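(* Let $P\subset\mathbb{C}$ be any planar shape and let $\mu$ be the harmonic measure on $\partial P$ for the domain $\hat{\mathbb{C}}\setminus P$ relative to $\infty$. Let $\Phi:\hat{\mathbb{C}}\setminus\overline{\mathbb{D}}\to\hat{\mathbb{C}}\setminus P$ be a conformal isomorphism with $\Phi(\infty)=\infty$. Then the function $g:\mathbb{D}\to\mathbb{C}$ defined by $$g(z)=\int_0^z \Phi'(1/x)\,dx$$ is locally univalent and gives a Euclidean development of the harmonic cap $\hat{P}_\mu$ (parametrized by $\mathbb{D}$ via $z\mapsto\Phi(1/z)$). That is, the map $\hat{\mathbb{C}}\setminus P\to\mathbb{C}$, $w\mapsto g(1/\Phi^{-1}(w))$, is a local isometry from $\hat{\mathbb{C}}\setminus P$ with the metric $\rho(P,\mu)$ to $(\mathbb{C},|dz|)$. Moreover, there exist planar shapes $P$ for which the harmonic cap is not planar, i.e. for which this development is not injective.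
   Context: Here $\hat{\mathbb{C}}=\mathbb{C}\cup\{\infty\}$ is the Riemann sphere and $\mathbb{D}$ is the open unit disk. A planar shape is a compact, connected subset $P$ of the Euclidean plane $\mathbb{C}$ that contains at least two points and has connected complement. The harmonic measure $\mu$ of $P$ (relative to $\infty$) is the push-forward under $\Phi$ (via its almost-everywhere defined boundary values) of normalized Lebesgue measure on the unit circle $S^1$, where $\Phi:\hat{\mathbb{C}}\setminus\overline{\mathbb{D}}\to\hat{\mathbb{C}}\setminus P$ is a conformal isomorphism fixing $\infty$. The Green function of $P$ is $G_P(z)=\log|\Phi^{-1}(z)|$ for $z\in\mathbb{C}\setminus P$ and $G_P(z)=0$ for $z\in P$. For this $\mu$, the metric $\rho(P,\mu)$ is the continuous conformal metric $e^{-2G_P(z)}|dz|$ on $\mathbb{C}$, extended by continuity across $\infty$ to $\hat{\mathbb{C}}$. It coincides with $|dz|$ on $P$, and its curvature distribution $-\Delta\log\rho=2\Delta G_P$ equals $4\pi\mu$. The harmonic cap $\hat{P}_\mu$ is the complement $\hat{\mathbb{C}}\setminus P$ equipped with $\rho(P,\mu)$; this metric is flat on the simply connected domain $\hat{\mathbb{C}}\setminus P$. A Euclidean development of the cap is a local isometry $D:\hat{P}_\mu\to(\mathbb{C},|dz|)$. The cap is called planar if its development $D$ is injective. At $x=0$, $\Phi'(1/x)$ is understood as its limit, the nonzero number $\lim_{\zeta\to\infty}\Phi'(\zeta)$. *)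

(* Defs.v *)
From Stdlib Require Export Reals List ClassicalEpsilon.
From Coquelicot Require Export Coquelicot.
Open Scope R_scope.

(** * Planar shapes *)

Definition compact_set (P : C -> Prop) : Prop :=
  forall F : (C -> Prop) -> Prop,
    (forall V, F V -> open V) ->
    (forall z, P z -> exists V, F V /\ V z) ->
    exists l : list (C -> Prop),
      List.Forall F l /\ forall z, P z -> exists V, List.In V l /\ V z.

Definition connected_set (P : C -> Prop) : Prop :=
  forall V W : C -> Prop,
    open V -> open W ->
    (forall z, P z -> V z \/ W z) ->
    (exists z, P z /\ V z) -> (exists z, P z /\ W z) ->
    exists z, P z /\ V z /\ W z.

Definition planar_shape (P : C -> Prop) : Prop :=
  compact_set P /\ connected_set P /\
  (exists z w : C, P z /\ P w /\ z <> w) /\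
  connected_set (fun z => ~ P z).

(** * The Riemann sphere *)

Inductive sphere : Type :=
| Fin (z : C)
| Inf.

(** Two charts: the coordinate [z] off infinity, and [u = 1/z] off zero.
    [coord] takes an irrelevant value outside the domain of its chart. *)
Inductive chart : Type := chart_fin | chart_inf.

Definition in_chart (c : chart) (p : sphere) : Prop :=
  match c with
  | chart_fin => p <> Inf
  | chart_inf => p <> Fin 0
  end.

Definition coord (c : chart) (p : sphere) : C :=
  match c, p with
  | chart_fin, Fin z => z
  | chart_fin, Inf => 0
  | chart_inf, Fin z => (/ z)%C
  | chart_inf, Inf => 0
  end.

Definition param (c : chart) (u : C) : sphere :=
  match c with
  | chart_fin => Fin u
  | chart_inf => if Ceq_dec u 0 then Inf else Fin (/ u)
  end.

Definition exterior_disk (p : sphere) : Prop :=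
  match p with
  | Fin z => 1 < Cmod z
  | Inf => True
  end.

Definition complement (P : C -> Prop) (p : sphere) : Prop :=
  match p with
  | Fin z => ~ P z
  | Inf => True
  end.

(** The [locally] clause is needed because of the irrelevant values of
    [coord d]: near [p], the values of [F] have to stay in the chart [d]. *)
Definition sphere_holomorphic_at (F : sphere -> sphere) (p : sphere) : Prop :=
  exists c d : chart,
    in_chart c p /\ in_chart d (F p) /\
    locally (coord c p) (fun z : C => in_chart d (F (param c z))) /\
    ex_derive (K := C_AbsRing) (V := C_NormedModule)
      (fun z : C => coord d (F (param c z))) (coord c p).

(** [Phi] restricts to a conformal isomorphism of [U] onto [V], with inverse
    [Psi]; the values of [Phi] off [U] and of [Psi] off [V] are irrelevant. *)
Definition conformal_isomorphism (U V : sphere -> Prop)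
    (Phi Psi : sphere -> sphere) : Prop :=
  (forall p, U p -> V (Phi p)) /\
  (forall q, V q -> U (Psi q)) /\
  (forall p, U p -> Psi (Phi p) = p) /\
  (forall q, V q -> Phi (Psi q) = q) /\
  (forall p, U p -> sphere_holomorphic_at Phi p) /\
  (forall q, V q -> sphere_holomorphic_at Psi q).

Definition riemann_map (P : C -> Prop) (Phi Psi : sphere -> sphere) : Prop :=
  conformal_isomorphism exterior_disk (complement P) Phi Psi /\ Phi Inf = Inf.

(** * The harmonic cap *)

Definition green (P : C -> Prop) (Psi : sphere -> sphere) (z : C) : R :=
  if excluded_middle_informative (P z) then 0
  else ln (Cmod (coord chart_fin (Psi (Fin z)))).

(** A conformal metric on the sphere is given by its density with respect to
    the Euclidean length element [|du|] of each chart. *)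
Definition conformal_metric : Type := chart -> C -> R.

(** [exp (-2 G) |dz|]; since [|dz| = |du| / |u|^2] for [z = 1/u], its density
    in the chart at infinity is [exp (-2 G(1/u)) / |u|^2], extended to [u = 0]
    by continuity. *)
Definition cap_metric (P : C -> Prop) (Psi : sphere -> sphere) :
    conformal_metric :=
  fun c u =>
    match c with
    | chart_fin => exp (- 2 * green P Psi u)
    | chart_inf =>
        let dens (v : C) := exp (- 2 * green P Psi (/ v)) / Cmod v ^ 2 in
        if Ceq_dec u 0
        then lim (T := R_CompleteSpace) (filtermap dens (locally' (RtoC 0)))
        else dens u
    end.

Definition injective_on {A B : Type} (U : A -> Prop) (f : A -> B) : Prop :=
  forall x y, U x -> U y -> f x = f y -> x = y.

(** Riemannian local isometry from [(U, rho)] to the Euclidean plane: [D] is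
    locally injective and real differentiable, and its differential takes
    [rho]-length to Euclidean length, on every tangent vector. *)
Definition local_isometry (U : sphere -> Prop) (rho : conformal_metric)
    (D : sphere -> C) : Prop :=
  forall (p : sphere) (c : chart), U p -> in_chart c p ->
    (exists V : C -> Prop,
       open V /\ V (coord c p) /\ injective_on V (fun u => D (param c u))) /\
    exists L : C -> C,
      filterdiff (K := R_AbsRing) (U := C_R_NormedModule)
        (V := C_R_NormedModule)
        (fun u : C => D (param c u)) (locally (coord c p)) L /\
      forall v : C, Cmod (L v) = rho c (coord c p) * Cmod v.

Definition euclidean_development (P : C -> Prop) (Psi : sphere -> sphere)
    (D : sphere -> C) : Prop :=
  local_isometry (complement P) (cap_metric P Psi) D.

(** A development is unique up to a Euclidean isometry, so that its
    injectivity does not depend on its choice. *)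
Definition planar_cap (P : C -> Prop) (Psi : sphere -> sphere) : Prop :=
  forall D : sphere -> C,
    euclidean_development P Psi D -> injective_on (complement P) D.

(** * The map [g] *)

Definition unit_disk (z : C) : Prop := Cmod z < 1.

Definition locally_univalent (U : C -> Prop) (f : C -> C) : Prop :=
  forall z : C, U z ->
    ex_derive (K := C_AbsRing) (V := C_NormedModule) f z /\
    exists V : C -> Prop, open V /\ V z /\ injective_on V f.

(** [C_derive] and [C_lim] take limits along the real direction only; they
    agree with the complex derivative and limit whenever these exist. *)
Definition Phi_derive (Phi : sphere -> sphere) (zeta : C) : C :=
  C_derive (fun z : C => coord chart_fin (Phi (Fin z))) zeta.

Definition cap_integrand (Phi : sphere -> sphere) (x : C) : C :=
  if Ceq_dec x 0 then C_lim (fun y : C => Phi_derive Phi (/ y)) 0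
  else Phi_derive Phi (/ x).

(** The integral from [0] to [z] is taken along the straight segment. *)
Definition cap_g (Phi : sphere -> sphere) (z : C) : C :=
  (z * RInt (V := C_R_CompleteNormedModule)
         (fun t : R => cap_integrand Phi (t * z)) 0 1)%C.

(** [w |-> g (1 / Phi^-1 (w))], with [1 / infinity = 0]. *)
Definition cap_development (Phi Psi : sphere -> sphere) (w : sphere) : C :=
  cap_g Phi (coord chart_inf (Psi w)).

(* Main.v *)
Require Import Defs.
From Stdlib Require Import Lra Lia Classical ClassicalEpsilon FunctionalExtensionality Ranalysis5.
Local Open Scope R_scope.

(** Put [x = 1 / Phi^-1 (w)]. The derivative of [D = g (1 / Phi^-1 (w))] is
    [- x^2], and [|x|^2 = exp (-2 G)]. The analytic point is that [g' = Phi' (1/x)],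
    for which [Phi'] has to be continuous: Goursat's lemma in logarithmic
    coordinates gives a Cauchy estimate, which makes the derivative of a
    holomorphic function locally Lipschitz.

    For a non-planar cap take an arrow [P], symmetric about the real axis: a real
    shaft with two barbs starting at its head [0] and running close to the shaft.
    By symmetry [g] takes conjugate values at conjugate points, so that it is not
    injective once it has a real value off the real axis. In the upper half of the
    disk [Im g] is positive near [0]. Deep inside the corridor between the shaft
    and a barb it is minus the integral of [sin (2 t) d|Phi (exp (- i t))|] over
    the shaft, that is, over the arc of the unit circle from there to the tip
    [t = PI] of the shaft, and the part [t < PI / 2] of this integral prevails. *)

(** * Complex differentiability *)

(** Both halves rest on an integration by parts. With [m x = x^2 Phi (1/x)] it gives [g = 2 N - m],
    where [N' x = m x / x]. So the primitive is built from first derivatives of [Phi] alone, and for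
    the arrow [g] is controlled by the values of [Phi] near the unit circle, without an estimate of
    [Phi'] there. The arrow is designed backwards from its Riemann map, which is explicit in the
    coordinate [1 / w]: an affine image [T] of the Koebe function, followed by
    [10 (T - 1) + kap Log T]. The image of the disk is the plane without three half-lines pointing
    to the left. It is stable under translation to the right, which makes the arrow connected. The
    corridor sits at [cos t = 4/5] on the circle. For small [kap], [Im N] is there close to
    [- sin t (sin^2 t / 3 - (1 - cos t) / 2)], which is negative as soon as [cos t > 1/2], while [m]
    is close to [0] deep inside the corridor. At [4/5] the margin is [0.012], and [kap = 1/1000]
    keeps the errors below it. *)

Definition near (z : C) (Q : C -> Prop) : Prop :=
  exists d : R, 0 < d /\ forall y : C, Cmod (y - z) < d -> Q y.

Definition has_deriv (f : C -> C) (z l : C) : Prop :=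
  forall eps : R, 0 < eps ->
    near z (fun y => Cmod (f y - f z - l * (y - z)) <= eps * Cmod (y - z)).

Definition cont_at (f : C -> C) (z : C) : Prop :=
  forall eps : R, 0 < eps -> near z (fun y => Cmod (f y - f z) < eps).

Lemma Cmod_minus_sym (x y : C) : Cmod (x - y) = Cmod (y - x).
Proof. rewrite <- Cmod_opp. f_equal. ring. Qed.

Lemma Cmod_triangle_minus (x y z : C) :
  Cmod (x - z) <= Cmod (x - y) + Cmod (y - z).
Proof.
  replace (x - z)%C with ((x - y) + (y - z))%C by ring. apply Cmod_triangle.
Qed.

Lemma Cmod_triangle_sub (x y : C) : Cmod (x - y) <= Cmod x + Cmod y.
Proof.
  unfold Cminus. rewrite <- (Cmod_opp y). apply Cmod_triangle.
Qed.

Lemma Cmod_triangle_inv (x y : C) : Cmod x - Cmod y <= Cmod (x - y).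
Proof.
  generalize (Cmod_triangle (x - y) y). replace (x - y + y)%C with x by ring. lra.
Qed.

Lemma Cmod_self (x : C) : Cmod (x - x) = 0.
Proof. replace (x - x)%C with (RtoC 0) by ring. apply Cmod_0. Qed.

Lemma Cmod_eq (x y : C) : Cmod (x - y) = 0 -> x = y.
Proof.
  intros H. apply Cmod_eq_0 in H.
  replace x with (x - y + y)%C by ring. rewrite H. ring.
Qed.

Lemma Cmod_small_eq (x y : C) :
  (forall eps : R, 0 < eps -> Cmod (x - y) <= eps) -> x = y.
Proof.
  intros H. apply Cmod_eq.
  destruct (Rle_lt_dec (Cmod (x - y)) 0) as [Hl|Hl].
  - generalize (Cmod_ge_0 (x - y)). lra.
  - specialize (H (Cmod (x - y) / 2)). lra.
Qed.

Lemma ball_convex (p q c : C) (r t : R) :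
  Cmod (p - c) < r -> Cmod (q - c) < r -> 0 <= t <= 1 -> Cmod (p + t * (q - p) - c) < r.
Proof.
  intros Hp Hq Ht.
  replace (p + t * (q - p) - c)%C with ((1 - t)%R * (p - c) + t * (q - c))%C
    by (rewrite RtoC_minus; ring).
  eapply Rle_lt_trans; [apply Cmod_triangle|].
  rewrite !Cmod_mult, !Cmod_R, !Rabs_pos_eq by lra.
  destruct (Rle_lt_dec t (1 / 2)); nra.
Qed.

Lemma disk_convex (p q : C) (t : R) :
  Cmod p < 1 -> Cmod q < 1 -> 0 <= t <= 1 -> Cmod (p + t * (q - p)) < 1.
Proof.
  assert (E : forall z : C, (z - 0)%C = z) by (intros; ring).
  intros Hp Hq Ht. rewrite <- (E (p + t * (q - p))%C).
  apply ball_convex; rewrite ?E; assumption.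
Qed.

Lemma Cmod_Re_Lipschitz (y z : C) : Rabs (fst y - fst z) <= Cmod (y - z).
Proof.
  generalize (Rmax_Cmod (y - z)%C), (Rmax_l (Rabs (fst (y - z)%C)) (Rabs (snd (y - z)%C))).
  simpl. unfold Rminus. lra.
Qed.

Lemma Cmod_Im_Lipschitz (y z : C) : Rabs (snd y - snd z) <= Cmod (y - z).
Proof.
  generalize (Rmax_Cmod (y - z)%C), (Rmax_r (Rabs (fst (y - z)%C)) (Rabs (snd (y - z)%C))).
  simpl. unfold Rminus. lra.
Qed.

Lemma Cmod_le_Rabs (x y : R) : Cmod (x, y) <= Rabs x + Rabs y.
Proof.
  replace (x, y) with (RtoC x + y * Ci)%C by (apply injective_projections; simpl; ring).
  eapply Rle_trans; [apply Cmod_triangle|]. rewrite Cmod_mult, Cmod_Ci, !Cmod_R. lra.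
Qed.

Lemma near_and (z : C) (Q1 Q2 : C -> Prop) :
  near z Q1 -> near z Q2 -> near z (fun y => Q1 y /\ Q2 y).
Proof.
  intros [d1 [H1 K1]] [d2 [H2 K2]]. exists (Rmin d1 d2). split.
  - now apply Rmin_pos.
  - intros y Hy. split.
    + apply K1. generalize (Rmin_l d1 d2); lra.
    + apply K2. generalize (Rmin_r d1 d2); lra.
Qed.

Lemma near_imp (z : C) (Q1 Q2 : C -> Prop) :
  (forall y, Q1 y -> Q2 y) -> near z Q1 -> near z Q2.
Proof. intros H [d [H1 K1]]. exists d. split; auto. Qed.

Lemma near_self (z : C) (Q : C -> Prop) : near z Q -> Q z.
Proof. intros [d [H K]]. apply K. now rewrite Cmod_self. Qed.

Lemma near_all (z : C) (Q : C -> Prop) : (forall y, Q y) -> near z Q.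
Proof. intros H. exists 1. split; [lra|auto]. Qed.

Lemma near_ball (z w : C) (r : R) :
  Cmod (z - w) < r -> near z (fun y => Cmod (y - w) < r).
Proof.
  intros H. exists (r - Cmod (z - w)). split; [lra|].
  intros y Hy. generalize (Cmod_triangle_minus y z w). lra.
Qed.

Lemma near_cont (f : C -> C) (z : C) (Q : C -> Prop) :
  cont_at f z -> near (f z) Q -> near z (fun y => Q (f y)).
Proof.
  intros Hf [d [Hd K]]. destruct (Hf d Hd) as [e [He L]].
  exists e. split; auto.
Qed.

Lemma near_neq (z w : C) : z <> w -> near z (fun y => y <> w).
Proof.
  intros H. assert (Hp : 0 < Cmod (z - w)).
  { apply Cmod_gt_0. intros K. apply H.
    replace z with (z - w + w)%C by ring. rewrite K. ring. }
  exists (Cmod (z - w)). split; [exact Hp|]. intros y Hy E.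
  subst y. rewrite Cmod_minus_sym in Hy. lra.
Qed.

Lemma ball_Cmod (z : C) (d : posreal) (y : C) :
  Cmod (y - z) < d -> @ball C_UniformSpace z d y.
Proof.
  intros H. split.
  - exact (Rle_lt_trans _ _ _ (Cmod_Re_Lipschitz y z) H).
  - exact (Rle_lt_trans _ _ _ (Cmod_Im_Lipschitz y z) H).
Qed.

Lemma Cmod_ball (z : C) (d : posreal) (y : C) :
  @ball C_UniformSpace z d y -> Cmod (y - z) < 2 * d.
Proof.
  intros [H1 H2].
  assert (H1' : Rabs (fst y - fst z) < d) by exact H1.
  assert (H2' : Rabs (snd y - snd z) < d) by exact H2.
  replace (y - z)%C with (fst y - fst z, snd y - snd z)
    by (apply injective_projections; simpl; ring).
  eapply Rle_lt_trans; [apply Cmod_le_Rabs|]. lra.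
Qed.

(** [C] carries two uniform structures, with square balls from the product and round balls from the
    modulus. They have the same neighbourhoods, and [near] serves for both. *)
Lemma locally_near (z : C) (Q : C -> Prop) :
  @locally C_UniformSpace z Q <-> near z Q.
Proof.
  split.
  - intros [d H]. exists d. split; [apply cond_pos|].
    intros y Hy. apply H. now apply ball_Cmod.
  - intros [d [Hd H]]. assert (Hd2 : 0 < d / 2) by lra.
    exists (mkposreal _ Hd2). intros y Hy. apply H.
    apply Cmod_ball in Hy. simpl in Hy. lra.
Qed.

Lemma locally_AbsRing_near (z : C) (Q : C -> Prop) :
  @locally (AbsRing_UniformSpace C_AbsRing) z Q <-> near z Q.
Proof.
  split.
  - intros [d H]. exists d. split; [apply cond_pos|]. exact H.
  - intros [d [Hd H]]. exists (mkposreal _ Hd). exact H.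
Qed.

Lemma open_near (V : C -> Prop) :
  @open C_UniformSpace V <-> forall z, V z -> near z V.
Proof.
  split; intros H z Hz; specialize (H z Hz); now apply locally_near.
Qed.

Lemma is_derive_has_deriv (f : C -> C) (z l : C) :
  is_derive (K := C_AbsRing) (V := C_NormedModule) f z l <-> has_deriv f z l.
Proof.
  split.
  - intros [_ H] eps Heps.
    specialize (H z (fun P HP => HP) (mkposreal eps Heps)).
    apply locally_AbsRing_near in H. revert H. apply near_imp.
    intros y Hy. unfold norm, minus, plus, opp, scal in Hy; simpl in Hy.
    replace (f y - f z - l * (y - z))%C with (f y + - f z + - ((y + - z) * l))%C
      by ring. exact Hy.
  - intros H. split.
    + apply is_linear_scal_l.
    + intros x Hx.
      (* [filterdiff] asks for the expansion at every limit [x] of the filter at [z]; the plane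
         being separated, this is [z] itself. *)
      assert (E : z = x).
      { apply Cmod_small_eq. intros eps Heps.
        assert (L : @locally (AbsRing_UniformSpace C_AbsRing) x
                      (fun y => Cmod (y - x) < eps)).
        { apply locally_AbsRing_near. exists eps. split; auto. }
        specialize (Hx _ L). simpl in Hx. apply locally_AbsRing_near in Hx.
        apply near_self in Hx. simpl in Hx. lra. }
      subst x. intros eps.
      apply locally_AbsRing_near. generalize (H eps (cond_pos eps)).
      apply near_imp. intros y Hy.
      unfold norm, minus, plus, opp, scal; simpl.
      replace (f y + - f z + - mult (y + - z) l)%C
        with (f y - f z - l * (y - z))%C by (unfold mult; simpl; ring).
      exact Hy.
Qed.

Lemma has_deriv_cont (f : C -> C) (z l : C) : has_deriv f z l -> cont_at f z.
Proof.
  intros H eps Heps. destruct (H 1 Rlt_0_1) as [d [Hd K]].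
  assert (Hl := Cmod_ge_0 l).
  assert (He : 0 < eps / (Cmod l + 2)) by (apply Rdiv_lt_0_compat; lra).
  exists (Rmin d (eps / (Cmod l + 2))). split; [now apply Rmin_pos|].
  intros y Hy. assert (Hy1 : Cmod (y - z) < d) by (generalize (Rmin_l d (eps / (Cmod l + 2))); lra).
  assert (Hy2 : Cmod (y - z) < eps / (Cmod l + 2)) by (generalize (Rmin_r d (eps / (Cmod l + 2))); lra).
  specialize (K y Hy1).
  replace (f y - f z)%C with ((f y - f z - l * (y - z)) + l * (y - z))%C by ring.
  eapply Rle_lt_trans; [apply Cmod_triangle|]. rewrite Cmod_mult.
  apply (Rmult_lt_compat_r (Cmod l + 2)) in Hy2; [|lra].
  unfold Rdiv in Hy2. rewrite Rmult_assoc, Rinv_l, Rmult_1_r in Hy2 by lra.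
  generalize (Cmod_ge_0 (y - z)). nra.
Qed.

Lemma has_deriv_ext_near (f g : C -> C) (z l : C) :
  near z (fun y => f y = g y) -> has_deriv f z l -> has_deriv g z l.
Proof.
  intros He H eps Heps. specialize (H eps Heps).
  assert (Ez := near_self _ _ He). simpl in Ez.
  apply (near_imp z _ _ (fun y K => K) ) in He.
  generalize (near_and _ _ _ He H). apply near_imp.
  intros y [E K]. now rewrite <- E, <- Ez.
Qed.

Lemma has_deriv_ext (f g : C -> C) (z l : C) :
  (forall y, f y = g y) -> has_deriv f z l -> has_deriv g z l.
Proof. intros H. apply has_deriv_ext_near. now apply near_all. Qed.

Lemma has_deriv_val (f : C -> C) (z l m : C) :
  has_deriv f z l -> l = m -> has_deriv f z m.
Proof. now intros H <-. Qed.

Lemma has_deriv_unique (f : C -> C) (z l1 l2 : C) :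
  has_deriv f z l1 -> has_deriv f z l2 -> l1 = l2.
Proof.
  intros H1 H2. apply is_derive_has_deriv in H1, H2.
  rewrite <- (is_C_derive_unique f z l1), <- (is_C_derive_unique f z l2); auto.
Qed.

Lemma has_deriv_const (c z : C) : has_deriv (fun _ => c) z 0.
Proof.
  intros eps Heps. apply near_all. intros y.
  replace (c - c - 0 * (y - z))%C with (RtoC 0) by ring. rewrite Cmod_0.
  generalize (Cmod_ge_0 (y - z)). nra.
Qed.

Lemma has_deriv_id (z : C) : has_deriv (fun x => x) z 1.
Proof.
  intros eps Heps. apply near_all. intros y.
  replace (y - z - 1 * (y - z))%C with (RtoC 0) by ring. rewrite Cmod_0.
  generalize (Cmod_ge_0 (y - z)). nra.
Qed.

Lemma has_deriv_plus (f g : C -> C) (z l m : C) :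
  has_deriv f z l -> has_deriv g z m ->
  has_deriv (fun x => f x + g x)%C z (l + m)%C.
Proof.
  intros Hf Hg. apply is_derive_has_deriv.
  apply is_derive_has_deriv in Hf, Hg.
  exact (is_derive_plus (K := C_AbsRing) (V := C_NormedModule) f g z l m Hf Hg).
Qed.

Lemma has_deriv_comp (f g : C -> C) (z l m : C) :
  has_deriv f (g z) l -> has_deriv g z m ->
  has_deriv (fun x => f (g x)) z (l * m)%C.
Proof.
  intros Hf Hg eps Heps.
  assert (Hc := has_deriv_cont _ _ _ Hg).
  assert (Hl := Cmod_ge_0 l). assert (Hm := Cmod_ge_0 m).
  (* Half of [eps] pays for the remainder of [f], half for that of [g]. The bound [1] in [e2] gives
     the Lipschitz constant [Cmod m + 1] of [g] at [z]. *)
  set (e1 := eps / (2 * (Cmod m + 1))).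
  assert (He1 : 0 < e1) by (apply Rdiv_lt_0_compat; lra).
  set (e2 := Rmin 1 (eps / (2 * (Cmod l + 1)))).
  assert (He2 : 0 < e2).
  { apply Rmin_pos; [lra|apply Rdiv_lt_0_compat; lra]. }
  generalize (near_and _ _ _ (Hg e2 He2) (near_cont g z _ Hc (Hf e1 He1))).
  apply near_imp. intros y [K1 K2].
  replace (f (g y) - f (g z) - l * m * (y - z))%C with
    ((f (g y) - f (g z) - l * (g y - g z)) + l * (g y - g z - m * (y - z)))%C by ring.
  eapply Rle_trans; [apply Cmod_triangle|]. rewrite Cmod_mult.
  assert (K3 : Cmod (g y - g z) <= (Cmod m + 1) * Cmod (y - z)).
  { replace (g y - g z)%C with ((g y - g z - m * (y - z)) + m * (y - z))%C by ring.
    eapply Rle_trans; [apply Cmod_triangle|]. rewrite Cmod_mult.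
    generalize (Rmin_l 1 (eps / (2 * (Cmod l + 1)))), (Cmod_ge_0 (y - z)).
    fold e2. nra. }
  assert (A1 : e1 * (Cmod m + 1) = eps / 2) by (unfold e1; field; lra).
  assert (A2 : Cmod l * e2 <= eps / 2).
  { apply Rle_trans with ((Cmod l + 1) * (eps / (2 * (Cmod l + 1)))).
    - generalize (Rmin_r 1 (eps / (2 * (Cmod l + 1)))). fold e2. nra.
    - right. field. lra. }
  assert (Hn := Cmod_ge_0 (y - z)). assert (Hn2 := Cmod_ge_0 (g y - g z)).
  apply Rle_trans with (e1 * ((Cmod m + 1) * Cmod (y - z)) + Cmod l * (e2 * Cmod (y - z))).
  - apply Rplus_le_compat; [nra|]. apply Rmult_le_compat_l; auto.
  - nra.
Qed.

Lemma has_deriv_mult (f g : C -> C) (z l m : C) :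
  has_deriv f z l -> has_deriv g z m ->
  has_deriv (fun x => f x * g x)%C z (l * g z + f z * m)%C.
Proof.
  intros Hf Hg eps Heps.
  assert (Hc := has_deriv_cont _ _ _ Hg).
  assert (B1 := Cmod_ge_0 (f z)). assert (B2 := Cmod_ge_0 (g z)). assert (B3 := Cmod_ge_0 l).
  set (e1 := eps / (3 * (Cmod (g z) + 1))).
  set (e2 := eps / (3 * (Cmod (f z) + 1))).
  set (e3 := Rmin 1 (eps / (3 * (Cmod l + 1)))).
  assert (He1 : 0 < e1) by (apply Rdiv_lt_0_compat; lra).
  assert (He2 : 0 < e2) by (apply Rdiv_lt_0_compat; lra).
  assert (He3' : 0 < eps / (3 * (Cmod l + 1))) by (apply Rdiv_lt_0_compat; lra).
  assert (He3 : 0 < e3) by (apply Rmin_pos; lra).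
  generalize (near_and _ _ _ (near_and _ _ _ (Hf e1 He1) (Hg e2 He2)) (Hc e3 He3)).
  apply near_imp. intros y [[K1 K2] K3].
  replace (f y * g y - f z * g z - (l * g z + f z * m) * (y - z))%C with
    ((f y - f z - l * (y - z)) * g y + f z * (g y - g z - m * (y - z))
      + l * (y - z) * (g y - g z))%C by ring.
  eapply Rle_trans; [apply Cmod_triangle|].
  eapply Rle_trans; [apply Rplus_le_compat_r, Cmod_triangle|].
  rewrite !Cmod_mult.
  assert (G : Cmod (g y) <= Cmod (g z) + 1).
  { generalize (Cmod_triangle_inv (g y) (g z)), (Rmin_l 1 (eps / (3 * (Cmod l + 1)))).
    fold e3. lra. }
  assert (A1 : e1 * (Cmod (g z) + 1) = eps / 3) by (unfold e1; field; lra).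
  assert (A2 : e2 * (Cmod (f z) + 1) = eps / 3) by (unfold e2; field; lra).
  assert (A3 : eps / (3 * (Cmod l + 1)) * (Cmod l + 1) = eps / 3) by (field; lra).
  assert (A4 := Rmin_r 1 (eps / (3 * (Cmod l + 1)))). fold e3 in A4.
  assert (Hn := Cmod_ge_0 (y - z)). assert (Hg0 := Cmod_ge_0 (g y)).
  assert (H1 : Cmod (f y - f z - l * (y - z)) * Cmod (g y) <= eps / 3 * Cmod (y - z)).
  { rewrite <- A1. apply Rle_trans with (e1 * Cmod (y - z) * (Cmod (g z) + 1)).
    - apply Rmult_le_compat; auto. apply Cmod_ge_0.
    - right; ring. }
  assert (H2 : Cmod (f z) * Cmod (g y - g z - m * (y - z)) <= eps / 3 * Cmod (y - z)).
  { rewrite <- A2. apply Rle_trans with ((Cmod (f z) + 1) * (e2 * Cmod (y - z))).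
    - apply Rmult_le_compat; auto; try lra. apply Cmod_ge_0.
    - right; ring. }
  assert (H3 : Cmod l * Cmod (y - z) * Cmod (g y - g z) <= eps / 3 * Cmod (y - z)).
  { assert (Cmod l * Cmod (g y - g z) <= eps / 3).
    { rewrite <- A3. rewrite Rmult_comm. apply Rmult_le_compat; try lra. apply Cmod_ge_0. }
    nra. }
  lra.
Qed.

Lemma has_deriv_scal (f : C -> C) (c z l : C) :
  has_deriv f z l -> has_deriv (fun x => c * f x)%C z (c * l)%C.
Proof.
  intros H. replace (c * l)%C with (0 * f z + c * l)%C by ring.
  apply (has_deriv_mult (fun _ => c) f); auto. apply has_deriv_const.
Qed.

Lemma has_deriv_minus (f g : C -> C) (z l m : C) :
  has_deriv f z l -> has_deriv g z m ->
  has_deriv (fun x => f x - g x)%C z (l - m)%C.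
Proof.
  intros Hf Hg. replace (l - m)%C with (l + - (1) * m)%C by ring.
  apply has_deriv_ext with (fun x => f x + - (1) * g x)%C.
  - intros y. ring.
  - apply has_deriv_plus; auto. now apply has_deriv_scal.
Qed.

(** The remainder is exactly [(y - z)^2 / (z^2 y)], and [Cmod y >= Cmod z / 2] within [Cmod z / 2]
    of [z]. *)
Lemma has_deriv_inv_id (z : C) : z <> 0 -> has_deriv Cinv z (- / (z * z))%C.
Proof.
  intros Hz eps Heps.
  assert (Hp : 0 < Cmod z) by now apply Cmod_gt_0.
  set (e := eps * (Cmod z * Cmod z * (Cmod z / 2))).
  assert (He : 0 < e) by (unfold e; repeat apply Rmult_lt_0_compat; lra).
  exists (Rmin (Cmod z / 2) e). split; [apply Rmin_pos; lra|].
  intros y Hy.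
  assert (H1 : Cmod (y - z) < Cmod z / 2) by (generalize (Rmin_l (Cmod z / 2) e); lra).
  assert (H2 : Cmod (y - z) < e) by (generalize (Rmin_r (Cmod z / 2) e); lra).
  assert (H3 : Cmod z / 2 <= Cmod y).
  { generalize (Cmod_triangle_inv z y). rewrite (Cmod_minus_sym z y). lra. }
  assert (Hy0 : y <> 0) by (apply Cmod_gt_0; lra).
  replace (/ y - / z - - / (z * z) * (y - z))%C
    with ((y - z) * ((y - z) * / (z * z * y)))%C by (field; auto).
  assert (Hzz : (z * z * y)%C <> 0) by (repeat apply Cmult_neq_0; auto).
  rewrite !Cmod_mult, Cmod_inv, !Cmod_mult by exact Hzz.
  rewrite (Rmult_comm (Cmod (y - z))).
  apply Rmult_le_compat_r; [apply Cmod_ge_0|].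
  apply Rle_trans with (e * / (Cmod z * Cmod z * (Cmod z / 2))).
  - apply Rmult_le_compat.
    + apply Cmod_ge_0.
    + left. apply Rinv_0_lt_compat. repeat apply Rmult_lt_0_compat; lra.
    + lra.
    + apply Rinv_le_contravar.
      * repeat apply Rmult_lt_0_compat; lra.
      * apply Rmult_le_compat_l; auto. apply Rmult_le_pos; lra.
  - right. unfold e. field. lra.
Qed.

Lemma cont_at_Cinv (z : C) : z <> 0 -> cont_at Cinv z.
Proof. intros Hz. exact (has_deriv_cont _ _ _ (has_deriv_inv_id z Hz)). Qed.

Lemma has_deriv_inv (f : C -> C) (z l : C) :
  f z <> 0 -> has_deriv f z l ->
  has_deriv (fun x => / f x)%C z (- l / (f z * f z))%C.
Proof.
  intros Hz Hf. replace (- l / (f z * f z))%C with (- / (f z * f z) * l)%C by (field; auto).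
  apply (has_deriv_comp Cinv f); auto. now apply has_deriv_inv_id.
Qed.

(** The bridge from complex derivatives to the real mean value theorem and to [RInt]. *)
Lemma has_deriv_along (f : C -> C) (p d l : C) (t : R) :
  has_deriv f (p + t * d)%C l ->
  is_derive (V := C_R_NormedModule) (fun u : R => f (p + u * d)%C) t (l * d)%C.
Proof.
  intros H. split; [apply is_linear_scal_l|].
  intros x Hx.
  apply (is_filter_lim_locally_unique (K := R_AbsRing) (V := R_NormedModule)) in Hx.
  subst x.
  intros eps.
  assert (Hd := Cmod_ge_0 d).
  assert (He : 0 < eps / (Cmod d + 1)) by (apply Rdiv_lt_0_compat; [apply cond_pos|lra]).
  destruct (H _ He) as [r [Hr K]].
  assert (Hr' : 0 < r / (Cmod d + 1)) by (apply Rdiv_lt_0_compat; lra).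
  exists (mkposreal _ Hr'). intros u Hu.
  unfold ball in Hu; simpl in Hu; unfold AbsRing_ball, abs, minus, plus, opp in Hu; simpl in Hu.
  assert (En : @norm R_AbsRing R_NormedModule (minus u t) = Cmod (RtoC u - RtoC t)).
  { rewrite <- RtoC_minus, Cmod_R. reflexivity. }
  assert (E : Cmod (p + u * d - (p + t * d)) = Cmod (RtoC u - RtoC t) * Cmod d).
  { rewrite <- Cmod_mult. f_equal. ring. }
  assert (B : Cmod (RtoC u - RtoC t) < r / (Cmod d + 1)).
  { rewrite <- RtoC_minus, Cmod_R. exact Hu. }
  assert (K1 : Cmod (p + u * d - (p + t * d)) < r).
  { rewrite E. apply (Rmult_lt_compat_r (Cmod d + 1)) in B; [|lra].
    replace (r / (Cmod d + 1) * (Cmod d + 1)) with r in B by (field; lra).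
    generalize (Cmod_ge_0 (RtoC u - RtoC t)). nra. }
  specialize (K _ K1). rewrite E in K.
  rewrite <- Cmod_norm.
  apply Rle_trans with (Cmod (f (p + u * d) - f (p + t * d) - l * (p + u * d - (p + t * d)))%C).
  { right. f_equal.
    unfold minus, plus, opp, scal; simpl. unfold prod_plus, prod_opp, prod_scal; simpl.
    unfold scal, plus, opp, mult; simpl. unfold mult; simpl.
    apply injective_projections; simpl; ring. }
  eapply Rle_trans; [exact K|].
  apply Rle_trans with (eps * Cmod (RtoC u - RtoC t)); [|right; now rewrite <- En].
  rewrite (Rmult_comm (Cmod (RtoC u - RtoC t))), <- Rmult_assoc.
  apply Rmult_le_compat_r; [apply Cmod_ge_0|].
  apply Rle_trans with (eps / (Cmod d + 1) * (Cmod d + 1)); [|right; field; lra].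
  apply Rmult_le_compat_l; lra.
Qed.

Lemma is_derive_Re (f : R -> C) (t : R) (l : C) :
  is_derive (V := C_R_NormedModule) f t l -> is_derive (fun u => Re (f u)) t (Re l).
Proof.
  intros H.
  apply (filterdiff_ext_lin _ (fun y : R => fst (scal y l : C_R_NormedModule))).
  - apply (filterdiff_comp' (U := R_NormedModule) (V := C_R_NormedModule)
             (W := R_NormedModule) f (fun p : C_R_NormedModule => fst p) t
             (fun y => scal y l) (fun p : C_R_NormedModule => fst p)).
    + exact H.
    + apply filterdiff_linear. apply is_linear_fst.
  - intros y. destruct l as [a b]. reflexivity.
Qed.

Lemma is_derive_Im (f : R -> C) (t : R) (l : C) :
  is_derive (V := C_R_NormedModule) f t l -> is_derive (fun u => Im (f u)) t (Im l).
Proof.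
  intros H.
  apply (filterdiff_ext_lin _ (fun y : R => snd (scal y l : C_R_NormedModule))).
  - apply (filterdiff_comp' (U := R_NormedModule) (V := C_R_NormedModule)
             (W := R_NormedModule) f (fun p : C_R_NormedModule => snd p) t
             (fun y => scal y l) (fun p : C_R_NormedModule => snd p)).
    + exact H.
    + apply filterdiff_linear. apply is_linear_snd.
  - intros y. destruct l as [a b]. reflexivity.
Qed.

Lemma Re_le_Cmod (z : C) : Re z <= Cmod z.
Proof. generalize (re_le_Cmod z), (Rle_abs (Re z)). lra. Qed.

Lemma MVT_unit (phi dphi : R -> R) :
  (forall t, 0 <= t <= 1 -> is_derive phi t (dphi t)) ->
  exists t, 0 <= t <= 1 /\ phi 1 - phi 0 = dphi t.
Proof.
  intros H. destruct (MVT_gen phi 0 1 dphi) as [t [Ht E]].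
  - rewrite Rmin_left, Rmax_right by lra. intros x Hx. apply H. lra.
  - rewrite Rmin_left, Rmax_right by lra. intros x Hx.
    apply continuity_pt_filterlim. apply (ex_derive_continuous phi).
    exists (dphi x). apply H. lra.
  - rewrite Rmin_left, Rmax_right in Ht by lra. exists t. split; [lra|].
    rewrite E. ring.
Qed.

(** The mean value theorem fails for complex values, so it is applied to a real function: the real
    part of [f z - c z] multiplied by the conjugate of its own total increment [w]. This yields
    [Cmod w ^ 2 <= Cmod w * (M * Cmod d)]. *)
Lemma segment_mean_value (f : C -> C) (l : R -> C) (p d c : C) (M : R) :
  (forall t : R, 0 <= t <= 1 -> has_deriv f (p + t * d)%C (l t)) ->
  (forall t : R, 0 <= t <= 1 -> Cmod (l t - c) <= M) ->
  Cmod (f (p + d) - f p - c * d)%C <= M * Cmod d.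
Proof.
  intros Hd HM.
  set (w := (f (p + d) - f p - c * d)%C).
  set (F := fun z => (Cconj w * (f z - c * z))%C).
  assert (HF : forall t : R, 0 <= t <= 1 ->
             is_derive (fun u : R => Re (F (p + u * d)%C)) t (Re (Cconj w * (l t - c) * d)%C)).
  { intros t Ht. apply (is_derive_Re (fun u : R => F (p + u * d)%C)).
    apply has_deriv_along. unfold F. apply has_deriv_scal. apply has_deriv_minus; auto.
    replace c with (c * 1)%C at 2 by ring. apply has_deriv_scal, has_deriv_id. }
  destruct (MVT_unit _ _ HF) as [t [Ht E]].
  assert (E1 : Re (F (p + 1 * d)%C) - Re (F (p + 0 * d)%C) = Cmod w ^ 2).
  { replace (p + 1 * d)%C with (p + d)%C by ring.
    replace (p + 0 * d)%C with p by ring.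
    transitivity (Re (F (p + d) - F p)%C); [reflexivity|].
    replace (F (p + d) - F p)%C with (w * Cconj w)%C.
    2:{ unfold F. unfold w at 1. ring. }
    rewrite <- Cmod2_conj. reflexivity. }
  rewrite E1 in E.
  assert (H := Re_le_Cmod (Cconj w * (l t - c) * d)%C).
  rewrite <- E, !Cmod_mult, Cmod_conj in H.
  assert (Hw := Cmod_ge_0 w). assert (Hdd := Cmod_ge_0 d).
  assert (Hl : Cmod (l t - c) * Cmod d <= M * Cmod d) by (apply Rmult_le_compat_r; auto).
  destruct (Rle_lt_dec (Cmod w) (M * Cmod d)) as [|Hn]; auto.
  assert (H0 : 0 <= Cmod (l t - c) * Cmod d) by (apply Rmult_le_pos; auto; apply Cmod_ge_0).
  set (B := (M * Cmod d)%R) in *. set (N := (Cmod (l t - c) * Cmod d)%R) in *.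
  rewrite Rmult_assoc in H. fold N in H. clearbody B N.
  clear - H Hw Hl Hn H0. set (W := Cmod w) in *. clearbody W. nra.
Qed.

(** The Cauchy-Riemann equations are built in: the [y]-partials are prescribed as [- vx] and [ux].
    The roles of [x] and [y] differ as in [is_derive_filterdiff], where one partial is continuous
    near the point and the other is given at the point. *)
Lemma has_deriv_of_partials (u v ux vx : R -> R -> R) (x y : R) :
  near (x, y) (fun p => is_derive (fun a => u a (snd p)) (fst p) (ux (fst p) (snd p))) ->
  near (x, y) (fun p => is_derive (fun a => v a (snd p)) (fst p) (vx (fst p) (snd p))) ->
  is_derive (fun b => u x b) y (- vx x y) ->
  is_derive (fun b => v x b) y (ux x y) ->
  continuous (fun p : R * R => ux (fst p) (snd p)) (x, y) ->
  continuous (fun p : R * R => vx (fst p) (snd p)) (x, y) ->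
  has_deriv (fun p => (u (fst p) (snd p), v (fst p) (snd p))) (x, y) (ux x y, vx x y).
Proof.
  intros Hu Hv Huy Hvy Cu Cv.
  assert (Fu := is_derive_filterdiff u x y ux _
                  (proj2 (locally_near _ _) Hu) Huy Cu).
  assert (Fv := is_derive_filterdiff v x y vx _
                  (proj2 (locally_near _ _) Hv) Hvy Cv).
  destruct Fu as [_ Fu]. destruct Fv as [_ Fv].
  specialize (Fu (x, y) (fun P HP => HP)). specialize (Fv (x, y) (fun P HP => HP)).
  intros eps Heps. assert (He : 0 < eps / 2) by lra.
  specialize (Fu (mkposreal _ He)). specialize (Fv (mkposreal _ He)).
  apply locally_near in Fu. apply locally_near in Fv.
  generalize (near_and _ _ _ Fu Fv). apply near_imp.
  intros [a b] [Ku Kv]. simpl in Ku, Kv.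
  assert (En : forall w : C, w = ((a, b) - (x, y))%C -> @norm R_AbsRing C_R_NormedModule w = Cmod w).
  { intros w _. symmetry. exact (Cmod_norm w). }
  specialize (En _ eq_refl).
  assert (Ku' : Rabs (u a b - u x y - ((a - x) * ux x y + (b - y) * - vx x y))
                <= eps / 2 * Cmod ((a, b) - (x, y))%C).
  { rewrite <- En. exact Ku. }
  assert (Kv' : Rabs (v a b - v x y - ((a - x) * vx x y + (b - y) * ux x y))
                <= eps / 2 * Cmod ((a, b) - (x, y))%C).
  { rewrite <- En. exact Kv. }
  clear Ku Kv. simpl.
  match goal with |- Cmod ?w <= _ => remember w as W end.
  rewrite (surjective_pairing W). eapply Rle_trans; [apply Cmod_le_Rabs|].
  assert (H1 : Rabs (fst W) <= eps / 2 * Cmod ((a, b) - (x, y))%C).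
  { eapply Rle_trans; [right|exact Ku']. subst W. simpl. f_equal. ring. }
  assert (H2 : Rabs (snd W) <= eps / 2 * Cmod ((a, b) - (x, y))%C).
  { eapply Rle_trans; [right|exact Kv']. subst W. simpl. f_equal. ring. }
  lra.
Qed.

(** * The complex exponential *)

Definition cexp (z : C) : C := (exp (fst z) * cos (snd z), exp (fst z) * sin (snd z)).

Lemma cexp_deriv (z : C) : has_deriv cexp z (cexp z).
Proof.
  destruct z as [x y].
  apply (has_deriv_of_partials (fun a b => exp a * cos b) (fun a b => exp a * sin b)
     (fun a b => exp a * cos b) (fun a b => exp a * sin b) x y).
  - apply near_all. intros [a b]; simpl. auto_derive; auto. ring.
  - apply near_all. intros [a b]; simpl. auto_derive; auto. ring.
  - auto_derive; auto. ring.
  - auto_derive; auto. ring.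
  - apply (continuous_mult (fun p : R * R => exp (fst p)) (fun p : R * R => cos (snd p))).
    + apply (continuous_comp fst exp). apply continuous_fst.
      apply (ex_derive_continuous exp). auto_derive; auto.
    + apply (continuous_comp snd cos). apply continuous_snd.
      apply (ex_derive_continuous cos). auto_derive; auto.
  - apply (continuous_mult (fun p : R * R => exp (fst p)) (fun p : R * R => sin (snd p))).
    + apply (continuous_comp fst exp). apply continuous_fst.
      apply (ex_derive_continuous exp). auto_derive; auto.
    + apply (continuous_comp snd sin). apply continuous_snd.
      apply (ex_derive_continuous sin). auto_derive; auto.
Qed.

Lemma Cmod_cexp (z : C) : Cmod (cexp z) = exp (fst z).
Proof.
  unfold Cmod, cexp. simpl fst; simpl snd.
  replace ((exp (fst z) * cos (snd z)) ^ 2 + (exp (fst z) * sin (snd z)) ^ 2)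
    with (exp (fst z) ^ 2 * (Rsqr (sin (snd z)) + Rsqr (cos (snd z)))) by (unfold Rsqr; ring).
  rewrite sin2_cos2, Rmult_1_r. apply sqrt_pow2. left; apply exp_pos.
Qed.

Lemma cexp_neq_0 (z : C) : cexp z <> 0.
Proof. apply Cmod_gt_0. rewrite Cmod_cexp. apply exp_pos. Qed.

Lemma cexp_2PI (s : R) : cexp (s, 2 * PI) = cexp (s, 0).
Proof.
  unfold cexp; simpl. now rewrite cos_2PI, sin_2PI, cos_0, sin_0.
Qed.

(** * Choice and bisection of rectangles *)

Lemma choice_function (X Y : Type) (R : X -> Y -> Prop) :
  (forall x, exists y, R x y) -> exists f : X -> Y, forall x, R x (f x).
Proof.
  intros H. exists (fun x => proj1_sig (constructive_indefinite_description _ (H x))).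
  intros x. now destruct (constructive_indefinite_description _ (H x)).
Qed.

(** If the whole rectangle is bad, so is one of its quarters, and so on; the nested bad rectangles
    shrink to a point, where the local hypothesis makes the small ones good. All rectangles are
    similar to the first one, [h] being the ratio. *)
Lemma bisection_2d (A B a0 c0 : R) (Q : R -> R -> R -> Prop) :
  0 < A -> 0 < B ->
  let inside a c h := a0 <= a /\ a + h * A <= a0 + A /\ c0 <= c /\ c + h * B <= c0 + B in
  (forall a c h, 0 < h -> inside a c h ->
     Q a c (h / 2) -> Q (a + h / 2 * A) c (h / 2) ->
     Q a (c + h / 2 * B) (h / 2) -> Q (a + h / 2 * A) (c + h / 2 * B) (h / 2) ->
     Q a c h) ->
  (forall x y, a0 <= x <= a0 + A -> c0 <= y <= c0 + B ->
     exists d, 0 < d /\ forall a c h, 0 < h < d -> inside a c h ->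
       a <= x <= a + h * A -> c <= y <= c + h * B -> Q a c h) ->
  Q a0 c0 1.
Proof.
  intros HA HB inside Hstep Hloc.
  apply NNPP. intros HN.
  set (bad := fun (h : R) (p : R * R) => inside (fst p) (snd p) h /\ ~ Q (fst p) (snd p) h).
  set (sub := fun (h : R) (p q : R * R) =>
     fst p <= fst q /\ fst q + h / 2 * A <= fst p + h * A /\
     snd p <= snd q /\ snd q + h / 2 * B <= snd p + h * B).
  (* The badness of the current rectangle is put under the existential, so that choice gives a total
     function [next]. *)
  assert (Hnext : forall np : nat * (R * R), exists q, bad ((/ 2) ^ fst np) (snd np) ->
     bad ((/ 2) ^ S (fst np)) q /\ sub ((/ 2) ^ fst np) (snd np) q).
  { intros [n [a c]]. cbn [fst snd].
    assert (Hh : 0 < (/ 2) ^ n) by (apply pow_lt; lra).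
    replace ((/ 2) ^ S n) with ((/ 2) ^ n / 2) by (simpl; lra).
    set (h := (/ 2) ^ n) in *. clearbody h.
    destruct (classic (bad h (a, c))) as [[Hi HQ]|]; [|exists (a, c); tauto].
    unfold bad, sub, inside in *. simpl in *.
    assert (0 < h * A) by now apply Rmult_lt_0_compat.
    assert (0 < h * B) by now apply Rmult_lt_0_compat.
    destruct (classic (Q a c (h / 2))) as [Q1|Q1].
    2:{ exists (a, c). intros _. simpl. repeat split; try assumption; lra. }
    destruct (classic (Q (a + h / 2 * A) c (h / 2))) as [Q2|Q2].
    2:{ exists (a + h / 2 * A, c). intros _. simpl. repeat split; try assumption; lra. }
    destruct (classic (Q a (c + h / 2 * B) (h / 2))) as [Q3|Q3].
    2:{ exists (a, c + h / 2 * B). intros _. simpl. repeat split; try assumption; lra. }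
    destruct (classic (Q (a + h / 2 * A) (c + h / 2 * B) (h / 2))) as [Q4|Q4].
    2:{ exists (a + h / 2 * A, c + h / 2 * B). intros _. simpl.
        repeat split; try assumption; lra. }
    exfalso. apply HQ. now apply Hstep. }
  destruct (choice_function _ _ _ Hnext) as [next Hn]. clear Hnext.
  set (s := fix s (n : nat) : R * R := match n with O => (a0, c0) | S m => next (m, s m) end).
  assert (Hs : forall n, bad ((/ 2) ^ n) (s n)).
  { induction n as [|n IH].
    - split; [|exact HN]. unfold inside; simpl. lra.
    - simpl s. exact (proj1 (Hn (n, s n) IH)). }
  assert (Hsub : forall n, sub ((/ 2) ^ n) (s n) (s (S n))).
  { intros n. exact (proj2 (Hn (n, s n) (Hs n))). }
  assert (Hmono : forall n m,
     fst (s n) <= fst (s (n + m)%nat) /\ snd (s n) <= snd (s (n + m)%nat) /\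
     fst (s (n + m)%nat) + (/ 2) ^ (n + m) * A <= fst (s n) + (/ 2) ^ n * A /\
     snd (s (n + m)%nat) + (/ 2) ^ (n + m) * B <= snd (s n) + (/ 2) ^ n * B).
  { intros n m. induction m as [|m IH].
    - rewrite Nat.add_0_r. lra.
    - rewrite Nat.add_succ_r. destruct (Hsub (n + m)%nat) as [U1 [U2 [U3 U4]]].
      replace ((/ 2) ^ S (n + m)) with ((/ 2) ^ (n + m) / 2) by (simpl; lra). lra. }
  (* Every left endpoint lies below every right endpoint, so that the suprema of the left and lower
     endpoints lie in all the rectangles. *)
  assert (Hcross : forall n m,
     fst (s m) <= fst (s n) + (/ 2) ^ n * A /\ snd (s m) <= snd (s n) + (/ 2) ^ n * B).
  { intros n m.
    assert (P1 : 0 < (/ 2) ^ n) by (apply pow_lt; lra).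
    assert (P2 : 0 < (/ 2) ^ m) by (apply pow_lt; lra).
    assert (0 < (/ 2) ^ n * A) by now apply Rmult_lt_0_compat.
    assert (0 < (/ 2) ^ n * B) by now apply Rmult_lt_0_compat.
    assert (0 < (/ 2) ^ m * A) by now apply Rmult_lt_0_compat.
    assert (0 < (/ 2) ^ m * B) by now apply Rmult_lt_0_compat.
    destruct (Nat.le_ge_cases n m) as [L|L].
    - destruct (Hmono n (m - n)%nat) as [V1 [V2 [V3 V4]]].
      replace (n + (m - n))%nat with m in * by lia. lra.
    - destruct (Hmono m (n - m)%nat) as [V1 [V2 [V3 V4]]].
      replace (m + (n - m))%nat with n in * by lia. lra. }
  destruct (completeness (fun r => exists n, r = fst (s n))) as [x [Hx1 Hx2]].
  { exists (fst (s 0%nat) + (/ 2) ^ 0 * A). intros r [n ->]. apply Hcross. }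
  { exists (fst (s 0%nat)). now exists 0%nat. }
  destruct (completeness (fun r => exists n, r = snd (s n))) as [y [Hy1 Hy2]].
  { exists (snd (s 0%nat) + (/ 2) ^ 0 * B). intros r [n ->]. apply Hcross. }
  { exists (snd (s 0%nat)). now exists 0%nat. }
  assert (Lx : forall n, fst (s n) <= x <= fst (s n) + (/ 2) ^ n * A).
  { intros n. split; [apply Hx1; now exists n|].
    apply Hx2. intros r [m ->]. apply Hcross. }
  assert (Ly : forall n, snd (s n) <= y <= snd (s n) + (/ 2) ^ n * B).
  { intros n. split; [apply Hy1; now exists n|].
    apply Hy2. intros r [m ->]. apply Hcross. }
  assert (X0 := Lx 0%nat). assert (Y0 := Ly 0%nat). simpl in X0, Y0.
  destruct (Hloc x y) as [d [Hd K]]; [lra|lra|].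
  destruct (pow_lt_1_zero (/ 2)) with (y := d) as [n Hdn].
  { rewrite Rabs_pos_eq; lra. }
  { exact Hd. }
  specialize (Hdn n (Nat.le_refl n)).
  assert (P1 : 0 < (/ 2) ^ n) by (apply pow_lt; lra).
  rewrite Rabs_pos_eq in Hdn by lra.
  destruct (Hs n) as [Hi HQ]. apply HQ. apply K; auto.
Qed.

(** * Goursat's lemma *)

(** Contour integral along [p + t d]. The line is kept fixed and only the bounds vary, so that
    subdividing a side is the additivity of [RInt]. *)
Definition seg (f : C -> C) (p d : C) (a b : R) : C :=
  RInt (V := C_R_CompleteNormedModule) (fun t : R => f (p + t * d) * d)%C a b.

Definition cont_on_seg (f : C -> C) (p d : C) (a b : R) : Prop :=
  forall t : R, a <= t <= b -> cont_at f (p + t * d)%C.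

Lemma RInt_C_ext (f g : R -> C) (a b : R) :
  (forall t, Rmin a b < t < Rmax a b -> f t = g t) ->
  RInt (V := C_R_CompleteNormedModule) f a b = RInt (V := C_R_CompleteNormedModule) g a b :> C.
Proof. exact (RInt_ext (V := C_R_CompleteNormedModule) f g a b). Qed.

Lemma RInt_C_unique (f : R -> C) (a b : R) (l : C) :
  is_RInt (V := C_R_NormedModule) f a b l ->
  RInt (V := C_R_CompleteNormedModule) f a b = l :> C.
Proof. exact (is_RInt_unique (V := C_R_CompleteNormedModule) f a b l). Qed.

Lemma continuous_along (f : C -> C) (p d : C) (t : R) :
  cont_at f (p + t * d)%C ->
  continuous (T := R_UniformSpace) (U := C_R_NormedModule) (fun u : R => f (p + u * d)%C) t.
Proof.
  intros Hf P HP. apply locally_near in HP.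
  destruct (near_cont f _ P Hf HP) as [e [He K]].
  assert (Hd := Cmod_ge_0 d).
  assert (Hr : 0 < e / (Cmod d + 1)) by (apply Rdiv_lt_0_compat; lra).
  exists (mkposreal _ Hr). intros u Hu. apply K.
  replace (p + u * d - (p + t * d))%C with ((u - t)%R * d)%C by (rewrite RtoC_minus; ring).
  rewrite Cmod_mult, Cmod_R.
  assert (Hu' : Rabs (u - t) < e / (Cmod d + 1)) by exact Hu.
  apply (Rmult_lt_compat_r (Cmod d + 1)) in Hu'; [|lra].
  replace (e / (Cmod d + 1) * (Cmod d + 1)) with e in Hu' by (field; lra).
  generalize (Rabs_pos (u - t)). nra.
Qed.

Lemma cont_at_mult_r (f : C -> C) (c z : C) :
  cont_at f z -> cont_at (fun w => f w * c)%C z.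
Proof.
  intros H eps Heps. assert (Hc := Cmod_ge_0 c).
  assert (He : 0 < eps / (Cmod c + 1)) by (apply Rdiv_lt_0_compat; lra).
  generalize (H _ He). apply near_imp. intros y Hy.
  replace (f y * c - f z * c)%C with ((f y - f z) * c)%C by ring. rewrite Cmod_mult.
  apply (Rmult_lt_compat_r (Cmod c + 1)) in Hy; [|lra].
  replace (eps / (Cmod c + 1) * (Cmod c + 1)) with eps in Hy by (field; lra).
  generalize (Cmod_ge_0 (f y - f z)). nra.
Qed.

Lemma seg_ex (f : C -> C) (p d : C) (a b : R) :
  a <= b -> cont_on_seg f p d a b ->
  ex_RInt (V := C_R_CompleteNormedModule) (fun t : R => f (p + t * d) * d)%C a b.
Proof.
  intros Hab H. apply (ex_RInt_continuous (V := C_R_CompleteNormedModule)).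
  rewrite Rmin_left, Rmax_right by exact Hab.
  intros t Ht. apply (continuous_along (fun z => (f z * d)%C)).
  apply cont_at_mult_r. auto.
Qed.

Lemma seg_Chasles (f : C -> C) (p d : C) (a b c : R) :
  a <= b -> b <= c -> cont_on_seg f p d a c ->
  (seg f p d a b + seg f p d b c = seg f p d a c)%C.
Proof.
  intros Hab Hbc H. unfold seg.
  apply (RInt_Chasles (V := C_R_CompleteNormedModule) (fun t : R => f (p + t * d) * d)%C a b c).
  - apply seg_ex; auto. intros t Ht. apply H. lra.
  - apply seg_ex; auto. intros t Ht. apply H. lra.
Qed.

Lemma seg_plus (f g : C -> C) (p d : C) (a b : R) :
  a <= b -> cont_on_seg f p d a b -> cont_on_seg g p d a b ->
  seg (fun z => f z + g z)%C p d a b = (seg f p d a b + seg g p d a b)%C.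
Proof.
  intros Hab Hf Hg. unfold seg.
  transitivity (RInt (V := C_R_CompleteNormedModule)
    (fun t : R => plus (f (p + t * d) * d)%C (g (p + t * d) * d)%C) a b).
  - apply RInt_C_ext. intros t _. apply Cmult_plus_distr_r.
  - exact (RInt_plus (V := C_R_CompleteNormedModule) _ _ a b
             (seg_ex f p d a b Hab Hf) (seg_ex g p d a b Hab Hg)).
Qed.

Lemma seg_primitive (F f : C -> C) (p d : C) (a b : R) :
  a <= b -> (forall t : R, a <= t <= b -> has_deriv F (p + t * d)%C (f (p + t * d)%C)) ->
  cont_on_seg f p d a b ->
  seg f p d a b = (F (p + b * d) - F (p + a * d))%C.
Proof.
  intros Hab HF Hf. unfold seg. apply RInt_C_unique.
  apply (is_RInt_derive (V := C_R_CompleteNormedModule) (fun t : R => F (p + t * d)%C)).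
  - rewrite Rmin_left, Rmax_right by exact Hab. intros t Ht. apply has_deriv_along. auto.
  - rewrite Rmin_left, Rmax_right by exact Hab.
    intros t Ht. apply (continuous_along (fun z => (f z * d)%C)).
    apply cont_at_mult_r. auto.
Qed.

Lemma seg_bound (f : C -> C) (p d : C) (a b M : R) :
  a <= b -> cont_on_seg f p d a b ->
  (forall t : R, a <= t <= b -> Cmod (f (p + t * d)%C) <= M) ->
  Cmod (seg f p d a b) <= (b - a) * (M * Cmod d).
Proof.
  intros Hab Hf HM. rewrite Cmod_norm.
  apply (norm_RInt_le_const (V := C_R_NormedModule)
           (fun t : R => f (p + t * d) * d)%C a b); auto.
  - intros t Ht. rewrite <- Cmod_norm, Cmod_mult.
    apply Rmult_le_compat_r; [apply Cmod_ge_0|auto].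
  - exact (RInt_correct (V := C_R_CompleteNormedModule) _ _ _ (seg_ex f p d a b Hab Hf)).
Qed.

(** Counterclockwise: bottom and right side, then top and left side with reversed orientation. *)
Definition bdry (f : C -> C) (a b c d : R) : C :=
  (seg f (0, c) 1 a b + seg f (b, 0) Ci c d
   - seg f (0, d) 1 a b - seg f (a, 0) Ci c d)%C.

Definition hol_on_rect (f : C -> C) (a b c d : R) : Prop :=
  forall x y : R, a <= x <= b -> c <= y <= d -> exists l, has_deriv f (x, y) l.

Lemma horizontal_point (x y : R) : ((0, y) + x * 1)%C = (x, y).
Proof. apply injective_projections; simpl; ring. Qed.

Lemma vertical_point (x y : R) : ((x, 0) + y * Ci)%C = (x, y).
Proof. apply injective_projections; simpl; ring. Qed.

Lemma hol_on_rect_h (f : C -> C) (a b c d y : R) :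
  hol_on_rect f a b c d -> c <= y <= d -> cont_on_seg f (0, y) 1 a b.
Proof.
  intros H Hy t Ht. rewrite horizontal_point. destruct (H t y) as [l Hl]; auto.
  exact (has_deriv_cont _ _ _ Hl).
Qed.

Lemma hol_on_rect_v (f : C -> C) (a b c d x : R) :
  hol_on_rect f a b c d -> a <= x <= b -> cont_on_seg f (x, 0) Ci c d.
Proof.
  intros H Hx t Ht. rewrite vertical_point. destruct (H x t) as [l Hl]; auto.
  exact (has_deriv_cont _ _ _ Hl).
Qed.

Lemma hol_on_rect_sub (f : C -> C) (a b c d a' b' c' d' : R) :
  hol_on_rect f a b c d -> a <= a' -> b' <= b -> c <= c' -> d' <= d ->
  hol_on_rect f a' b' c' d'.
Proof. intros H ? ? ? ? x y Hx Hy. apply H; lra. Qed.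

Lemma bdry_split (f : C -> C) (a m b c n d : R) :
  a <= m -> m <= b -> c <= n -> n <= d -> hol_on_rect f a b c d ->
  bdry f a b c d =
    (bdry f a m c n + bdry f m b c n + bdry f a m n d + bdry f m b n d)%C.
Proof.
  intros H1 H2 H3 H4 H. unfold bdry.
  rewrite <- (seg_Chasles f (0, c) 1 a m b), <- (seg_Chasles f (0, d) 1 a m b),
    <- (seg_Chasles f (a, 0) Ci c n d), <- (seg_Chasles f (b, 0) Ci c n d);
    auto; try ring.
  - apply (hol_on_rect_v f a b c d); auto; lra.
  - apply (hol_on_rect_v f a b c d); auto; lra.
  - apply (hol_on_rect_h f a b c d); auto; lra.
  - apply (hol_on_rect_h f a b c d); auto; lra.
Qed.

Lemma bdry_plus (f g : C -> C) (a b c d : R) :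
  a <= b -> c <= d -> hol_on_rect f a b c d -> hol_on_rect g a b c d ->
  bdry (fun z => f z + g z)%C a b c d = (bdry f a b c d + bdry g a b c d)%C.
Proof.
  intros H1 H2 Hf Hg. unfold bdry.
  rewrite !seg_plus; auto; try ring;
  try (apply (hol_on_rect_v _ a b c d); auto; lra);
  try (apply (hol_on_rect_h _ a b c d); auto; lra).
Qed.

Lemma bdry_primitive (F f : C -> C) (a b c d : R) :
  a <= b -> c <= d -> (forall z, has_deriv F z (f z)) -> hol_on_rect f a b c d ->
  bdry f a b c d = 0.
Proof.
  intros H1 H2 HF Hf. unfold bdry.
  rewrite !(seg_primitive F f); auto;
  try (apply (hol_on_rect_v _ a b c d); auto; lra);
  try (apply (hol_on_rect_h _ a b c d); auto; lra).
  rewrite !horizontal_point, !vertical_point. ring.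
Qed.

Lemma bdry_bound (f : C -> C) (a b c d M : R) :
  a <= b -> c <= d -> hol_on_rect f a b c d ->
  (forall x y, a <= x <= b -> c <= y <= d -> Cmod (f (x, y)) <= M) ->
  Cmod (bdry f a b c d) <= 2 * ((b - a) + (d - c)) * M.
Proof.
  intros H1 H2 Hf HM. unfold bdry.
  assert (Sh : forall y, c <= y <= d -> Cmod (seg f (0, y) 1 a b) <= (b - a) * M).
  { intros y Hy. replace M with (M * Cmod 1) by (rewrite Cmod_1; ring). apply seg_bound; auto.
    - now apply (hol_on_rect_h _ a b c d).
    - intros t Ht. rewrite horizontal_point. now apply HM. }
  assert (Sv : forall x, a <= x <= b -> Cmod (seg f (x, 0) Ci c d) <= (d - c) * M).
  { intros x Hx. replace M with (M * Cmod Ci) by (rewrite Cmod_Ci; ring). apply seg_bound; auto.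
    - now apply (hol_on_rect_v _ a b c d).
    - intros t Ht. rewrite vertical_point. now apply HM. }
  assert (S1 := Sh c ltac:(lra)). assert (S2 := Sh d ltac:(lra)).
  assert (S3 := Sv a ltac:(lra)). assert (S4 := Sv b ltac:(lra)).
  eapply Rle_trans; [apply Cmod_triangle_sub|].
  eapply Rle_trans; [apply Rplus_le_compat_r, Cmod_triangle_sub|].
  eapply Rle_trans; [apply Rplus_le_compat_r, Rplus_le_compat_r, Cmod_triangle|].
  lra.
Qed.

(** Near each point [f] is affine up to [e] times the distance, and affine functions have vanishing
    boundary integrals. The resulting bound is proportional to the area, hence passes from four
    quarters to their union. *)
Lemma Goursat_rect (f : C -> C) (a b c d : R) :
  a < b -> c < d -> hol_on_rect f a b c d -> bdry f a b c d = 0.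
Proof.
  intros Hab Hcd Hf. apply Cmod_small_eq. intros eps Heps.
  set (A := b - a). set (B := d - c).
  assert (HA : 0 < A) by (unfold A; lra). assert (HB : 0 < B) by (unfold B; lra).
  (* Perimeter times a bound for the diameter. At scale [h] both shrink by [h], which gives the
     bound [e * K * (h * h)]. *)
  set (K := 2 * (A + B) * (A + B)).
  assert (HK : 0 < K) by (unfold K; repeat apply Rmult_lt_0_compat; lra).
  set (e := eps / K). assert (He : 0 < e) by now apply Rdiv_lt_0_compat.
  assert (G : Cmod (bdry f a (a + 1 * A) c (c + 1 * B)) <= e * K * (1 * 1)).
  2:{ replace (a + 1 * A) with b in G by (unfold A; ring).
      replace (c + 1 * B) with d in G by (unfold B; ring).
      replace (bdry f a b c d - 0)%C with (bdry f a b c d) by ring.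
      replace eps with (e * K * (1 * 1)); auto. unfold e. field. lra. }
  apply (bisection_2d A B a c
    (fun a' c' h => Cmod (bdry f a' (a' + h * A) c' (c' + h * B)) <= e * K * (h * h)));
    auto.
  - intros a' c' h Hh [I1 [I2 [I3 I4]]] Q1 Q2 Q3 Q4.
    assert (0 < h * A) by now apply Rmult_lt_0_compat.
    assert (0 < h * B) by now apply Rmult_lt_0_compat.
    rewrite (bdry_split f a' (a' + h / 2 * A) (a' + h * A) c' (c' + h / 2 * B) (c' + h * B));
      try lra.
    2:{ apply (hol_on_rect_sub f a b c d); auto; unfold A, B in *; lra. }
    replace (a' + h / 2 * A + h / 2 * A) with (a' + h * A) in * by field.
    replace (c' + h / 2 * B + h / 2 * B) with (c' + h * B) in * by field.
    eapply Rle_trans; [apply Cmod_triangle|].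
    eapply Rle_trans; [apply Rplus_le_compat_r, Cmod_triangle|].
    eapply Rle_trans; [apply Rplus_le_compat_r, Rplus_le_compat_r, Cmod_triangle|].
    replace (e * K * (h * h)) with (4 * (e * K * (h / 2 * (h / 2)))) by field.
    lra.
  - intros x y Hx Hy.
    destruct (Hf x y) as [l Hl]; [unfold A, B in *; lra|unfold A, B in *; lra|].
    destruct (Hl e He) as [r [Hr Kr]].
    exists (r / (A + B)). split; [apply Rdiv_lt_0_compat; lra|].
    intros a' c' h [Hh1 Hh2] [I1 [I2 [I3 I4]]] Jx Jy.
    assert (0 < h * A) by now apply Rmult_lt_0_compat.
    assert (0 < h * B) by now apply Rmult_lt_0_compat.
    assert (Hh3 : h * (A + B) < r).
    { apply (Rmult_lt_compat_r (A + B)) in Hh2; [|lra].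
      replace (r / (A + B) * (A + B)) with r in Hh2 by (field; lra). exact Hh2. }
    set (p := (x, y) : C) in *.
    set (aff := fun z : C => (f p + l * (z - p))%C).
    set (rem := fun z : C => (f z - aff z)%C).
    assert (Haff : forall z, has_deriv aff z l).
    { intros z. unfold aff. apply has_deriv_val with (0 + l * (1 - 0))%C; [|ring].
      apply has_deriv_plus; [apply has_deriv_const|]. apply has_deriv_scal.
      apply has_deriv_minus; [apply has_deriv_id|apply has_deriv_const]. }
    assert (Hfr : hol_on_rect f a' (a' + h * A) c' (c' + h * B)).
    { apply (hol_on_rect_sub f a b c d); auto; unfold A, B in *; lra. }
    assert (Har : hol_on_rect aff a' (a' + h * A) c' (c' + h * B)).
    { intros u v _ _. exists l. apply Haff. }
    assert (Hrr : hol_on_rect rem a' (a' + h * A) c' (c' + h * B)).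
    { intros u v Hu Hv. destruct (Hfr u v Hu Hv) as [m Hm].
      exists (m - l)%C. unfold rem. now apply has_deriv_minus. }
    assert (E : bdry f a' (a' + h * A) c' (c' + h * B) =
      (bdry aff a' (a' + h * A) c' (c' + h * B) + bdry rem a' (a' + h * A) c' (c' + h * B))%C).
    { rewrite <- bdry_plus; auto; try lra. f_equal.
      apply functional_extensionality. intros z. unfold rem. ring. }
    rewrite E.
    (* The affine part has an explicit quadratic primitive and drops out. *)
    rewrite (bdry_primitive (fun z => (f p * z + (l / 2) * ((z - p) * (z - p)))%C) aff); auto; try lra.
    2:{ intros z. unfold aff.
        apply has_deriv_val with
          (f p * 1 + (l / 2) * ((1 - 0) * (z - p) + (z - p) * (1 - 0)))%C.
        2:{ field. }
        apply has_deriv_plus; [apply has_deriv_scal, has_deriv_id|].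
        apply has_deriv_scal.
        assert (D : has_deriv (fun z => (z - p)%C) z (1 - 0)%C)
          by (apply has_deriv_minus; [apply has_deriv_id|apply has_deriv_const]).
        apply (has_deriv_mult (fun z => (z - p)%C) (fun z => (z - p)%C)); exact D. }
    rewrite Cplus_0_l.
    eapply Rle_trans.
    { apply (bdry_bound rem _ _ _ _ (e * (h * (A + B)))); auto; try lra.
      intros u v Hu Hv.
      assert (D : Cmod ((u, v) - p) <= h * (A + B)).
      { unfold p. replace ((u, v) - (x, y))%C with (u - x, v - y)
          by (apply injective_projections; simpl; ring).
        eapply Rle_trans; [apply Cmod_le_Rabs|].
        assert (Rabs (u - x) <= h * A) by (apply Rabs_le; lra).
        assert (Rabs (v - y) <= h * B) by (apply Rabs_le; lra). lra. }
      eapply Rle_trans; [|apply Rmult_le_compat_l; [lra|exact D]].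
      unfold rem, aff.
      replace (f (u, v) - (f p + l * ((u, v) - p)))%C with
        (f (u, v) - f p - l * ((u, v) - p))%C by ring.
      apply Kr. lra. }
    right. unfold K. ring.
Qed.

(** In logarithmic coordinates [z = b + exp w] the difference quotient at [b] is
    [2 pi i]-periodic, so that by Goursat its integral over a period is the
    same on the circle of radius [r] and on an arbitrarily small one. *)
Lemma Cauchy_estimate (f : C -> C) (b l : C) (r M : R) :
  0 < r ->
  (forall z, Cmod (z - b) <= r -> exists m, has_deriv f z m) ->
  has_deriv f b l ->
  (forall z, Cmod (z - b) = r -> Cmod (f z - f b) <= M) ->
  Cmod l <= M / r.
Proof.
  intros Hr Hf Hl HM.
  apply Rnot_lt_le. intros Hlt.
  set (eps := (Cmod l - M / r) / 2).
  assert (Heps : 0 < eps) by (unfold eps; lra).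
  destruct (Hl eps Heps) as [d [Hd K]].
  (* The left side of the rectangle: the circle of radius [exp s] lies inside the given one and in
     the range where the difference quotient is within [eps] of [l]. *)
  set (s := ln (Rmin (r / 2) (d / 2))).
  assert (Hm : 0 < Rmin (r / 2) (d / 2)) by (apply Rmin_pos; lra).
  assert (Es : exp s = Rmin (r / 2) (d / 2)) by (unfold s; now rewrite exp_ln).
  assert (Hs1 : exp s < r) by (rewrite Es; generalize (Rmin_l (r / 2) (d / 2)); lra).
  assert (Hs2 : exp s < d) by (rewrite Es; generalize (Rmin_r (r / 2) (d / 2)); lra).
  assert (Hs : s < ln r) by (apply exp_lt_inv; now rewrite exp_ln).
  assert (HPI := PI_RGT_0).
  set (q := fun w => ((f (b + cexp w) - f b) * / cexp w)%C).
  assert (Hq : forall w : C, fst w <= ln r -> exists m, has_deriv q w m).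
  { intros w Hw. destruct (Hf (b + cexp w)%C) as [m Hm'].
    { replace (b + cexp w - b)%C with (cexp w) by ring. rewrite Cmod_cexp.
      rewrite <- (exp_ln r Hr). destruct Hw as [Hw | ->]; [left; now apply exp_increasing|lra]. }
    eexists. unfold q. apply has_deriv_mult.
    - apply has_deriv_minus; [|apply has_deriv_const].
      apply (has_deriv_comp f (fun x => (b + cexp x)%C)); [exact Hm'|].
      apply has_deriv_plus; [apply has_deriv_const|apply cexp_deriv].
    - apply has_deriv_inv; [apply cexp_neq_0|apply cexp_deriv]. }
  assert (Hrect : hol_on_rect q s (ln r) 0 (2 * PI)).
  { intros x y Hx _. apply Hq. simpl. lra. }
  assert (G := Goursat_rect q s (ln r) 0 (2 * PI) Hs ltac:(lra) Hrect).
  (* By periodicity the two horizontal sides cancel, so that Goursat's lemma equates the two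
     vertical ones. *)
  assert (Eper : seg q (0, 2 * PI) 1 s (ln r) = seg q (0, 0) 1 s (ln r)).
  { unfold seg. apply RInt_C_ext. intros t _. rewrite !horizontal_point.
    unfold q. now rewrite cexp_2PI. }
  unfold bdry in G. rewrite Eper in G.
  assert (E : seg q (s, 0) Ci 0 (2 * PI) = seg q (ln r, 0) Ci 0 (2 * PI)).
  { apply Cmod_eq. rewrite Cmod_minus_sym. apply (f_equal Cmod) in G. rewrite Cmod_0 in G.
    eapply eq_trans; [|exact G]. f_equal. ring. }
  assert (B1 : Cmod (seg q (ln r, 0) Ci 0 (2 * PI)) <= (2 * PI - 0) * (M / r * Cmod Ci)).
  { apply seg_bound; [lra| |].
    - apply (hol_on_rect_v q s (ln r) 0 (2 * PI)); auto; lra.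
    - intros t Ht. rewrite vertical_point. unfold q.
      rewrite Cmod_mult, Cmod_inv by apply cexp_neq_0.
      rewrite Cmod_cexp; simpl fst. rewrite exp_ln by exact Hr.
      apply Rmult_le_compat_r; [left; now apply Rinv_0_lt_compat|].
      apply HM. replace (b + cexp (ln r, t) - b)%C with (cexp (ln r, t)) by ring.
      rewrite Cmod_cexp. simpl. now apply exp_ln. }
  set (rem := fun w => (q w - l)%C).
  assert (Hc : cont_on_seg (fun _ => l) (s, 0) Ci 0 (2 * PI)).
  { intros t _. exact (has_deriv_cont _ _ _ (has_deriv_const l _)). }
  assert (Hq' : cont_on_seg q (s, 0) Ci 0 (2 * PI)).
  { apply (hol_on_rect_v q s (ln r) 0 (2 * PI)); auto; lra. }
  assert (Hrem : cont_on_seg rem (s, 0) Ci 0 (2 * PI)).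
  { intros t Ht eps' Heps'. generalize (Hq' t Ht eps' Heps'). apply near_imp.
    intros y. unfold rem.
    now replace (q y - l - (q ((s, 0%R) + t * Ci) - l))%C
      with (q y - q ((s, 0%R) + t * Ci))%C by ring. }
  assert (E2 : seg q (s, 0) Ci 0 (2 * PI) =
    (seg (fun _ => l) (s, 0%R) Ci 0 (2 * PI) + seg rem (s, 0%R) Ci 0 (2 * PI))%C).
  { rewrite <- seg_plus; auto; try lra. f_equal. apply functional_extensionality.
    intros w. unfold rem. ring. }
  (* The constant part contributes [2 PI Ci l], the rest at most [2 PI eps]. Hence
     [Cmod l <= M / r + eps], which is absurd since [eps] is half of the gap. *)
  rewrite (seg_primitive (fun z => l * z)%C (fun _ => l)) in E2; auto; try lra.
  2:{ intros t _. apply has_deriv_val with (l * 1)%C; [|ring].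
      apply has_deriv_scal, has_deriv_id. }
  assert (B2 : Cmod (seg rem (s, 0) Ci 0 (2 * PI)) <= (2 * PI - 0) * (eps * Cmod Ci)).
  { apply seg_bound; [lra|exact Hrem|].
    intros t Ht. rewrite vertical_point. unfold rem, q.
    assert (Hz := cexp_neq_0 (s, t)).
    replace ((f (b + cexp (s, t)) - f b) * / cexp (s, t) - l)%C with
      ((f (b + cexp (s, t)) - f b - l * (b + cexp (s, t) - b)) * / cexp (s, t))%C
      by (field; exact Hz).
    rewrite Cmod_mult, Cmod_inv by exact Hz.
    apply Rle_trans with (eps * Cmod (cexp (s, t)) * / Cmod (cexp (s, t))).
    - apply Rmult_le_compat_r.
      + left. apply Rinv_0_lt_compat. now apply Cmod_gt_0.
      + replace (Cmod (cexp (s, t))) with (Cmod (b + cexp (s, t) - b)) by (f_equal; ring).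
        apply K. replace (b + cexp (s, t) - b)%C with (cexp (s, t)) by ring.
        rewrite Cmod_cexp. exact Hs2.
    - right. field. apply Cmod_gt_0 in Hz. lra. }
  rewrite Cmod_Ci, Rmult_1_r in B1, B2.
  assert (E3 : (l * ((s, 0%R) + (2 * PI)%R * Ci) - l * ((s, 0%R) + 0%R * Ci))%C
                = (l * ((2 * PI)%R * Ci))%C) by ring.
  rewrite E3 in E2.
  assert (F : Cmod (l * ((2 * PI)%R * Ci)) = 2 * PI * Cmod l).
  { rewrite !Cmod_mult, Cmod_Ci, Cmod_R, Rabs_pos_eq by lra. ring. }
  assert (T : 2 * PI * Cmod l <= 2 * PI * (M / r) + 2 * PI * eps).
  { rewrite <- F.
    replace (l * ((2 * PI)%R * Ci))%C with
      (seg q (ln r, 0%R) Ci 0 (2 * PI) - seg rem (s, 0%R) Ci 0 (2 * PI))%C.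
    2:{ rewrite <- E, E2. ring. }
    eapply Rle_trans; [apply Cmod_triangle_sub|]. lra. }
  assert (2 * PI * (Cmod l - M / r - eps) <= 0) by lra.
  assert (0 < Cmod l - M / r - eps) by (unfold eps; lra).
  assert (0 < 2 * PI * (Cmod l - M / r - eps)) by (apply Rmult_lt_0_compat; lra).
  lra.
Qed.

(** Two uses of the Cauchy estimate: for [f] near [a], and then for the
    increments [f (z + h) - f z]. *)
Lemma deriv_Lipschitz (f df : C -> C) (a : C) :
  near a (fun z => has_deriv f z (df z)) ->
  exists r L : R, 0 < r /\ 0 <= L /\
    forall y z, Cmod (y - a) < r -> Cmod (z - a) < r ->
      Cmod (df y - df z) <= L * Cmod (y - z).
Proof.
  intros Hf.
  assert (Hc := has_deriv_cont _ _ _ (near_self _ _ Hf)).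
  destruct (near_and _ _ _ Hf (Hc 1 Rlt_0_1)) as [R0 [HR K]].
  (* The points considered stay within [4 r] of [a], and the circles of radius [r] about them within
     [5 r < R0]. *)
  set (r := R0 / 8).
  assert (Hr : 0 < r) by (unfold r; lra).
  assert (Hdf : forall z, Cmod (z - a) < 4 * r -> Cmod (df z) <= 2 / r).
  { intros z Hz.
    assert (Hin : forall w, Cmod (w - z) <= r -> Cmod (w - a) < R0).
    { intros w Hw. generalize (Cmod_triangle_minus w z a). unfold r in *. lra. }
    apply (Cauchy_estimate f z); auto.
    - intros w Hw. exists (df w). apply K. auto.
    - apply K. unfold r in *; lra.
    - intros w Hw. generalize (Cmod_triangle_minus (f w) (f a) (f z)).
      rewrite (Cmod_minus_sym (f a)).
      destruct (K w) as [_ K1]; [apply Hin; lra|].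
      destruct (K z) as [_ K2]; [unfold r in *; lra|]. lra. }
  assert (Hlip : forall y z, Cmod (y - a) < 4 * r -> Cmod (z - a) < 4 * r ->
             Cmod (f y - f z) <= 2 / r * Cmod (y - z)).
  { intros y z Hy Hz.
    assert (S : Cmod (f (z + (y - z)) - f z - 0 * (y - z))%C <= 2 / r * Cmod (y - z)).
    { assert (Hin : forall t : R, 0 <= t <= 1 -> Cmod (z + t * (y - z) - a) < 4 * r).
      { intros t Ht. now apply ball_convex. }
      apply (segment_mean_value f (fun t => df (z + t * (y - z))%C)).
      - intros t Ht. apply K. specialize (Hin t Ht). unfold r in *; lra.
      - intros t Ht. replace (df (z + t * (y - z)) - 0)%C with (df (z + t * (y - z))%C) by ring.
        apply Hdf. auto. }
    replace (f y - f z)%C with (f (z + (y - z)) - f z - 0 * (y - z))%C; auto.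
    replace (z + (y - z))%C with y by ring. ring. }
  (* The derivative is at most [2 / r], so an increment of [f] is at most [2 / r * Cmod (y - z)]; a
     difference of two increments doubles this, and the second Cauchy estimate divides by [r]. *)
  exists r, (4 / r / r). split; [exact Hr|]. split.
  { left. repeat apply Rdiv_lt_0_compat; lra. }
  intros y z Hy Hz.
  set (g := fun w => (f (w + (y - z)) - f w)%C).
  assert (Hyz : Cmod (y - z) < 2 * r).
  { generalize (Cmod_triangle_minus y a z). rewrite (Cmod_minus_sym a z). lra. }
  assert (Hin : forall w, Cmod (w - z) <= r ->
     Cmod (w - a) < 2 * r /\ Cmod (w + (y - z) - a) < 4 * r).
  { intros w Hw. generalize (Cmod_triangle_minus w z a), (Cmod_triangle_minus (w + (y - z)) w a).
    replace (w + (y - z) - w)%C with (y - z)%C by ring. lra. }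
  assert (Hg : forall w, Cmod (w - z) <= r -> has_deriv g w (df (w + (y - z))%C - df w)%C).
  { intros w Hw. destruct (Hin w Hw) as [H1 H2]. unfold g.
    apply has_deriv_minus.
    2:{ apply K. unfold r in *; lra. }
    apply has_deriv_val with (df (w + (y - z))%C * (1 + 0))%C; [|ring].
    apply (has_deriv_comp f (fun w => (w + (y - z))%C)).
    - apply K. unfold r in *; lra.
    - apply has_deriv_plus; [apply has_deriv_id|apply has_deriv_const]. }
  assert (Eg : (df y - df z)%C = (df (z + (y - z))%C - df z)%C).
  { replace (z + (y - z))%C with y by ring. reflexivity. }
  rewrite Eg.
  replace (4 / r / r * Cmod (y - z)) with ((2 * (2 / r * Cmod (y - z))) / r) by (field; lra).
  apply (Cauchy_estimate g z); auto.
  - intros w Hw. eexists. now apply Hg.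
  - apply Hg. rewrite Cmod_self. lra.
  - intros w Hw.
    assert (Hb : forall w, Cmod (w - z) <= r -> Cmod (g w) <= 2 / r * Cmod (y - z)).
    { intros v Hv. destruct (Hin v Hv). unfold g.
      replace (Cmod (y - z)) with (Cmod (v + (y - z) - v)) by (f_equal; ring).
      apply Hlip; lra. }
    eapply Rle_trans; [apply Cmod_triangle_sub|].
    assert (B1 := Hb w ltac:(lra)). assert (B2 := Hb z ltac:(rewrite Cmod_self; lra)). lra.
Qed.

(** What makes [Phi'] integrable and the inverse function argument available, starting from bare
    complex differentiability. *)
Lemma deriv_cont (f df : C -> C) (a : C) :
  near a (fun z => has_deriv f z (df z)) -> cont_at df a.
Proof.
  intros H. destruct (deriv_Lipschitz f df a H) as [r [L [Hr [HL K]]]].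
  intros eps Heps. exists (Rmin r (eps / (L + 1))).
  assert (He : 0 < eps / (L + 1)) by (apply Rdiv_lt_0_compat; lra).
  split; [now apply Rmin_pos|]. intros y Hy.
  assert (H1 : Cmod (y - a) < r) by (generalize (Rmin_l r (eps / (L + 1))); lra).
  assert (H2 : Cmod (y - a) < eps / (L + 1)) by (generalize (Rmin_r r (eps / (L + 1))); lra).
  eapply Rle_lt_trans; [apply K; [exact H1|rewrite Cmod_self; exact Hr]|].
  apply (Rmult_lt_compat_r (L + 1)) in H2; [|lra].
  replace (eps / (L + 1) * (L + 1)) with eps in H2 by (field; lra).
  generalize (Cmod_ge_0 (y - a)). nra.
Qed.

(** * Local inversion *)

(** Continuity of the derivative allows both endpoints of the increment to move, as injectivity near
    [a] and the contraction in [locally_onto] require. *)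
Lemma strictly_differentiable (f df : C -> C) (a : C) :
  near a (fun z => has_deriv f z (df z)) ->
  forall eps, 0 < eps -> exists r, 0 < r /\
    forall y z, Cmod (y - a) < r -> Cmod (z - a) < r ->
      Cmod (f y - f z - df a * (y - z)) <= eps * Cmod (y - z).
Proof.
  intros Hf eps Heps.
  destruct (near_and _ _ _ Hf (deriv_cont f df a Hf eps Heps)) as [r [Hr K]].
  exists r. split; [exact Hr|]. intros y z Hy Hz.
  assert (Hin : forall t : R, 0 <= t <= 1 -> Cmod (z + t * (y - z) - a) < r).
  { intros t Ht. now apply ball_convex. }
  replace (f y) with (f (z + (y - z))%C) by (f_equal; ring).
  apply (segment_mean_value f (fun t => df (z + t * (y - z))%C)).
  - intros t Ht. apply K. auto.
  - intros t Ht. left. apply K. auto.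
Qed.

Lemma expanding_near (f df : C -> C) (a : C) :
  near a (fun z => has_deriv f z (df z)) -> df a <> 0 ->
  exists r, 0 < r /\
    forall y z, Cmod (y - a) < r -> Cmod (z - a) < r ->
      Cmod (df a) / 2 * Cmod (y - z) <= Cmod (f y - f z).
Proof.
  intros Hf H0. apply Cmod_gt_0 in H0.
  destruct (strictly_differentiable f df a Hf (Cmod (df a) / 2)) as [r [Hr K]]; [lra|].
  exists r. split; [exact Hr|]. intros y z Hy Hz. specialize (K y z Hy Hz).
  assert (E := Cmod_triangle_inv (df a * (y - z)) (df a * (y - z) - (f y - f z))).
  replace (df a * (y - z) - (df a * (y - z) - (f y - f z)))%C with (f y - f z)%C in E by ring.
  rewrite (Cmod_minus_sym (df a * (y - z))) in E. rewrite Cmod_mult in E. lra.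
Qed.

Lemma expanding_injective (f : C -> C) (a : C) (r k : R) :
  0 < k ->
  (forall y z, Cmod (y - a) < r -> Cmod (z - a) < r ->
      k * Cmod (y - z) <= Cmod (f y - f z)) ->
  injective_on (fun z => Cmod (z - a) < r) f.
Proof.
  intros Hk H y z Hy Hz E. specialize (H y z Hy Hz).
  rewrite E, Cmod_self in H. apply Cmod_eq. generalize (Cmod_ge_0 (y - z)). nra.
Qed.

(** Completeness of the plane, taken from [R] in each coordinate, with an explicit rate. *)
Lemma geometric_limit (z : nat -> C) (K : R) :
  (forall n, Cmod (z (S n) - z n) <= K * (/ 2) ^ n) ->
  exists l, forall n, Cmod (l - z n) <= 4 * K * (/ 2) ^ n.
Proof.
  intros H.
  assert (Hp : forall n, 0 < (/ 2) ^ n) by (intros n; apply pow_lt; lra).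
  assert (HK : 0 <= K).
  { specialize (H 0%nat). simpl in H. generalize (Cmod_ge_0 (z 1%nat - z 0%nat)). lra. }
  assert (Hnk : forall n k, Cmod (z (n + k)%nat - z n) <= 2 * K * (/ 2) ^ n * (1 - (/ 2) ^ k)).
  { intros n k. induction k as [|k IH].
    - rewrite Nat.add_0_r, Cmod_self. simpl. lra.
    - rewrite Nat.add_succ_r. eapply Rle_trans; [apply (Cmod_triangle_minus _ (z (n + k)%nat))|].
      specialize (H (n + k)%nat). rewrite pow_add in H. simpl. lra. }
  assert (Hb : forall n k, Cmod (z (n + k)%nat - z n) <= 2 * K * (/ 2) ^ n).
  { intros n k. eapply Rle_trans; [apply Hnk|].
    assert (0 <= 2 * K * (/ 2) ^ n) by (apply Rmult_le_pos; [lra|left; auto]).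
    specialize (Hp k). nra. }
  assert (Hsmall : forall eps, 0 < eps -> exists N, forall n, (N <= n)%nat -> 4 * K * (/ 2) ^ n < eps).
  { intros eps Heps. destruct (pow_lt_1_zero (/ 2)) with (y := eps / (4 * K + 1)) as [N HN].
    - rewrite Rabs_pos_eq; lra.
    - apply Rdiv_lt_0_compat; lra.
    - exists N. intros n Hn. specialize (HN n Hn). rewrite Rabs_pos_eq in HN by (left; auto).
      apply (Rmult_lt_compat_l (4 * K + 1)) in HN; [|lra].
      replace ((4 * K + 1) * (eps / (4 * K + 1))) with eps in HN by (field; lra).
      specialize (Hp n). nra. }
  assert (Hc : forall p : C -> R, (forall x y, Rabs (p x - p y) <= Cmod (x - y)) ->
             exists l, Un_cv (fun n => p (z n)) l).
  { intros p Hpx. destruct (Rcomplete.R_complete (fun n => p (z n))) as [l Hl]; [|now exists l].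
    intros eps Heps. destruct (Hsmall eps Heps) as [N HN]. exists N.
    intros n m Hn Hm. unfold Rdist. eapply Rle_lt_trans; [apply Hpx|].
    eapply Rle_lt_trans; [apply (Cmod_triangle_minus _ (z N))|].
    rewrite (Cmod_minus_sym (z N)).
    assert (B1 := Hb N (n - N)%nat). assert (B2 := Hb N (m - N)%nat).
    replace (N + (n - N))%nat with n in B1 by lia.
    replace (N + (m - N))%nat with m in B2 by lia.
    specialize (HN N (Nat.le_refl N)). lra. }
  destruct (Hc fst Cmod_Re_Lipschitz) as [x Hx].
  destruct (Hc snd Cmod_Im_Lipschitz) as [y Hy].
  exists (x, y). intros n. apply Rle_plus_epsilon. intros eps Heps.
  destruct (Hx (eps / 2)) as [N1 HN1]; [lra|]. destruct (Hy (eps / 2)) as [N2 HN2]; [lra|].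
  set (m := (n + (N1 + N2))%nat).
  specialize (HN1 m ltac:(unfold m; lia)). specialize (HN2 m ltac:(unfold m; lia)).
  unfold Rdist in HN1, HN2.
  eapply Rle_trans; [apply (Cmod_triangle_minus _ (z m))|].
  rewrite (Cmod_minus_sym _ (z m)).
  assert (D : Cmod (z m - (x, y)) <= eps).
  { replace (z m - (x, y))%C with (fst (z m) - x, snd (z m) - y)
      by (apply injective_projections; simpl; ring).
    eapply Rle_trans; [apply Cmod_le_Rabs|]. lra. }
  assert (B1 := Hb n (N1 + N2)%nat). fold m in B1.
  assert (0 <= 2 * K * (/ 2) ^ n) by (apply Rmult_le_pos; [lra|left; auto]). lra.
Qed.

(** Newton's iteration with the derivative frozen at [a] is a contraction with factor [1/2]. If [w]
    is within [Cmod c * s / 8] of [f a], the first step has length [K < s / 8], the iterates stay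
    within [2 K] of [a] and the limit within [4 K < s]. *)
Lemma locally_onto (f df : C -> C) (a : C) (r : R) :
  near a (fun z => has_deriv f z (df z)) -> df a <> 0 -> 0 < r ->
  near (f a) (fun w => exists z, Cmod (z - a) < r /\ f z = w).
Proof.
  intros Hf H0 Hr. set (c := df a) in *.
  assert (Hc : 0 < Cmod c) by now apply Cmod_gt_0.
  destruct (strictly_differentiable f df a Hf (Cmod c / 2)) as [r1 [Hr1 K1]]; [lra|].
  destruct Hf as [r2 [Hr2 K2]].
  set (s := Rmin r (Rmin r1 r2)).
  assert (Hs : 0 < s) by (unfold s; repeat apply Rmin_pos; assumption).
  assert (Hsr : s <= r) by apply Rmin_l.
  assert (Hs1 : s <= r1) by (eapply Rle_trans; [apply Rmin_r|apply Rmin_l]).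
  assert (Hs2 : s <= r2) by (eapply Rle_trans; [apply Rmin_r|apply Rmin_r]).
  exists (Cmod c * s / 8). split.
  { apply Rdiv_lt_0_compat; [now apply Rmult_lt_0_compat|lra]. }
  intros w Hw.
  set (step := fun z => (z + (w - f z) / c)%C).
  set (z := fix z (n : nat) : C := match n with O => a | S m => step (z m) end).
  set (K := Cmod (w - f a) / Cmod c).
  assert (HK0 : 0 <= K) by (apply Rdiv_le_0_compat; [apply Cmod_ge_0|exact Hc]).
  assert (HK : 8 * K < s).
  { unfold K. apply (Rmult_lt_reg_r (Cmod c)); auto.
    replace (8 * (Cmod (w - f a) / Cmod c) * Cmod c) with (8 * Cmod (w - f a)) by (field; lra).
    lra. }
  assert (Hstep : forall x y, Cmod (x - a) < s -> Cmod (y - a) < s ->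
             Cmod (step x - step y) <= / 2 * Cmod (x - y)).
  { intros x y Hx Hy. specialize (K1 x y ltac:(lra) ltac:(lra)). fold c in K1.
    unfold step.
    replace (x + (w - f x) / c - (y + (w - f y) / c))%C
      with (- ((f x - f y - c * (x - y)) / c))%C by (field; exact H0).
    rewrite Cmod_opp, Cmod_div by exact H0.
    apply (Rmult_le_reg_r (Cmod c)); auto.
    unfold Rdiv at 1. rewrite Rmult_assoc, Rinv_l, Rmult_1_r by lra. lra. }
  assert (Hp : forall n, 0 < (/ 2) ^ n) by (intros n; apply pow_lt; lra).
  assert (Hz : forall n, Cmod (z n - a) <= 2 * K * (1 - (/ 2) ^ n) /\
                         Cmod (z (S n) - z n) <= K * (/ 2) ^ n).
  { induction n as [|n [IH1 IH2]].
    - simpl. rewrite Cmod_self. split; [lra|]. unfold step.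
      replace (a + (w - f a) / c - a)%C with ((w - f a) / c)%C by ring.
      rewrite Cmod_div by exact H0. fold K. lra.
    - assert (IH3 : Cmod (z (S n) - a) <= 2 * K * (1 - (/ 2) ^ S n)).
      { eapply Rle_trans; [apply (Cmod_triangle_minus _ (z n))|]. simpl pow. lra. }
      split; [exact IH3|].
      change (Cmod (step (z (S n)) - step (z n)) <= K * (/ 2) ^ S n).
      eapply Rle_trans.
      { apply Hstep.
        - specialize (Hp (S n)). nra.
        - specialize (Hp n). nra. }
      simpl pow. lra. }
  destruct (geometric_limit z K (fun n => proj2 (Hz n))) as [l Hl].
  exists l.
  assert (Hla : Cmod (l - a) < s).
  { specialize (Hl 0%nat). simpl in Hl. lra. }
  split; [lra|].
  apply Cmod_small_eq. intros eps Heps.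
  assert (Hcont := has_deriv_cont f l _ (K2 l ltac:(lra))).
  destruct (Hcont (eps / 2)) as [d [Hd Kd]]; [lra|].
  set (e := Rmin (d / (4 * K + 1)) (eps / 2 / (Cmod c * K + 1))).
  assert (0 <= Cmod c * K) by (apply Rmult_le_pos; lra).
  assert (He : 0 < e) by (apply Rmin_pos; apply Rdiv_lt_0_compat; lra).
  destruct (pow_lt_1_zero (/ 2)) with (y := e) as [n Hn].
  { rewrite Rabs_pos_eq; lra. }
  { exact He. }
  specialize (Hn n (Nat.le_refl n)). rewrite Rabs_pos_eq in Hn by (left; auto).
  assert (Hn1 : (/ 2) ^ n * (4 * K + 1) < d).
  { apply (Rmult_lt_reg_r (/ (4 * K + 1))); [apply Rinv_0_lt_compat; lra|].
    rewrite Rmult_assoc, Rinv_r, Rmult_1_r by lra.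
    eapply Rlt_le_trans; [exact Hn|apply Rmin_l]. }
  assert (Hn2 : (/ 2) ^ n * (Cmod c * K + 1) < eps / 2).
  { apply (Rmult_lt_reg_r (/ (Cmod c * K + 1))); [apply Rinv_0_lt_compat; lra|].
    rewrite Rmult_assoc, Rinv_r, Rmult_1_r by lra.
    eapply Rlt_le_trans; [exact Hn|apply Rmin_r]. }
  specialize (Hp n).
  assert (H1 : Cmod (f (z n) - f l) < eps / 2).
  { apply Kd. rewrite Cmod_minus_sym. specialize (Hl n). nra. }
  assert (H2 : Cmod (w - f (z n)) <= eps / 2).
  { assert (E : (w - f (z n))%C = (c * (z (S n) - z n))%C).
    { simpl. unfold step. field. exact H0. }
    rewrite E, Cmod_mult. destruct (Hz n) as [_ Hzn].
    apply Rle_trans with (Cmod c * (K * (/ 2) ^ n)).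
    - apply Rmult_le_compat_l; lra.
    - nra. }
  eapply Rle_trans; [apply (Cmod_triangle_minus _ (f (z n)))|].
  rewrite (Cmod_minus_sym (f l)), (Cmod_minus_sym (f (z n)) w). lra.
Qed.

(** Since [f] is locally onto, each [w] near [f a] is some [f z] with [z] near [a]; since [f] is
    expanding, an error small against [z - a] is small against [f z - f a]. *)
Lemma inverse_has_deriv (f df g : C -> C) (a : C) :
  near a (fun z => has_deriv f z (df z)) -> df a <> 0 ->
  near a (fun z => g (f z) = z) ->
  has_deriv g (f a) (/ df a)%C.
Proof.
  intros Hf H0 Hg eps Heps.
  assert (Hc : 0 < Cmod (df a)) by now apply Cmod_gt_0.
  destruct (expanding_near f df a Hf H0) as [r1 [Hr1 K1]].
  set (e := eps * (Cmod (df a) * (Cmod (df a) / 2))).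
  assert (He : 0 < e) by (unfold e; repeat apply Rmult_lt_0_compat; lra).
  assert (Ha : g (f a) = a) by exact (near_self _ _ Hg).
  destruct (near_and _ _ _ (near_self _ _ Hf e He) Hg) as [r2 [Hr2 K2]].
  generalize (locally_onto f df a (Rmin r1 r2) Hf H0 (Rmin_pos _ _ Hr1 Hr2)).
  apply near_imp. intros w [z [Hz <-]].
  assert (Hz1 : Cmod (z - a) < r1) by (generalize (Rmin_l r1 r2); lra).
  assert (Hz2 : Cmod (z - a) < r2) by (generalize (Rmin_r r1 r2); lra).
  destruct (K2 z Hz2) as [K3 K4]. rewrite K4, Ha.
  specialize (K1 z a Hz1). rewrite Cmod_self in K1. specialize (K1 Hr1).
  replace (z - a - / df a * (f z - f a))%C with (- ((f z - f a - df a * (z - a)) / df a))%C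
    by (field; exact H0).
  rewrite Cmod_opp, Cmod_div by exact H0.
  apply (Rmult_le_reg_r (Cmod (df a))); auto.
  unfold Rdiv at 1. rewrite Rmult_assoc, Rinv_l, Rmult_1_r by lra.
  eapply Rle_trans; [exact K3|].
  replace (e * Cmod (z - a)) with (eps * Cmod (df a) * (Cmod (df a) / 2 * Cmod (z - a)))
    by (unfold e; ring).
  replace (eps * Cmod (f z - f a) * Cmod (df a)) with (eps * Cmod (df a) * Cmod (f z - f a)) by ring.
  apply Rmult_le_compat_l; auto. apply Rmult_le_pos; lra.
Qed.

(** * Radial primitives *)

Lemma is_RInt_C_scal (c : C) (f : R -> C) (a b : R) (l : C) :
  is_RInt (V := C_R_NormedModule) f a b l ->
  is_RInt (V := C_R_NormedModule) (fun t => c * f t)%C a b (c * l)%C.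
Proof.
  intros H.
  assert (H1 := is_RInt_fct_extend_fst (U := R_NormedModule) (V := R_NormedModule) f a b l H).
  assert (H2 := is_RInt_fct_extend_snd (U := R_NormedModule) (V := R_NormedModule) f a b l H).
  apply (is_RInt_fct_extend_pair (U := R_NormedModule) (V := R_NormedModule)).
  - exact (is_RInt_minus _ _ a b _ _ (is_RInt_scal _ a b (fst c) _ H1)
             (is_RInt_scal _ a b (snd c) _ H2)).
  - exact (is_RInt_plus _ _ a b _ _ (is_RInt_scal _ a b (fst c) _ H2)
             (is_RInt_scal _ a b (snd c) _ H1)).
Qed.

Lemma cont_at_radius (f : C -> C) (z : C) (t : R) :
  cont_at f (t * z)%C ->
  continuous (T := R_UniformSpace) (U := C_R_NormedModule) (fun u : R => f (u * z)%C) t.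
Proof.
  intros H.
  apply (continuous_ext (fun u : R => f (0 + u * z)%C)).
  - intros u. now rewrite Cplus_0_l.
  - apply continuous_along. now rewrite Cplus_0_l.
Qed.

Definition radial_mean (f : C -> C) (z : C) : C :=
  RInt (V := C_R_CompleteNormedModule) (fun t : R => f (t * z)%C) 0 1.

Lemma radius_in_disk (t : R) (z : C) : 0 <= t <= 1 -> Cmod (t * z) <= Cmod z.
Proof.
  intros Ht. rewrite Cmod_mult, Cmod_R, Rabs_pos_eq by lra.
  generalize (Cmod_ge_0 z). nra.
Qed.

Lemma radial_mean_correct (f : C -> C) (z : C) :
  (forall w, Cmod w < 1 -> cont_at f w) -> Cmod z < 1 ->
  is_RInt (V := C_R_NormedModule) (fun t : R => f (t * z)%C) 0 1 (radial_mean f z).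
Proof.
  intros Hf Hz. apply (RInt_correct (V := C_R_CompleteNormedModule)).
  apply (ex_RInt_continuous (V := C_R_CompleteNormedModule)).
  rewrite Rmin_left, Rmax_right by lra.
  intros t Ht. apply cont_at_radius. apply Hf.
  generalize (radius_in_disk t z Ht). lra.
Qed.

(** Stronger than uniform continuity along the segment: [w] may leave the line, so compactness gives
    a whole tube around it. *)
Lemma uniform_cont_seg (f : C -> C) (p d : C) (a b eps : R) :
  cont_on_seg f p d a b -> 0 < eps ->
  exists r, 0 < r /\ forall (t : R) (w : C), a <= t <= b ->
    Cmod (w - (p + t * d)) < r -> Cmod (f w - f (p + t * d)%C) <= eps.
Proof.
  intros Hf Heps. assert (Hd0 := Cmod_ge_0 d).
  (* In the factor [1 + Cmod d], the term [Cmod d] pays for moving along the line and [1] for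
     leaving it. *)
  assert (H : forall t : R, exists r : posreal, a <= t <= b ->
            forall w, Cmod (w - (p + t * d)) < (1 + Cmod d) * r ->
              Cmod (f w - f (p + t * d)%C) < eps / 2).
  { intros t. destruct (classic (a <= t <= b)) as [Ht|Ht].
    - destruct (Hf t Ht (eps / 2)) as [r [Hr K]]; [lra|].
      assert (Hr2 : 0 < r / (1 + Cmod d)) by (apply Rdiv_lt_0_compat; lra).
      exists (mkposreal _ Hr2). intros _ w Hw. apply K. simpl in Hw.
      replace ((1 + Cmod d) * (r / (1 + Cmod d))) with r in Hw by (field; lra). exact Hw.
    - exists (mkposreal _ Rlt_0_1). tauto. }
  destruct (choice_function _ _ _ H) as [delta Hdelta].
  destruct (compactness_value_1d a b delta) as [r Hr].
  exists r. split; [apply cond_pos|]. intros t w Ht Hw.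
  apply Rnot_lt_le. intros Hn. apply (Hr t Ht). intros [u [Hu [Htu Hdu]]].
  assert (E : Cmod (p + t * d - (p + u * d)) <= Cmod d * delta u).
  { replace (p + t * d - (p + u * d))%C with ((t - u)%R * d)%C by (rewrite RtoC_minus; ring).
    rewrite Cmod_mult, Cmod_R, Rmult_comm. apply Rmult_le_compat_l; lra. }
  assert (Hp := cond_pos (delta u)).
  assert (H1 : Cmod (f w - f (p + u * d)%C) < eps / 2).
  { apply Hdelta; auto.
    eapply Rle_lt_trans; [apply (Cmod_triangle_minus _ (p + t * d))|]. lra. }
  assert (H2 : Cmod (f (p + t * d)%C - f (p + u * d)%C) < eps / 2).
  { apply Hdelta; auto. lra. }
  generalize (Cmod_triangle_minus (f w) (f (p + u * d)%C) (f (p + t * d)%C)).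
  rewrite (Cmod_minus_sym (f (p + u * d)%C)). lra.
Qed.

Definition quotient_by_id (m dm : C -> C) (z : C) : C :=
  if Ceq_dec z 0 then dm 0 else (m z / z)%C.

(** Serves for [m x / x] and for the chart expressions of [Phi] and [Psi] at infinity, hence asks
    for differentiability at a single point. *)
Lemma quotient_cont_0 (u : C -> C) (u1 : C) :
  has_deriv u 0 u1 -> u 0 = 0 ->
  cont_at (fun x => if Ceq_dec x 0 then u1 else u x / x)%C 0.
Proof.
  intros Hu H0 eps Heps. assert (He2 : 0 < eps / 2) by lra.
  generalize (Hu (eps / 2) He2). apply near_imp. intros y Hy.
  destruct (Ceq_dec 0 0) as [_|]; [|congruence].
  destruct (Ceq_dec y 0) as [->|Hy0].
  - rewrite Cmod_self. exact Heps.
  - assert (Hp : 0 < Cmod y) by now apply Cmod_gt_0.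
    rewrite H0 in Hy. replace (y - 0)%C with y in Hy by ring.
    replace (u y / y - u1)%C with ((u y - 0 - u1 * y) / y)%C by (field; exact Hy0).
    rewrite Cmod_div by exact Hy0. apply (Rmult_lt_reg_r (Cmod y)); auto.
    unfold Rdiv. rewrite Rmult_assoc, Rinv_l, Rmult_1_r by lra. nra.
Qed.

Section Radial_primitive.

Variables m dm : C -> C.
Hypothesis m_deriv : forall z, Cmod z < 1 -> has_deriv m z (dm z).
Hypothesis m_0 : m 0 = 0.

Let k := quotient_by_id m dm.

Lemma near_in_disk (z : C) : Cmod z < 1 -> near z (fun w => Cmod w < 1).
Proof.
  intros Hz. assert (H : Cmod (z - 0) < 1) by (now replace (z - 0)%C with z by ring).
  generalize (near_ball z 0 1 H). apply near_imp. intros y Hy.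
  now replace (y - 0)%C with y in Hy by ring.
Qed.

Lemma dm_cont (z : C) : Cmod z < 1 -> cont_at dm z.
Proof.
  intros Hz. apply (deriv_cont m). generalize (near_in_disk z Hz).
  apply near_imp. exact m_deriv.
Qed.

Lemma quotient_by_id_mult (z : C) : (z * k z)%C = m z.
Proof.
  unfold k, quotient_by_id. destruct (Ceq_dec z 0) as [->|Hz].
  - rewrite m_0. ring.
  - field. exact Hz.
Qed.

Lemma quotient_by_id_cont (z : C) : Cmod z < 1 -> cont_at k z.
Proof.
  intros Hz. destruct (Ceq_dec z 0) as [->|Hz0].
  - exact (quotient_cont_0 m (dm 0) (m_deriv 0 Hz) m_0).
  - apply has_deriv_cont with (dm z * / z + m z * (- / (z * z)))%C.
    apply has_deriv_ext_near with (fun x => m x * / x)%C.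
    + generalize (near_neq z 0 Hz0). apply near_imp. intros y Hy.
      unfold k, quotient_by_id. destruct (Ceq_dec y 0); [contradiction|reflexivity].
    + apply has_deriv_mult; [now apply m_deriv|now apply has_deriv_inv_id].
Qed.

Lemma mean_dm (z : C) : Cmod z < 1 -> (z * radial_mean dm z)%C = m z.
Proof.
  intros Hz.
  assert (Hc : cont_on_seg dm 0 z 0 1).
  { intros t Ht. apply dm_cont. rewrite Cplus_0_l. generalize (radius_in_disk t z Ht). lra. }
  assert (S : seg dm 0 z 0 1 = m z).
  { rewrite (seg_primitive m dm); auto; try lra.
    - replace (0 + 1 * z)%C with z by ring. replace (0 + 0%R * z)%C with (RtoC 0) by ring.
      rewrite m_0. ring.
    - intros t Ht. apply m_deriv. rewrite Cplus_0_l. generalize (radius_in_disk t z Ht). lra. }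
  rewrite <- S. unfold seg. symmetry. apply RInt_C_unique.
  apply (is_RInt_ext (V := C_R_NormedModule) (fun t : R => z * dm (t * z))%C).
  - intros t _. rewrite Cplus_0_l. apply Cmult_comm.
  - apply is_RInt_C_scal. apply radial_mean_correct; auto. apply dm_cont.
Qed.

(** Since [z * k (t z) = m (t z) / t], differentiation under the integral gives [dm (t z)], whose
    mean over [t] is [m z / z = k z]. In this way only [m] is differentiated, and [k] need only be
    continuous at its filled-in point [0]. *)
Lemma radial_primitive (z : C) :
  Cmod z < 1 -> has_deriv (fun z => z * radial_mean k z)%C z (k z).
Proof.
  intros Hz.
  apply has_deriv_val with (radial_mean dm z).
  2:{ unfold k at 1, quotient_by_id. destruct (Ceq_dec z 0) as [->|Hz0].
      - unfold radial_mean. apply RInt_C_unique.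
        apply (is_RInt_ext (V := C_R_NormedModule) (fun t : R => dm 0)).
        + intros t _. f_equal. ring.
        + assert (Es : scal (1 - 0) (dm 0 : C_R_NormedModule) = dm 0).
          { rewrite Rminus_0_r. apply (scal_one (V := C_R_NormedModule)). }
          generalize (is_RInt_const (V := C_R_NormedModule) 0 1 (dm 0)).
          now rewrite Es.
      - rewrite <- (mean_dm z Hz). field. exact Hz0. }
  intros eps Heps.
  (* Uniform continuity of [dm] around the radius makes the estimate of the integrand independent of
     [t]. *)
  assert (K : exists d, 0 < d /\ forall (t : R) (w : C), 0 <= t <= 1 ->
    Cmod (w - t * z) < d -> Cmod (dm w - dm (t * z)%C) <= eps).
  { destruct (uniform_cont_seg dm 0 z 0 1 eps) as [d [Hd K]]; [|exact Heps|].
    - intros t Ht. apply dm_cont. rewrite Cplus_0_l. generalize (radius_in_disk t z Ht). lra.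
    - exists d. split; [exact Hd|]. intros t w Ht Hw.
      specialize (K t w Ht). rewrite Cplus_0_l in K. auto. }
  destruct K as [d [Hd K]].
  generalize (near_and _ _ _ (near_ball z z d ltac:(rewrite Cmod_self; exact Hd)) (near_in_disk z Hz)).
  apply near_imp. intros y [Hyd Hy].
  assert (I1 := is_RInt_C_scal y _ _ _ _ (radial_mean_correct k y quotient_by_id_cont Hy)).
  assert (I2 := is_RInt_C_scal z _ _ _ _ (radial_mean_correct k z quotient_by_id_cont Hz)).
  assert (I3 := is_RInt_C_scal (y - z) _ _ _ _ (radial_mean_correct dm z dm_cont Hz)).
  assert (I4 := is_RInt_minus (V := C_R_NormedModule) _ _ _ _ _ _
                 (is_RInt_minus (V := C_R_NormedModule) _ _ _ _ _ _ I1 I2) I3).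
  assert (E : Cmod (y * radial_mean k y - z * radial_mean k z - radial_mean dm z * (y - z))
              <= (1 - 0) * (eps * Cmod (y - z))); [|lra].
  rewrite (Cmult_comm (radial_mean dm z)). rewrite Cmod_norm.
  refine (norm_RInt_le_const (V := C_R_NormedModule) _ 0 1 _ _ Rle_0_1 _ I4).
  intros t Ht. rewrite <- Cmod_norm.
  apply Rle_trans with (Cmod (y * k (t * y) - z * k (t * z) - (y - z) * dm (t * z))%C);
    [right; reflexivity|].
  destruct (Req_dec t 0) as [->|Ht0].
  - replace (0%R * y)%C with (RtoC 0) by ring. replace (0%R * z)%C with (RtoC 0) by ring.
    unfold k, quotient_by_id. destruct (Ceq_dec 0 0) as [_|]; [|congruence].
    replace (y * dm 0 - z * dm 0 - (y - z) * dm 0)%C with (RtoC 0) by ring.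
    rewrite Cmod_0. apply Rmult_le_pos; [lra|apply Cmod_ge_0].
  - assert (HtC : RtoC t <> 0) by (intros HtC; now apply RtoC_inj in HtC).
    assert (Ey : (y * k (t * y))%C = (m (t * y) / t)%C).
    { rewrite <- (quotient_by_id_mult (t * y)). field. exact HtC. }
    assert (Ez : (z * k (t * z))%C = (m (t * z) / t)%C).
    { rewrite <- (quotient_by_id_mult (t * z)). field. exact HtC. }
    rewrite Ey, Ez.
    replace (m (t * y) / t - m (t * z) / t - (y - z) * dm (t * z))%C
      with ((m (t * z + t * (y - z)) - m (t * z) - dm (t * z) * (t * (y - z))) / t)%C.
    2:{ replace (t * z + t * (y - z))%C with (t * y)%C by ring. field. exact HtC. }
    rewrite Cmod_div by exact HtC. rewrite Cmod_R, Rabs_pos_eq by lra.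
    apply (Rmult_le_reg_r t); [lra|].
    unfold Rdiv. rewrite Rmult_assoc, Rinv_l, Rmult_1_r by lra.
    replace (eps * Cmod (y - z) * t) with (eps * Cmod (t * (y - z))).
    2:{ rewrite Cmod_mult, Cmod_R, Rabs_pos_eq by lra. ring. }
    assert (Hb : forall s : R, 0 <= s <= 1 -> Cmod (t * z + s * (t * (y - z)) - t * z) < d).
    { intros s Hs. replace (t * z + s * (t * (y - z)) - t * z)%C with (s * (t * (y - z)))%C by ring.
      eapply Rle_lt_trans; [apply radius_in_disk; lra|].
      eapply Rle_lt_trans; [apply radius_in_disk; lra|]. exact Hyd. }
    apply (segment_mean_value m (fun s => dm (t * z + s * (t * (y - z)))%C)).
    + intros s Hs. apply m_deriv.
      replace (t * z + s * (t * (y - z)))%C with (t * (z + s * (y - z)))%C by ring.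
      eapply Rle_lt_trans; [apply radius_in_disk; lra|]. now apply disk_convex.
    + intros s Hs. apply K; auto.
Qed.

End Radial_primitive.

(** * Compact sets *)

(** The sets [d < rho] with [d > 0] cover [P], and the least [d] of a finite subcover works. Taking
    for [rho] the distance to a point gives closedness, and [1 / (1 + Cmod w)] gives boundedness. *)
Lemma compact_avoids (P : C -> Prop) (rho : C -> R) :
  (forall z eps, 0 < eps -> near z (fun y => Rabs (rho y - rho z) < eps)) ->
  compact_set P -> (forall z, P z -> 0 < rho z) ->
  exists d, 0 < d /\ forall z, P z -> d < rho z.
Proof.
  intros Hrho HP Hpos.
  destruct (HP (fun V => exists d, 0 < d /\ V = fun z => d < rho z)) as [l [Hl Hcov]].
  - intros V [d [Hd ->]]. apply open_near. intros z Hz.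
    generalize (Hrho z (rho z - d) ltac:(lra)). apply near_imp.
    intros y Hy. apply Rabs_def2 in Hy. lra.
  - intros z Hz. specialize (Hpos z Hz).
    exists (fun y => rho z / 2 < rho y). split; [|lra].
    exists (rho z / 2). split; [lra|reflexivity].
  - assert (Hmin : exists d, 0 < d /\ forall V, List.In V l -> forall z, V z -> d < rho z).
    { clear Hcov. induction Hl as [|V l [d [Hd ->]] Hl [e [He IH]]].
      - exists 1. split; [lra|]. intros V [].
      - exists (Rmin d e). split; [now apply Rmin_pos|].
        intros W [<-|HW] z Hz.
        + generalize (Rmin_l d e). lra.
        + specialize (IH W HW z Hz). generalize (Rmin_r d e). lra. }
    destruct Hmin as [d [Hd K]]. exists d. split; [exact Hd|].
    intros z Hz. destruct (Hcov z Hz) as [V [HV HVz]]. exact (K V HV z HVz).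
Qed.

Lemma compact_closed (P : C -> Prop) (z : C) :
  compact_set P -> ~ P z -> near z (fun w => ~ P w).
Proof.
  intros HP Hz.
  destruct (compact_avoids P (fun w => Cmod (w - z))) as [d [Hd K]]; auto.
  - intros w eps Heps. exists eps. split; [exact Heps|]. intros y Hy.
    eapply Rle_lt_trans; [|exact Hy]. apply Rabs_le.
    generalize (Cmod_triangle_inv (y - z) (w - z)), (Cmod_triangle_inv (w - z) (y - z)).
    replace (y - z - (w - z))%C with (y - w)%C by ring.
    replace (w - z - (y - z))%C with (w - y)%C by ring.
    rewrite (Cmod_minus_sym w y). lra.
  - intros w Hw. apply Cmod_gt_0. intros E. apply Hz.
    replace z with w; auto. apply Cmod_eq. rewrite E. apply Cmod_0.
  - exists d. split; [exact Hd|]. intros y Hy HPy. specialize (K y HPy). lra.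
Qed.

Lemma compact_bounded (P : C -> Prop) :
  compact_set P -> exists M, 0 < M /\ forall z, P z -> Cmod z < M.
Proof.
  intros HP.
  destruct (compact_avoids P (fun w => / (1 + Cmod w))) as [d [Hd K]]; auto.
  - intros w eps Heps. exists eps. split; [exact Heps|]. intros y Hy.
    eapply Rle_lt_trans; [|exact Hy].
    assert (H1 := Cmod_ge_0 w). assert (H2 := Cmod_ge_0 y).
    replace (/ (1 + Cmod y) - / (1 + Cmod w))
      with ((Cmod w - Cmod y) * (/ (1 + Cmod y) * / (1 + Cmod w))) by (field; lra).
    rewrite Rabs_mult.
    assert (I1 : 0 < / (1 + Cmod y) <= 1).
    { split; [apply Rinv_0_lt_compat; lra|]. rewrite <- Rinv_1. apply Rinv_le_contravar; lra. }
    assert (I2 : 0 < / (1 + Cmod w) <= 1).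
    { split; [apply Rinv_0_lt_compat; lra|]. rewrite <- Rinv_1. apply Rinv_le_contravar; lra. }
    assert (A0 : Rabs (Cmod w - Cmod y) <= Cmod (y - w)).
    { apply Rabs_le.
      generalize (Cmod_triangle_inv y w), (Cmod_triangle_inv w y).
      rewrite (Cmod_minus_sym w y). lra. }
    assert (B0 : 0 <= / (1 + Cmod y) * / (1 + Cmod w) <= 1) by nra.
    rewrite (Rabs_pos_eq _ (proj1 B0)).
    generalize (Rabs_pos (Cmod w - Cmod y)). nra.
  - intros z _. apply Rinv_0_lt_compat. generalize (Cmod_ge_0 z). lra.
  - exists (/ d). split; [now apply Rinv_0_lt_compat|]. intros z Hz. specialize (K z Hz).
    apply Rinv_lt_contravar in K.
    + rewrite Rinv_inv in K. lra.
    + apply Rmult_lt_0_compat; auto. apply Rinv_0_lt_compat. generalize (Cmod_ge_0 z). lra.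
Qed.

(** * Charts of the sphere *)

(** With this default value inversion is an involution of the whole plane, and [coord_fin_inf] and
    [coord_inf_fin] hold at every point of the sphere. *)
Lemma Cinv_0 : (/ 0)%C = 0.
Proof. apply injective_projections; simpl; unfold Rdiv; ring. Qed.

Lemma Cinv_inv (z : C) : (/ / z)%C = z.
Proof.
  destruct (Ceq_dec z 0) as [->|Hz]; [now rewrite !Cinv_0|].
  field. exact Hz.
Qed.

Lemma Cinv_neq_0 (z : C) : z <> 0 -> (/ z)%C <> 0.
Proof. intros Hz H. apply Hz. rewrite <- (Cinv_inv z), H. apply Cinv_0. Qed.

Lemma Cmod_inv_gt_1 (x : C) : x <> 0 -> Cmod x < 1 -> 1 < Cmod (/ x).
Proof.
  intros Hx H. rewrite Cmod_inv by exact Hx.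
  apply Cmod_gt_0 in Hx. rewrite <- Rinv_1. apply Rinv_lt_contravar; lra.
Qed.

Lemma Cmod_inv_lt_1 (z : C) : 1 < Cmod z -> z <> 0 /\ Cmod (/ z) < 1.
Proof.
  intros Hz. assert (H0 : z <> 0) by (apply Cmod_gt_0; lra). split; [exact H0|].
  rewrite Cmod_inv by exact H0. rewrite <- Rinv_1. apply Rinv_lt_contravar; lra.
Qed.

Lemma coord_fin_inf (p : sphere) : coord chart_fin p = (/ coord chart_inf p)%C.
Proof. destruct p as [z|]; simpl; [now rewrite Cinv_inv|now rewrite Cinv_0]. Qed.

Lemma coord_inf_fin (p : sphere) : coord chart_inf p = (/ coord chart_fin p)%C.
Proof. destruct p as [z|]; simpl; [reflexivity|now rewrite Cinv_0]. Qed.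

Lemma param_coord (c : chart) (p : sphere) : in_chart c p -> param c (coord c p) = p.
Proof.
  destruct c, p as [z|]; simpl; intros H; try congruence.
  - destruct (Ceq_dec (/ z) 0) as [E|E]; [|now rewrite Cinv_inv].
    exfalso. apply H. f_equal. now rewrite <- (Cinv_inv z), E, Cinv_0.
  - now destruct (Ceq_dec 0 0).
Qed.

Lemma coord_param (c : chart) (u : C) : coord c (param c u) = u.
Proof.
  destruct c; simpl; [reflexivity|].
  destruct (Ceq_dec u 0) as [->|Hu]; simpl; [reflexivity|apply Cinv_inv].
Qed.

Lemma param_inf_neq_0 (u : C) : u <> 0 -> param chart_inf u = Fin (/ u).
Proof. intros Hu. simpl. now destruct (Ceq_dec u 0). Qed.

Lemma param_inf_0 : param chart_inf 0 = Inf.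
Proof. simpl. now destruct (Ceq_dec 0 0). Qed.

Lemma ex_derive_has_deriv (f : C -> C) (z : C) :
  ex_derive (K := C_AbsRing) (V := C_NormedModule) f z <-> exists l, has_deriv f z l.
Proof.
  split; intros [l Hl]; exists l; now apply is_derive_has_deriv.
Qed.

(** Holomorphy may be witnessed in any admissible pair of charts; composing with inversion on either
    side moves both charts to the finite one. *)
Lemma sphere_holomorphic_fin (F : sphere -> sphere) (z : C) :
  sphere_holomorphic_at F (Fin z) -> F (Fin z) <> Inf ->
  exists l, has_deriv (fun w => coord chart_fin (F (Fin w))) z l.
Proof.
  intros [c [d [Hc [Hd [_ H]]]]] HInf. apply ex_derive_has_deriv in H.
  assert (K : exists l, has_deriv (fun w => coord d (F (Fin w))) z l).
  { destruct c; [exact H|]. destruct H as [l Hl]. simpl coord in Hl at 2.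
    assert (Hz : z <> 0) by (intros ->; now apply Hc).
    exists (l * (- / (z * z)))%C.
    apply has_deriv_ext_near with (fun w => coord d (F (param chart_inf (/ w)))).
    - generalize (near_neq z 0 Hz). apply near_imp. intros y Hy.
      rewrite param_inf_neq_0, Cinv_inv; auto. now apply Cinv_neq_0.
    - apply (has_deriv_comp (fun u => coord d (F (param chart_inf u))) Cinv); auto.
      now apply has_deriv_inv_id. }
  destruct d; [exact K|]. destruct K as [l Hl].
  eexists. apply has_deriv_ext with (fun w => / coord chart_inf (F (Fin w)))%C.
  - intros y. now rewrite <- coord_fin_inf.
  - apply has_deriv_inv; [|exact Hl].
    destruct (F (Fin z)) as [w|]; [|congruence]. simpl in *.
    apply Cinv_neq_0. intros ->. now apply Hd.
Qed.

(** [Inf] lies in one chart only, so both charts are forced here. *)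
Lemma sphere_holomorphic_inf (F : sphere -> sphere) :
  sphere_holomorphic_at F Inf -> F Inf = Inf ->
  near 0 (fun u => F (param chart_inf u) <> Fin 0) /\
  exists l, has_deriv (fun u => coord chart_inf (F (param chart_inf u))) 0 l.
Proof.
  intros [c [d [Hc [Hd [Hn H]]]]] HInf. apply ex_derive_has_deriv in H.
  apply locally_near in Hn.
  destruct c; [now destruct Hc|]. destruct d; [now destruct Hd|].
  simpl coord in H at 2. simpl coord in Hn at 1. split; auto.
Qed.

Lemma has_deriv_filterdiff (f : C -> C) (z l : C) :
  has_deriv f z l ->
  filterdiff (K := R_AbsRing) (U := C_R_NormedModule) (V := C_R_NormedModule)
    f (locally z) (fun v => l * v)%C.
Proof.
  intros H. split.
  - split.
    + intros x y. apply injective_projections; simpl; unfold plus; simpl; ring.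
    + intros k x. apply injective_projections; simpl; unfold scal; simpl;
        unfold mult; simpl; ring.
    + exists (Cmod l + 1). split; [generalize (Cmod_ge_0 l); lra|].
      intros x. rewrite <- !Cmod_norm, Cmod_mult. generalize (Cmod_ge_0 l), (Cmod_ge_0 x). nra.
  - intros x Hx.
    apply (is_filter_lim_locally_unique (K := R_AbsRing) (V := C_R_NormedModule)) in Hx.
    subst x. intros eps. apply locally_near.
    generalize (H eps (cond_pos eps)). apply near_imp. intros y Hy.
    rewrite <- !Cmod_norm. exact Hy.
Qed.

(** [lim] is a total operator that is specified on Cauchy filters only. [complete_cauchy] shows that
    the filter converges to it, and limits in [R] are unique. *)
Lemma lim_filtermap_unique (T : Type) (F : (T -> Prop) -> Prop) (h : T -> R) (L : R) :
  ProperFilter F -> (forall eps, 0 < eps -> F (fun x => Rabs (h x - L) < eps)) ->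
  lim (T := R_CompleteSpace) (filtermap h F) = L.
Proof.
  intros PF H.
  assert (PF' : ProperFilter (filtermap h F)) by now apply filtermap_proper_filter.
  assert (Hb : forall eps : posreal, filtermap h F (ball (lim (T := R_CompleteSpace) (filtermap h F)) eps)).
  { apply complete_cauchy; auto. intros eps. exists L. exact (H eps (cond_pos eps)). }
  apply Rminus_diag_uniq. apply Rabs_eq_0.
  apply Rle_antisym; [|apply Rabs_pos].
  apply Rle_plus_epsilon. intros eps Heps. rewrite Rplus_0_l.
  assert (Heps2 : 0 < eps / 2) by lra.
  destruct (filter_ex (F := F) _ (filter_and (F := F)
      (fun x => ball (lim (T := R_CompleteSpace) (filtermap h F)) (eps / 2) (h x))
      (fun x => Rabs (h x - L) < eps / 2) (Hb (mkposreal _ Heps2)) (H _ Heps2)))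
    as [x [H1 H2]].
  set (l := lim (T := R_CompleteSpace) (filtermap h F)) in *.
  assert (H3 : Rabs (h x - l) < eps / 2) by exact H1.
  replace (l - L) with ((h x - L) - (h x - l)) by ring.
  eapply Rle_trans; [apply Rabs_triang|]. rewrite Rabs_Ropp. lra.
Qed.

Lemma locally'_0_proper : ProperFilter (locally' (T := C_UniformSpace) (RtoC 0)).
Proof.
  split.
  - intros Q HQ. apply locally_near in HQ. destruct HQ as [d [Hd K]].
    exists (RtoC (d / 2)). apply K.
    + replace (RtoC (d / 2) - 0)%C with (RtoC (d / 2)) by ring.
      rewrite Cmod_R, Rabs_pos_eq; lra.
    + intros E. apply RtoC_inj in E. lra.
  - apply within_filter. apply locally_filter.
Qed.

(** * The development of the harmonic cap *)

Section Development.

Variables (P : C -> Prop) (Phi Psi : sphere -> sphere).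
Hypothesis P_compact : compact_set P.
Hypothesis Phi_riemann : riemann_map P Phi Psi.

Definition Phi_fin (zeta : C) : C := coord chart_fin (Phi (Fin zeta)).
Definition Psi_fin (w : C) : C := coord chart_fin (Psi (Fin w)).

Lemma Psi_Inf : Psi Inf = Inf.
Proof.
  destruct Phi_riemann as [[_ [_ [H [_ _]]]] E]. rewrite <- E at 1. now apply H.
Qed.

Lemma Phi_Fin (z : C) : 1 < Cmod z -> Phi (Fin z) = Fin (Phi_fin z) /\ ~ P (Phi_fin z).
Proof.
  intros Hz. destruct Phi_riemann as [[HU [_ [HPsiPhi _]]] HInf].
  assert (Hc := HU (Fin z) Hz). assert (Hi := HPsiPhi (Fin z) Hz).
  unfold Phi_fin. destruct (Phi (Fin z)) as [w|] eqn:E; [now split|].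
  rewrite Psi_Inf in Hi. discriminate.
Qed.

Lemma Psi_Fin (w : C) : ~ P w -> Psi (Fin w) = Fin (Psi_fin w) /\ 1 < Cmod (Psi_fin w).
Proof.
  intros Hw. destruct Phi_riemann as [[_ [HV [_ [HPhiPsi _]]]] HInf].
  assert (Hc := HV (Fin w) Hw). assert (Hi := HPhiPsi (Fin w) Hw).
  unfold Psi_fin. destruct (Psi (Fin w)) as [z|] eqn:E; [now split|].
  rewrite HInf in Hi. discriminate.
Qed.

Lemma Psi_Phi_fin (z : C) : 1 < Cmod z -> Psi_fin (Phi_fin z) = z.
Proof.
  intros Hz. destruct (Phi_Fin z Hz) as [E _].
  destruct Phi_riemann as [[_ [_ [H _]]] _].
  unfold Psi_fin. rewrite <- E, (H (Fin z) Hz). reflexivity.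
Qed.

Lemma Phi_Psi_fin (w : C) : ~ P w -> Phi_fin (Psi_fin w) = w.
Proof.
  intros Hw. destruct (Psi_Fin w Hw) as [E _].
  destruct Phi_riemann as [[_ [_ [_ [H _]]]] _].
  unfold Phi_fin. rewrite <- E, (H (Fin w) Hw). reflexivity.
Qed.

Lemma Phi_fin_deriv (z : C) : 1 < Cmod z -> has_deriv Phi_fin z (Phi_derive Phi z).
Proof.
  intros Hz. destruct (Phi_Fin z Hz) as [E _].
  destruct Phi_riemann as [[_ [_ [_ [_ [H _]]]]] _].
  destruct (sphere_holomorphic_fin Phi z (H (Fin z) Hz)) as [l Hl].
  { now rewrite E. }
  apply has_deriv_val with l; [exact Hl|]. symmetry.
  apply is_C_derive_unique. now apply is_derive_has_deriv.
Qed.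

(** The chain rule for [Phi (Psi w) = w], an identity on a neighbourhood of [w] because [P] is
    closed. The product of the two derivatives being [1], neither vanishes. *)
Lemma Psi_fin_deriv (w : C) :
  ~ P w -> Phi_derive Phi (Psi_fin w) <> 0 /\ has_deriv Psi_fin w (/ Phi_derive Phi (Psi_fin w))%C.
Proof.
  intros Hw. destruct (Psi_Fin w Hw) as [E H1].
  destruct Phi_riemann as [[_ [_ [_ [_ [_ H]]]]] _].
  destruct (sphere_holomorphic_fin Psi w (H (Fin w) Hw)) as [l Hl].
  { now rewrite E. }
  assert (K : has_deriv (fun z => z) w (Phi_derive Phi (Psi_fin w) * l)%C).
  { apply has_deriv_ext_near with (fun z => Phi_fin (Psi_fin z)).
    - generalize (compact_closed P w P_compact Hw). apply near_imp. exact Phi_Psi_fin.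
    - apply has_deriv_comp; [now apply Phi_fin_deriv|exact Hl]. }
  assert (E1 := has_deriv_unique _ _ _ _ K (has_deriv_id w)).
  assert (H0 : Phi_derive Phi (Psi_fin w) <> 0).
  { intros Z. rewrite Z, Cmult_0_l in E1. apply RtoC_inj in E1. lra. }
  split; [exact H0|]. apply has_deriv_val with l; [exact Hl|].
  replace l with ((Phi_derive Phi (Psi_fin w) * l) / Phi_derive Phi (Psi_fin w))%C
    by (field; exact H0).
  rewrite E1. unfold Cdiv. ring.
Qed.

Lemma Phi_derive_neq_0 (z : C) : 1 < Cmod z -> Phi_derive Phi z <> 0.
Proof.
  intros Hz. destruct (Phi_Fin z Hz) as [_ H].
  rewrite <- (Psi_Phi_fin z Hz). now apply Psi_fin_deriv.
Qed.

(** Here [c] is the leading coefficient in [Phi z ~ c z], so that [1 / Phi (1/x)] has derivative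
    [/ c] at [0]. The chain rule for [Psi] after [Phi] shows that it is nonzero. *)
Lemma Phi_at_infinity :
  exists c : C, c <> 0 /\
    has_deriv (fun x => coord chart_inf (Phi (param chart_inf x))) 0 (/ c)%C /\
    has_deriv (fun x => coord chart_inf (Psi (param chart_inf x))) 0 c.
Proof.
  destruct Phi_riemann as [[HU [HV [HPsiPhi [HPhiPsi [HPhi HPsi]]]]] HInf].
  destruct (sphere_holomorphic_inf Phi (HPhi Inf I) HInf) as [Hn [u1 Hu]].
  destruct (sphere_holomorphic_inf Psi (HPsi Inf I) Psi_Inf) as [_ [v1 Hv]].
  set (u := fun x => coord chart_inf (Phi (param chart_inf x))) in *.
  set (v := fun x => coord chart_inf (Psi (param chart_inf x))) in *.
  assert (u0 : u 0 = 0) by (unfold u; rewrite param_inf_0, HInf; reflexivity).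
  assert (K : has_deriv (fun z => z) 0 (v1 * u1)%C).
  { apply has_deriv_ext_near with (fun z => v (u z)).
    - generalize (near_and _ _ _ Hn (near_in_disk 0 ltac:(rewrite Cmod_0; lra))).
      apply near_imp. intros x [Hx Hx1]. unfold v, u.
      rewrite (param_coord chart_inf); [|exact Hx].
      rewrite HPsiPhi; [apply coord_param|].
      destruct (Ceq_dec x 0) as [->|Hx0]; [now rewrite param_inf_0|].
      rewrite param_inf_neq_0 by exact Hx0. now apply Cmod_inv_gt_1.
    - apply has_deriv_comp; [now rewrite u0|exact Hu]. }
  assert (E1 := has_deriv_unique _ _ _ _ K (has_deriv_id 0)).
  assert (H0 : v1 <> 0).
  { intros Z. rewrite Z, Cmult_0_l in E1. apply RtoC_inj in E1. lra. }
  exists v1. repeat split; auto.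
  apply has_deriv_val with u1; [exact Hu|].
  replace u1 with ((v1 * u1) / v1)%C by (field; exact H0). rewrite E1. unfold Cdiv. ring.
Qed.

(** The limit of [Phi'] at infinity. *)
Definition cap_k0 : C := proj1_sig (constructive_indefinite_description _ Phi_at_infinity).

Lemma cap_k0_spec : cap_k0 <> 0 /\
    has_deriv (fun x => coord chart_inf (Phi (param chart_inf x))) 0 (/ cap_k0)%C /\
    has_deriv (fun x => coord chart_inf (Psi (param chart_inf x))) 0 cap_k0.
Proof. unfold cap_k0. now destruct (constructive_indefinite_description _ Phi_at_infinity). Qed.

(** [x^2 Phi (1/x)] is holomorphic on the disk, also at [0], and
    [Phi' (1/x) = 2 cap_m x / x - cap_m' x]. *)
Definition cap_m (x : C) : C := (x * x * Phi_fin (/ x))%C.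
Definition cap_dm (x : C) : C :=
  if Ceq_dec x 0 then cap_k0 else (2 * x * Phi_fin (/ x) - Phi_derive Phi (/ x))%C.
Definition cap_k : C -> C := quotient_by_id cap_m cap_dm.

Lemma cap_m_0 : cap_m 0 = 0.
Proof. unfold cap_m. ring. Qed.

(** At [0], write [cap_m x = x / w x] with [w x = u x / x], where [u] is [Phi] in the chart at
    infinity; [w] tends to [/ cap_k0]. Elsewhere this is the product rule. *)
Lemma cap_m_deriv (x : C) : Cmod x < 1 -> has_deriv cap_m x (cap_dm x).
Proof.
  intros Hx. unfold cap_dm. destruct (Ceq_dec x 0) as [->|Hx0].
  - destruct cap_k0_spec as [H0 [Hu _]].
    set (u := fun x => coord chart_inf (Phi (param chart_inf x))) in *.
    assert (u0 : u 0 = 0).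
    { unfold u. rewrite param_inf_0, (proj2 Phi_riemann). reflexivity. }
    set (w := fun x => if Ceq_dec x 0 then (/ cap_k0)%C else (u x / x)%C).
    assert (Hw : cont_at w 0) by (now apply quotient_cont_0).
    assert (w0 : w 0 = (/ cap_k0)%C) by (unfold w; now destruct (Ceq_dec 0 0)).
    assert (Hiw : cont_at (fun x => / w x)%C 0).
    { intros eps Heps. apply (near_cont w 0 (fun y => Cmod (/ y - / w 0) < eps)); auto.
      rewrite w0.
      exact (cont_at_Cinv _ (Cinv_neq_0 _ H0) eps Heps). }
    assert (Em : forall x, cap_m x = (x * / w x)%C).
    { intros x. unfold cap_m, w. destruct (Ceq_dec x 0) as [->|Hx0]; [ring|].
      assert (E : Phi_fin (/ x) = (/ u x)%C).
      { unfold Phi_fin, u. rewrite param_inf_neq_0 by exact Hx0. apply coord_fin_inf. }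
      (* If [u x = 0], both sides vanish by the default value of the inverse. *)
      rewrite E. destruct (Ceq_dec (u x) 0) as [E0|E0].
      - rewrite E0. unfold Cdiv. rewrite Cmult_0_l, Cinv_0. ring.
      - field. split; auto. }
    intros eps Heps. generalize (Hiw eps Heps). apply near_imp. intros y Hy.
    rewrite !Em, w0, Cinv_inv. rewrite w0, Cinv_inv in Hy.
    replace (y * / w y - 0 * cap_k0 - cap_k0 * (y - 0))%C with ((/ w y - cap_k0) * (y - 0))%C by ring.
    rewrite Cmod_mult. apply Rmult_le_compat_r; [apply Cmod_ge_0|lra].
  - unfold cap_m.
    apply has_deriv_val with
      ((1 * x + x * 1) * Phi_fin (/ x) + x * x * (Phi_derive Phi (/ x) * - / (x * x)))%C.
    2:{ field. exact Hx0. }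
    apply (has_deriv_mult (fun x => x * x)%C (fun x => Phi_fin (/ x))).
    + apply (has_deriv_mult (fun x => x) (fun x => x)); apply has_deriv_id.
    + apply (has_deriv_comp Phi_fin Cinv).
      * apply Phi_fin_deriv. now apply Cmod_inv_gt_1.
      * now apply has_deriv_inv_id.
Qed.

Lemma cap_k_cont (x : C) : Cmod x < 1 -> cont_at cap_k x.
Proof. apply quotient_by_id_cont; [exact cap_m_deriv|exact cap_m_0]. Qed.

Lemma cont_at_2k_minus_dm (x : C) : Cmod x < 1 -> cont_at (fun y => 2 * cap_k y - cap_dm y)%C x.
Proof.
  intros Hx eps Heps. assert (He : 0 < eps / 4) by lra.
  generalize (near_and _ _ _ (cap_k_cont x Hx _ He) (dm_cont cap_m cap_dm cap_m_deriv x Hx _ He)).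
  apply near_imp. intros y [H1 H2].
  replace (2 * cap_k y - cap_dm y - (2 * cap_k x - cap_dm x))%C
    with (2 * (cap_k y - cap_k x) - (cap_dm y - cap_dm x))%C by ring.
  eapply Rle_lt_trans; [apply Cmod_triangle_sub|].
  rewrite Cmod_mult, Cmod_R, Rabs_pos_eq by lra. lra.
Qed.

(** Away from [0] this is algebra. At [0] the integrand is defined as a limit, which the continuity
    of the right-hand side evaluates. *)
Lemma cap_integrand_eq (x : C) : Cmod x < 1 -> cap_integrand Phi x = (2 * cap_k x - cap_dm x)%C.
Proof.
  assert (H : forall x : C, x <> 0 -> Phi_derive Phi (/ x) = (2 * cap_k x - cap_dm x)%C).
  { intros y Hy. unfold cap_k, quotient_by_id, cap_dm, cap_m. destruct (Ceq_dec y 0); [contradiction|].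
    field. exact Hy. }
  intros Hx. unfold cap_integrand. destruct (Ceq_dec x 0) as [->|Hx0]; [|now apply H].
  apply is_C_lim_unique. intros Q HQ. apply locally_near in HQ.
  assert (Hc := near_cont _ _ _ (cont_at_2k_minus_dm 0 Hx) HQ).
  apply locally_near. revert Hc. apply near_imp. intros y Hy Hy0. now rewrite H.
Qed.

Lemma cap_integrand_0 : cap_integrand Phi 0 = cap_k0.
Proof.
  rewrite cap_integrand_eq by (rewrite Cmod_0; lra).
  unfold cap_k, quotient_by_id, cap_dm. destruct (Ceq_dec 0 0) as [_|]; [ring|congruence].
Qed.

Lemma cap_integrand_neq_0 (x : C) : Cmod x < 1 -> cap_integrand Phi x <> 0.
Proof.
  intros Hx. destruct (Ceq_dec x 0) as [->|Hx0].
  - rewrite cap_integrand_0. apply cap_k0_spec.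
  - unfold cap_integrand. destruct (Ceq_dec x 0); [contradiction|].
    apply Phi_derive_neq_0. now apply Cmod_inv_gt_1.
Qed.

(** Integration by parts. *)
Lemma cap_g_eq (z : C) : Cmod z < 1 -> cap_g Phi z = (2 * (z * radial_mean cap_k z) - cap_m z)%C.
Proof.
  intros Hz.
  assert (I1 := is_RInt_C_scal 2 _ _ _ _ (radial_mean_correct cap_k z cap_k_cont Hz)).
  assert (I2 := radial_mean_correct cap_dm z (dm_cont cap_m cap_dm cap_m_deriv) Hz).
  assert (I3 := is_RInt_minus (V := C_R_NormedModule) _ _ _ _ _ _ I1 I2).
  unfold cap_g.
  assert (E : RInt (V := C_R_CompleteNormedModule)
                (fun t : R => cap_integrand Phi (t * z)%C) 0 1
              = (2 * radial_mean cap_k z - radial_mean cap_dm z)%C :> C).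
  { apply RInt_C_unique. refine (is_RInt_ext (V := C_R_NormedModule) _ _ 0 1 _ _ I3).
    rewrite Rmin_left, Rmax_right by lra. intros t Ht. symmetry.
    apply cap_integrand_eq. generalize (radius_in_disk t z ltac:(lra)). lra. }
  rewrite E, <- (mean_dm cap_m cap_dm cap_m_deriv cap_m_0 z Hz). ring.
Qed.

Lemma cap_k_primitive (z : C) : Cmod z < 1 -> has_deriv (fun z => z * radial_mean cap_k z)%C z (cap_k z).
Proof. exact (radial_primitive cap_m cap_dm cap_m_deriv cap_m_0 z). Qed.

Lemma cap_k_mult (z : C) : (z * cap_k z)%C = cap_m z.
Proof. exact (quotient_by_id_mult cap_m cap_dm cap_m_0 z). Qed.

Lemma cap_g_deriv (z : C) : Cmod z < 1 -> has_deriv (cap_g Phi) z (cap_integrand Phi z).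
Proof.
  intros Hz. rewrite cap_integrand_eq by exact Hz.
  apply has_deriv_ext_near with (fun z => 2 * (z * radial_mean cap_k z) - cap_m z)%C.
  - generalize (near_in_disk z Hz). apply near_imp. intros y Hy. symmetry. now apply cap_g_eq.
  - apply has_deriv_minus; [|now apply cap_m_deriv]. apply has_deriv_scal. now apply cap_k_primitive.
Qed.

Lemma cap_g_locally_injective (z : C) :
  Cmod z < 1 -> exists r, 0 < r /\ injective_on (fun w => Cmod (w - z) < r) (cap_g Phi).
Proof.
  intros Hz.
  destruct (expanding_near (cap_g Phi) (cap_integrand Phi) z) as [r [Hr K]].
  - generalize (near_in_disk z Hz). apply near_imp. exact cap_g_deriv.
  - now apply cap_integrand_neq_0.
  - exists r. split; [exact Hr|].
    apply (expanding_injective _ _ _ (Cmod (cap_integrand Phi z) / 2)); auto.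
    apply Rdiv_lt_0_compat; [|lra]. apply Cmod_gt_0. now apply cap_integrand_neq_0.
Qed.

Lemma open_ball (z : C) (r : R) : open (fun w : C => Cmod (w - z) < r).
Proof. apply open_near. intros w Hw. now apply near_ball. Qed.

Lemma cap_g_locally_univalent : locally_univalent unit_disk (cap_g Phi).
Proof.
  intros z Hz. split.
  - apply ex_derive_has_deriv. eexists. now apply cap_g_deriv.
  - destruct (cap_g_locally_injective z Hz) as [r [Hr Hinj]].
    exists (fun w => Cmod (w - z) < r). split; [apply open_ball|].
    split; [now rewrite Cmod_self|exact Hinj].
Qed.

(** The complement is open at finite points because [P] is closed, and at infinity because [P] is
    bounded. *)
Lemma complement_near (p : sphere) (c : chart) :
  complement P p -> in_chart c p -> near (coord c p) (fun u => complement P (param c u)).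
Proof.
  intros Hp Hc. destruct c, p as [w|]; simpl coord; try (now destruct Hc).
  - now apply compact_closed.
  - assert (Hw : w <> 0) by (intros ->; now apply Hc).
    assert (K : near (/ w)%C (fun u => ~ P (/ u)%C)).
    { apply (near_cont Cinv (/ w)%C (fun y => ~ P y)).
      - exact (cont_at_Cinv _ (Cinv_neq_0 _ Hw)).
      - rewrite Cinv_inv. now apply compact_closed. }
    revert K. apply near_imp. intros u Hu. simpl. destruct (Ceq_dec u 0); [exact I|exact Hu].
  - destruct (compact_bounded P P_compact) as [M [HM K]].
    exists (/ M). split; [now apply Rinv_0_lt_compat|].
    intros u Hu. replace (u - 0)%C with u in Hu by ring.
    simpl. destruct (Ceq_dec u 0) as [|Hu0]; [exact I|].
    intros HP. specialize (K _ HP). rewrite Cmod_inv in K by exact Hu0.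
    apply Cmod_gt_0 in Hu0. apply Rinv_lt_contravar in K.
    + rewrite Rinv_inv in K. lra.
    + apply Rmult_lt_0_compat; auto. now apply Rinv_0_lt_compat.
Qed.

Lemma exp_m2_ln (r : R) : 0 < r -> exp (- 2 * ln r) = / (r * r).
Proof.
  intros Hr. replace (- 2 * ln r) with (- (ln r + ln r)) by ring.
  rewrite exp_Ropp, exp_plus, exp_ln; auto.
Qed.

Lemma exp_green (w : C) :
  ~ P w -> exp (- 2 * green P Psi w) = / (Cmod (Psi_fin w) * Cmod (Psi_fin w)).
Proof.
  intros Hw. unfold green. destruct (excluded_middle_informative (P w)); [contradiction|].
  apply exp_m2_ln. destruct (Psi_Fin w Hw) as [_ H]. unfold Psi_fin in H. exact (Rlt_trans _ _ _ Rlt_0_1 H).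
Qed.

Lemma disk_coordinate (p : sphere) : complement P p -> Cmod (coord chart_inf (Psi p)) < 1.
Proof.
  intros Hp. destruct p as [w|].
  - destruct (Psi_Fin w Hp) as [-> H]. simpl.
    now apply Cmod_inv_lt_1.
  - rewrite Psi_Inf. simpl. rewrite Cmod_0. lra.
Qed.

Lemma disk_coordinate_injective (p q : sphere) :
  complement P p -> complement P q ->
  coord chart_inf (Psi p) = coord chart_inf (Psi q) -> p = q.
Proof.
  intros Hp Hq E. destruct Phi_riemann as [[_ [HV [_ [H _]]]] _].
  rewrite <- (H p Hp), <- (H q Hq). f_equal.
  assert (K : forall p, complement P p -> in_chart chart_inf (Psi p)).
  { intros [w|] Hw; simpl.
    - destruct (Psi_Fin w Hw) as [-> H1]. intros Z. injection Z as Z.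
      rewrite Z, Cmod_0 in H1. lra.
    - now rewrite Psi_Inf. }
  rewrite <- (param_coord chart_inf (Psi p)), <- (param_coord chart_inf (Psi q)); auto.
  now rewrite E.
Qed.

(** The factor [Phi' (1/x)] of [g'] cancels against the derivative of [Psi]; what remains is the
    derivative of inversion. *)
Lemma development_deriv_fin (w : C) :
  ~ P w -> has_deriv (fun u => cap_development Phi Psi (Fin u)) w
             (- / (Psi_fin w * Psi_fin w))%C.
Proof.
  intros Hw. destruct (Psi_Fin w Hw) as [_ H1].
  assert (H0 : Psi_fin w <> 0) by (apply Cmod_gt_0; lra).
  destruct (Psi_fin_deriv w Hw) as [Hd Hderiv].
  apply has_deriv_ext with (fun u => cap_g Phi (/ Psi_fin u)%C).
  { intros u. unfold cap_development, Psi_fin. now rewrite <- coord_inf_fin. }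
  apply has_deriv_val with
    (cap_integrand Phi (/ Psi_fin w) *
       (- / Phi_derive Phi (Psi_fin w) / (Psi_fin w * Psi_fin w)))%C.
  - apply (has_deriv_comp (cap_g Phi) (fun u => / Psi_fin u)%C).
    + apply cap_g_deriv. now apply Cmod_inv_lt_1.
    + now apply has_deriv_inv.
  - unfold cap_integrand. destruct (Ceq_dec (/ Psi_fin w) 0) as [E|_].
    + exfalso. exact (Cinv_neq_0 _ H0 E).
    + rewrite Cinv_inv. field. split; auto.
Qed.

(** One factor [cap_k0] is [g' 0], the other is the derivative of [Psi] in the chart at infinity. *)
Lemma development_deriv_inf :
  has_deriv (fun u => cap_development Phi Psi (param chart_inf u)) 0 (cap_k0 * cap_k0)%C.
Proof.
  rewrite <- cap_integrand_0 at 1.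
  apply (has_deriv_comp (cap_g Phi) (fun u => coord chart_inf (Psi (param chart_inf u)))).
  - rewrite param_inf_0, Psi_Inf. apply cap_g_deriv. simpl. rewrite Cmod_0. lra.
  - apply cap_k0_spec.
Qed.

(** For [u <> 0] near [0] the density is the square of [Cmod (v u / u)], where [v] is [Psi] in the
    chart at infinity, and [v u / u] tends to [cap_k0]. *)
Lemma cap_metric_inf : cap_metric P Psi chart_inf 0 = Cmod (cap_k0 * cap_k0)%C.
Proof.
  unfold cap_metric. destruct (Ceq_dec 0 0) as [_|]; [|congruence].
  apply lim_filtermap_unique; [exact locally'_0_proper|].
  destruct cap_k0_spec as [H0 [_ Hv]].
  set (v := fun x => coord chart_inf (Psi (param chart_inf x))) in *.
  assert (v0 : v 0 = 0) by (unfold v; rewrite param_inf_0, Psi_Inf; reflexivity).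
  set (q := fun x => if Ceq_dec x 0 then cap_k0 else (v x / x)%C).
  assert (Hq : cont_at q 0) by (now apply quotient_cont_0).
  assert (q0 : q 0 = cap_k0) by (unfold q; now destruct (Ceq_dec 0 0)).
  intros eps Heps.
  set (a := Cmod cap_k0). assert (Ha : 0 <= a) by apply Cmod_ge_0.
  set (e := Rmin 1 (eps / (2 * a + 2))).
  assert (He' : 0 < eps / (2 * a + 2)) by (apply Rdiv_lt_0_compat; lra).
  assert (He : 0 < e) by (apply Rmin_pos; lra).
  assert (He1 : e <= 1) by apply Rmin_l.
  assert (He2 : e * (2 * a + 2) <= eps).
  { apply Rle_trans with (eps / (2 * a + 2) * (2 * a + 2)).
    - apply Rmult_le_compat_r; [lra|apply Rmin_r].
    - right. field. lra. }
  apply locally_near.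
  generalize (near_and _ _ _ (Hq e He) (complement_near Inf chart_inf I ltac:(discriminate))).
  apply near_imp. intros u [Hu1 Hu2] Hu0.
  rewrite param_inf_neq_0 in Hu2 by exact Hu0. simpl in Hu2.
  rewrite exp_green by exact Hu2.
  destruct (Psi_Fin _ Hu2) as [_ H1].
  assert (E : / (Cmod (Psi_fin (/ u)) * Cmod (Psi_fin (/ u))) / Cmod u ^ 2 = Cmod (q u) * Cmod (q u)).
  { unfold q. destruct (Ceq_dec u 0); [contradiction|].
    assert (Ev : v u = (/ Psi_fin (/ u))%C).
    { unfold v. rewrite param_inf_neq_0 by exact Hu0. apply coord_inf_fin. }
    assert (Hn : Psi_fin (/ u) <> 0) by (apply Cmod_gt_0; lra).
    rewrite Ev, Cmod_div, Cmod_inv by auto. apply Cmod_gt_0 in Hu0. field. lra. }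
  rewrite E, q0 in *. rewrite Cmod_mult. fold a.
  assert (Hb : Rabs (Cmod (q u) - a) < e).
  { eapply Rle_lt_trans; [|exact Hu1]. apply Rabs_le. unfold a.
    generalize (Cmod_triangle_inv (q u) cap_k0), (Cmod_triangle_inv cap_k0 (q u)).
    rewrite (Cmod_minus_sym cap_k0). lra. }
  replace (Cmod (q u) * Cmod (q u) - a * a) with ((Cmod (q u) - a) * (Cmod (q u) + a)) by ring.
  rewrite Rabs_mult. assert (Hq0 := Cmod_ge_0 (q u)).
  rewrite (Rabs_pos_eq (Cmod (q u) + a)) by lra.
  apply Rabs_def2 in Hb as Hb'.
  apply Rle_lt_trans with (Rabs (Cmod (q u) - a) * (2 * a + 1)).
  - apply Rmult_le_compat_l; [apply Rabs_pos|lra].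
  - generalize (Rabs_pos (Cmod (q u) - a)). nra.
Qed.

Lemma development_deriv (p : sphere) (c : chart) :
  complement P p -> in_chart c p ->
  exists l, has_deriv (fun u => cap_development Phi Psi (param c u)) (coord c p) l /\
    Cmod l = cap_metric P Psi c (coord c p).
Proof.
  intros Hp Hc. destruct c, p as [w|]; try (now destruct Hc).
  - exists (- / (Psi_fin w * Psi_fin w))%C. split; [now apply development_deriv_fin|].
    destruct (Psi_Fin w Hp) as [_ H1].
    assert (H0 : Psi_fin w <> 0) by (apply Cmod_gt_0; lra).
    simpl. rewrite exp_green by exact Hp.
    rewrite Cmod_opp, Cmod_inv, Cmod_mult; auto. now apply Cmult_neq_0.
  - assert (Hw : w <> 0) by (intros ->; now apply Hc).
    exists (- / (Psi_fin w * Psi_fin w) * (- / (/ w * / w)))%C. split.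
    + apply has_deriv_ext_near with (fun u => cap_development Phi Psi (Fin (/ u))).
      * generalize (near_neq (/ w)%C 0 (Cinv_neq_0 _ Hw)). apply near_imp. intros u Hu.
        now rewrite param_inf_neq_0.
      * apply (has_deriv_comp (fun u => cap_development Phi Psi (Fin u)) Cinv).
        -- simpl. rewrite Cinv_inv. now apply development_deriv_fin.
        -- apply has_deriv_inv_id. now apply Cinv_neq_0.
    + destruct (Psi_Fin w Hp) as [_ H1].
      assert (H0 : Psi_fin w <> 0) by (apply Cmod_gt_0; lra).
      unfold cap_metric. simpl coord.
      destruct (Ceq_dec (/ w) 0) as [E|_]; [exfalso; exact (Cinv_neq_0 _ Hw E)|].
      rewrite Cinv_inv, exp_green by exact Hp.
      assert (Hi := Cinv_neq_0 _ Hw).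
      rewrite Cmod_mult, !Cmod_opp, !Cmod_inv, !Cmod_mult, Cmod_inv;
        repeat apply Cmult_neq_0; auto.
      apply Cmod_gt_0 in Hw, H0. field. lra.
  - exists (cap_k0 * cap_k0)%C. split; [exact development_deriv_inf|].
    simpl coord. now rewrite cap_metric_inf.
Qed.

Lemma disk_coordinate_cont (p : sphere) (c : chart) :
  complement P p -> in_chart c p ->
  cont_at (fun u => coord chart_inf (Psi (param c u))) (coord c p).
Proof.
  assert (Hfin : forall w, ~ P w -> cont_at (fun u => coord chart_inf (Psi (Fin u))) w).
  { intros w Hw. destruct (Psi_Fin w Hw) as [_ H1].
    assert (H0 : Psi_fin w <> 0) by (apply Cmod_gt_0; lra).
    eapply has_deriv_cont. apply has_deriv_ext with (fun u => / Psi_fin u)%C.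
    - intros u. unfold Psi_fin. now rewrite <- coord_inf_fin.
    - apply has_deriv_inv; [exact H0|]. now apply Psi_fin_deriv. }
  intros Hp Hc. destruct c, p as [w|]; try (now destruct Hc).
  - now apply Hfin.
  - assert (Hw : w <> 0) by (intros ->; now apply Hc).
    intros eps Heps. simpl coord at 1.
    assert (K : near (/ / w)%C (fun y => Cmod (coord chart_inf (Psi (Fin y)) -
        coord chart_inf (Psi (param chart_inf (/ w)))) < eps)).
    { rewrite (param_inf_neq_0 (/ w)) by now apply Cinv_neq_0.
      rewrite Cinv_inv. now apply Hfin. }
    apply (near_cont Cinv) in K.
    + generalize (near_and _ _ _ K (near_neq (/ w)%C 0 (Cinv_neq_0 _ Hw))).
      apply near_imp. intros u [Hu Hu0]. now rewrite (param_inf_neq_0 u).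
    + exact (cont_at_Cinv _ (Cinv_neq_0 _ Hw)).
  - exact (has_deriv_cont _ _ _ (proj2 (proj2 cap_k0_spec))).
Qed.

Theorem cap_development_correct : euclidean_development P Psi (cap_development Phi Psi).
Proof.
  intros p c Hp Hc. split.
  - destruct (cap_g_locally_injective _ (disk_coordinate p Hp)) as [r [Hr Hinj]].
    assert (Hcont := disk_coordinate_cont p c Hp Hc r Hr).
    cbv beta in Hcont. rewrite (param_coord c p Hc) in Hcont.
    destruct (near_and _ _ _ Hcont (complement_near p c Hp Hc)) as [d [Hd K]].
    exists (fun u => Cmod (u - coord c p) < d). split; [apply open_ball|].
    split; [now rewrite Cmod_self|].
    intros u1 u2 H1 H2 E.
    destruct (K u1 H1) as [A1 B1]. destruct (K u2 H2) as [A2 B2].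
    rewrite <- (coord_param c u1), <- (coord_param c u2). f_equal.
    apply disk_coordinate_injective; auto.
  - destruct (development_deriv p c Hp Hc) as [l [Hl Hrho]].
    exists (fun v => l * v)%C. split; [now apply has_deriv_filterdiff|].
    intros v. now rewrite Cmod_mult, Hrho.
Qed.

End Development.

(** * Planar shapes from univalent functions on the disk *)

(** Each point of the square of half-side [M] gets a ball that lies in a chosen member of the cover
    or misses [P]; finitely many of these balls cover the square. *)
Lemma closed_bounded_compact (P : C -> Prop) (M : R) :
  (forall z, ~ P z -> near z (fun w => ~ P w)) -> (forall z, P z -> Cmod z <= M) ->
  compact_set P.
Proof.
  intros Hcl Hbd F Hopen Hcov.
  assert (HV : forall z, exists V : C -> Prop, P z -> F V /\ V z).
  { intros z. destruct (classic (P z)) as [Hz|Hz].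
    - destruct (Hcov z Hz) as [V HV]. now exists V.
    - exists (fun _ => True). tauto. }
  destruct (choice_function _ _ _ HV) as [V KV].
  assert (Hd : forall t : Compactness.Tn 2 R, exists d : posreal,
    forall w, Cmod (w - (fst t, fst (snd t))) < 2 * d ->
      if excluded_middle_informative (P (fst t, fst (snd t)))
      then V (fst t, fst (snd t)) w else ~ P w).
  { intros t. set (z := (fst t, fst (snd t)) : C).
    assert (N : near z (fun w => if excluded_middle_informative (P z) then V z w else ~ P w)).
    { destruct (excluded_middle_informative (P z)) as [Hz|Hz]; [|now apply Hcl].
      destruct (KV z Hz) as [HF HVz]. now apply (proj1 (open_near _) (Hopen _ HF)). }
    destruct N as [d [Hd K]]. assert (Hd2 : 0 < d / 2) by lra.
    exists (mkposreal _ Hd2). intros w Hw. apply K. simpl in Hw. lra. }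
  destruct (choice_function _ _ _ Hd) as [delta Kd].
  (* [compactness_list] concludes under a double negation. *)
  assert (L := compactness_list 2 (- M, (- M, tt)) (M, (M, tt)) delta).
  apply NNPP in L. destruct L as [l Hl].
  assert (Hlist : forall l : list (Compactness.Tn 2 R), exists l' : list (C -> Prop),
    List.Forall F l' /\ forall t, List.In t l -> P (fst t, fst (snd t)) ->
      List.In (V (fst t, fst (snd t))) l').
  { clear l Hl. induction l as [|t l [l' [IH1 IH2]]].
    - exists nil. split; [constructor|]. intros t [].
    - destruct (classic (P (fst t, fst (snd t)))) as [Ht|Ht].
      + exists (V (fst t, fst (snd t)) :: l'). split.
        * constructor; [now apply KV|exact IH1].
        * intros u [->|Hu] HPu; [now left|right; now apply IH2].
      + exists l'. split; [exact IH1|]. intros u [->|Hu] HPu; [contradiction|now apply IH2]. }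
  destruct (Hlist l) as [l' [H1 H2]]. exists l'. split; [exact H1|].
  intros z Hz. assert (HM := Hbd z Hz).
  assert (Hm := Rmax_Cmod z).
  assert (A1 : Rabs (fst z) <= M) by (generalize (Rmax_l (Rabs (fst z)) (Rabs (snd z))); lra).
  assert (A2 : Rabs (snd z) <= M) by (generalize (Rmax_r (Rabs (fst z)) (Rabs (snd z))); lra).
  apply Rabs_le_between in A1. apply Rabs_le_between in A2.
  destruct (Hl (fst z, (snd z, tt))) as [t [Ht1 [_ Ht2]]].
  { simpl. tauto. }
  destruct t as [a [b []]]. simpl in Ht2. destruct Ht2 as [B1 [B2 _]].
  assert (K := Kd (a, (b, tt)) z). simpl in K.
  assert (D : Cmod (z - (a, b)) < 2 * delta (a, (b, tt))).
  { replace (z - (a, b))%C with (fst z - a, snd z - b)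
      by (apply injective_projections; simpl; ring).
    eapply Rle_lt_trans; [apply Cmod_le_Rabs|]. lra. }
  specialize (K D). destruct (excluded_middle_informative (P (a, b))) as [Hp|Hp]; [|contradiction].
  exists (V (a, b)). split; [|exact K]. exact (H2 (a, (b, tt)) Ht1 Hp).
Qed.

(** * Connectedness by paths *)

Definition joined (S : C -> Prop) (x y : C) : Prop :=
  exists gamma : R -> C, gamma 0 = x /\ gamma 1 = y /\
    (forall t, 0 <= t <= 1 -> S (gamma t)) /\
    forall t, 0 <= t <= 1 -> forall eps, 0 < eps ->
      exists d, 0 < d /\ forall u, Rabs (u - t) < d -> Cmod (gamma u - gamma t) < eps.

(** Were the path to leave [V], the function equal to [-1] on [V] and to [1] elsewhere would be
    continuous along it and change sign without a zero. *)
Lemma joined_same_side (S V W : C -> Prop) (x y : C) :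
  open V -> open W -> (forall z, S z -> V z \/ W z) ->
  ~ (exists z, S z /\ V z /\ W z) -> joined S x y -> V x -> V y.
Proof.
  intros HV HW Hcov Hdis [gamma [<- [<- [HS Hc]]]] Hx.
  apply NNPP. intros Hy.
  (* [IVT] wants continuity on the whole line, so the path is extended by constants beyond
     [[0, 1]]. *)
  set (clamp := fun t => Rmax 0 (Rmin 1 t)).
  assert (Hcl : forall t, 0 <= clamp t <= 1).
  { intros t. unfold clamp. split; [apply Rmax_l|].
    apply Rmax_lub; [lra|apply Rmin_l]. }
  assert (Hcl2 : forall t u, Rabs (clamp u - clamp t) <= Rabs (u - t)).
  { intros t u. unfold clamp, Rmax, Rmin.
    destruct (Rle_dec 1 u), (Rle_dec 1 t); repeat destruct (Rle_dec _ _);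
      unfold Rabs; repeat destruct (Rcase_abs _); lra. }
  set (f := fun t => if excluded_middle_informative (V (gamma (clamp t))) then - 1 else 1).
  assert (Hf : continuity f).
  { intros t. apply continuity_pt_locally. intros eps.
    assert (Ht := Hcl t). assert (HSt := HS _ Ht).
    assert (N : near (gamma (clamp t)) (fun z => S z -> (V z <-> V (gamma (clamp t))))).
    { destruct (Hcov _ HSt) as [Hv|Hw].
      - generalize (proj1 (open_near V) HV _ Hv). apply near_imp. tauto.
      - assert (Hnv : forall z, S z -> W z -> ~ V z) by (intros z A1 A2 A3; apply Hdis; now exists z).
        generalize (proj1 (open_near W) HW _ Hw). apply near_imp.
        intros z Hz HSz. split; intros K; exfalso; revert K; now apply Hnv. }
    destruct N as [e [He K]]. destruct (Hc _ Ht e He) as [d [Hd L]].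
    exists (mkposreal _ Hd). intros u Hu.
    assert (Hu' : Rabs (clamp u - clamp t) < d) by (eapply Rle_lt_trans; [apply Hcl2|exact Hu]).
    specialize (K _ (L _ Hu') (HS _ (Hcl u))).
    unfold f. destruct (excluded_middle_informative (V (gamma (clamp u)))),
      (excluded_middle_informative (V (gamma (clamp t)))); try tauto;
      rewrite Rminus_diag, Rabs_R0; apply cond_pos. }
  assert (c0 : clamp 0 = 0) by (unfold clamp; rewrite Rmin_right, Rmax_left; lra).
  assert (c1 : clamp 1 = 1) by (unfold clamp; rewrite Rmin_right, Rmax_right; lra).
  destruct (IVT f 0 1 Hf) as [t [_ Ht]].
  - lra.
  - unfold f. rewrite c0. destruct (excluded_middle_informative (V (gamma 0))); [lra|contradiction].
  - unfold f. rewrite c1. destruct (excluded_middle_informative (V (gamma 1))); [contradiction|lra].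
  - unfold f in Ht. destruct (excluded_middle_informative _); lra.
Qed.

(** The intermediate point allows a detour without concatenating paths. *)
Lemma connected_of_joined (S : C -> Prop) (b : C) :
  (forall x, S x -> exists y, joined S x y /\ joined S y b) -> connected_set S.
Proof.
  intros H V W HV HW Hcov [x [Sx Vx]] [y [Sy Wy]].
  apply NNPP. intros Hdis.
  assert (Hdis' : ~ exists z, S z /\ W z /\ V z).
  { intros [z [A1 [A2 A3]]]. apply Hdis. now exists z. }
  assert (Hcov' : forall z, S z -> W z \/ V z) by (intros z Hz; destruct (Hcov z Hz); tauto).
  destruct (H x Sx) as [x' [J1 J2]]. destruct (H y Sy) as [y' [J3 J4]].
  assert (Vb : V b).
  { apply (joined_same_side S V W x' b); auto. now apply (joined_same_side S V W x x'). }
  assert (Wb : W b).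
  { apply (joined_same_side S W V y' b); auto. now apply (joined_same_side S W V y y'). }
  assert (Sb : S b).
  { destruct J2 as [g [_ [<- [K _]]]]. apply K. lra. }
  apply Hdis. now exists b.
Qed.

Lemma joined_segment (S : C -> Prop) (f : C -> C) (p q : C) :
  (forall t : R, 0 <= t <= 1 -> S (f (p + t * (q - p))%C)) ->
  (forall t : R, 0 <= t <= 1 -> cont_at f (p + t * (q - p))%C) ->
  joined S (f p) (f q).
Proof.
  intros HS Hc. exists (fun t : R => f (p + t * (q - p))%C).
  split; [f_equal; ring|]. split; [f_equal; ring|]. split; [exact HS|].
  intros t Ht eps Heps. destruct (Hc t Ht eps Heps) as [d [Hd K]].
  assert (Hq := Cmod_ge_0 (q - p)).
  exists (d / (Cmod (q - p) + 1)). split; [apply Rdiv_lt_0_compat; lra|].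
  intros u Hu. apply K.
  replace (p + u * (q - p) - (p + t * (q - p)))%C with ((u - t)%R * (q - p))%C
    by (rewrite RtoC_minus; ring).
  rewrite Cmod_mult, Cmod_R.
  apply (Rmult_lt_compat_r (Cmod (q - p) + 1)) in Hu; [|lra].
  replace (d / (Cmod (q - p) + 1) * (Cmod (q - p) + 1)) with d in Hu by (field; lra).
  generalize (Rabs_pos (u - t)). nra.
Qed.

(** * The omitted set of [1 / F] and its Riemann map *)

Section Disk_map.

Variables F dF : C -> C.
Hypothesis F_deriv : forall x, Cmod x < 1 -> has_deriv F x (dF x).
Hypothesis dF_neq_0 : forall x, Cmod x < 1 -> dF x <> 0.
Hypothesis F_0 : F 0 = 0.
Hypothesis F_inj : injective_on unit_disk F.

(** [w <> 1 / F x] for all [x], avoiding the junk value of [/ 0] at [x = 0]. *)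
Definition omitted_set (w : C) : Prop := ~ exists x, Cmod x < 1 /\ (w * F x)%C = 1.

Definition disk_inverse (y : C) : C :=
  epsilon (inhabits (RtoC 0)) (fun x => Cmod x < 1 /\ F x = y).

Definition exterior_map (p : sphere) : sphere :=
  match p with Fin z => Fin (/ F (/ z)) | Inf => Inf end.

Definition exterior_inverse (p : sphere) : sphere :=
  match p with Fin w => Fin (/ disk_inverse (/ w)) | Inf => Inf end.

Lemma disk_inverse_F (x : C) : Cmod x < 1 -> disk_inverse (F x) = x.
Proof.
  intros Hx.
  assert (H := epsilon_spec (inhabits (RtoC 0)) (fun y => Cmod y < 1 /\ F y = F x)
                 (ex_intro _ x (conj Hx eq_refl))).
  destruct H as [H1 H2]. now apply F_inj.
Qed.

Lemma F_neq_0 (x : C) : Cmod x < 1 -> x <> 0 -> F x <> 0.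
Proof.
  intros Hx H0 E. apply H0. apply F_inj; auto.
  - unfold unit_disk. rewrite Cmod_0. lra.
  - now rewrite F_0.
Qed.

Lemma not_omitted (w : C) :
  ~ omitted_set w -> exists x, Cmod x < 1 /\ x <> 0 /\ w <> 0 /\ (/ w)%C = F x.
Proof.
  intros H. apply NNPP in H. destruct H as [x [Hx E]].
  assert (Hw : w <> 0).
  { intros ->. rewrite Cmult_0_l in E. apply RtoC_inj in E. lra. }
  exists x. repeat split; auto.
  - intros ->. rewrite F_0, Cmult_0_r in E. apply RtoC_inj in E. lra.
  - replace (F x) with (/ w * (w * F x))%C by (field; exact Hw). rewrite E. ring.
Qed.

Lemma not_omitted_image (x : C) : Cmod x < 1 -> x <> 0 -> ~ omitted_set (/ F x)%C.
Proof.
  intros Hx H0 H. apply H. exists x. split; [exact Hx|].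
  apply Cinv_l. now apply F_neq_0.
Qed.

Lemma near_F_deriv (x : C) : Cmod x < 1 -> near x (fun y => has_deriv F y (dF y)).
Proof. intros Hx. generalize (near_in_disk x Hx). apply near_imp. exact F_deriv. Qed.

Lemma disk_inverse_deriv (x : C) :
  Cmod x < 1 -> has_deriv disk_inverse (F x) (/ dF x)%C.
Proof.
  intros Hx. apply inverse_has_deriv.
  - now apply near_F_deriv.
  - now apply dF_neq_0.
  - generalize (near_in_disk x Hx). apply near_imp. exact disk_inverse_F.
Qed.

Lemma image_open (x : C) : Cmod x < 1 -> near (F x) (fun y => exists z, Cmod z < 1 /\ F z = y).
Proof.
  intros Hx. assert (Hr : 0 < 1 - Cmod x) by lra.
  generalize (locally_onto F dF x _ (near_F_deriv x Hx) (dF_neq_0 x Hx) Hr).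
  apply near_imp. intros y [z [Hz E]]. exists z. split; [|exact E].
  generalize (Cmod_triangle_inv z x). lra.
Qed.

(** [F] parametrizes the coordinate [1 / w]: in the charts at infinity the map is [F] itself and its
    inverse is [disk_inverse], so that holomorphy at infinity is differentiability at [0]. *)
Lemma exterior_map_riemann : riemann_map omitted_set exterior_map exterior_inverse.
Proof.
  assert (Hext := Cmod_inv_lt_1).
  split; [|reflexivity]. repeat split.
  - intros [z|] Hz; simpl; [|exact I]. destruct (Hext z Hz) as [H0 H1].
    apply not_omitted_image; auto. now apply Cinv_neq_0.
  - intros [w|] Hw; simpl; [|exact I]. destruct (not_omitted w Hw) as [x [Hx [Hx0 [Hw0 E]]]].
    rewrite E, disk_inverse_F by exact Hx. now apply Cmod_inv_gt_1.
  - intros [z|] Hz; simpl; [|reflexivity]. destruct (Hext z Hz) as [H0 H1].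
    now rewrite Cinv_inv, disk_inverse_F, Cinv_inv.
  - intros [w|] Hw; simpl; [|reflexivity]. destruct (not_omitted w Hw) as [x [Hx [Hx0 [Hw0 E]]]].
    rewrite E, disk_inverse_F by exact Hx. now rewrite Cinv_inv, <- E, Cinv_inv.
  - intros [z|] Hz.
    + destruct (Hext z Hz) as [H0 H1]. exists chart_fin, chart_fin.
      split; [discriminate|]. split; [discriminate|]. split.
      * apply locally_near. apply near_all. discriminate.
      * apply ex_derive_has_deriv. simpl. eexists.
        apply has_deriv_inv.
        -- apply F_neq_0; auto. now apply Cinv_neq_0.
        -- apply (has_deriv_comp F Cinv); [now apply F_deriv|now apply has_deriv_inv_id].
    + exists chart_inf, chart_inf. split; [discriminate|]. split; [discriminate|].
      assert (H01 : Cmod 0 < 1) by (rewrite Cmod_0; lra). split.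
      * apply locally_near. simpl coord. generalize (near_in_disk 0 H01). apply near_imp.
        intros x Hx. simpl. destruct (Ceq_dec x 0) as [E|E]; [discriminate|].
        simpl. rewrite Cinv_inv. intros Z.
        apply (Cinv_neq_0 _ (F_neq_0 x Hx E)). exact (f_equal (coord chart_fin) Z).
      * apply ex_derive_has_deriv. simpl coord at 2. exists (dF 0).
        apply has_deriv_ext with F; [|now apply F_deriv].
        intros x. simpl. destruct (Ceq_dec x 0) as [->|E]; simpl; [exact F_0|].
        now rewrite !Cinv_inv.
  - intros [w|] Hw.
    + destruct (not_omitted w Hw) as [x [Hx [Hx0 [Hw0 E]]]]. exists chart_fin, chart_fin.
      split; [discriminate|]. split; [discriminate|]. split.
      * apply locally_near. apply near_all. discriminate.
      * apply ex_derive_has_deriv. simpl. eexists.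
        apply has_deriv_inv.
        -- rewrite E, disk_inverse_F; auto.
        -- apply (has_deriv_comp disk_inverse Cinv); [|now apply has_deriv_inv_id].
           rewrite E. now apply disk_inverse_deriv.
    + exists chart_inf, chart_inf. split; [discriminate|]. split; [discriminate|].
      assert (H01 : Cmod 0 < 1) by (rewrite Cmod_0; lra). split.
      * apply locally_near. simpl coord. assert (K := image_open 0 H01). rewrite F_0 in K.
        revert K. apply near_imp. intros y [x [Hx <-]].
        simpl. destruct (Ceq_dec (F x) 0) as [E|E]; [discriminate|].
        simpl. rewrite Cinv_inv, disk_inverse_F by exact Hx.
        intros Z. assert (Hx0 : x <> 0) by (intros ->; now apply E).
        exact (Cinv_neq_0 _ Hx0 (f_equal (coord chart_fin) Z)).
      * apply ex_derive_has_deriv. simpl coord at 2. exists (/ dF 0)%C.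
        assert (K := disk_inverse_deriv 0 H01). rewrite F_0 in K.
        assert (G0 : disk_inverse 0 = 0) by (rewrite <- F_0 at 1; now apply disk_inverse_F).
        apply has_deriv_ext with disk_inverse; [|exact K].
        intros x. simpl. destruct (Ceq_dec x 0) as [->|E]; simpl; [exact G0|].
        now rewrite !Cinv_inv.
Qed.

(** Both halves come from the openness of [F]: the omitted set is closed, and since the image of [F]
    contains a disk of radius [d] about [0], it lies in the disk of radius [/ d]. *)
Lemma omitted_set_compact : compact_set omitted_set.
Proof.
  assert (H01 : Cmod 0 < 1) by (rewrite Cmod_0; lra).
  assert (K := image_open 0 H01). rewrite F_0 in K. destruct K as [d [Hd K]].
  apply closed_bounded_compact with (/ d).
  - intros w Hw. destruct (not_omitted w Hw) as [x [Hx [Hx0 [Hw0 E]]]].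
    assert (N : near w (fun y => exists z, Cmod z < 1 /\ F z = (/ y)%C)).
    { apply (near_cont Cinv w (fun y => exists z, Cmod z < 1 /\ F z = y)).
      - exact (cont_at_Cinv _ Hw0).
      - rewrite E. now apply image_open. }
    generalize (near_and _ _ _ N (near_neq w 0 Hw0)). apply near_imp.
    intros y [[z [Hz Ez]] Hy] Ho. apply Ho. exists z. split; [exact Hz|].
    rewrite Ez. now apply Cinv_r.
  - intros w Hw. apply Rnot_lt_le. intros Hlt.
    assert (Hp : 0 < / d) by now apply Rinv_0_lt_compat.
    assert (Hw0 : w <> 0) by (apply Cmod_gt_0; lra).
    apply Hw. destruct (K (/ w)%C) as [x [Hx E]].
    + replace (/ w - 0)%C with (/ w)%C by ring. rewrite Cmod_inv by exact Hw0.
      rewrite <- (Rinv_inv d). apply Rinv_lt_contravar; [|exact Hlt].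
      apply Rmult_lt_0_compat; lra.
    + exists x. split; [exact Hx|]. rewrite E. now apply Cinv_r.
Qed.

(** In the plane, without infinity, the complement is the image of the punctured disk. A segment to
    the base point [1/2] can meet the puncture only from a real point, which takes a detour through
    [Ci / 2]. *)
Lemma complement_omitted_connected : connected_set (fun w => ~ omitted_set w).
Proof.
  set (S := fun w => ~ omitted_set w).
  set (G := fun x => (/ F x)%C).
  assert (J : forall p q : C, Cmod p < 1 -> Cmod q < 1 ->
     (forall t : R, 0 <= t <= 1 -> (p + t * (q - p))%C <> 0) -> joined S (G p) (G q)).
  { intros p q Hp Hq H0.
    assert (Hin : forall t : R, 0 <= t <= 1 -> Cmod (p + t * (q - p)) < 1).
    { intros t Ht. now apply disk_convex. }
    apply joined_segment.
    - intros t Ht. apply not_omitted_image; auto.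
    - intros t Ht. eapply has_deriv_cont. apply has_deriv_inv.
      + apply F_neq_0; auto.
      + now apply F_deriv, Hin. }
  assert (Him : forall a b c d : R, forall t : R,
     ((a, b) + t * ((c, d) - (a, b)))%C = (a + t * (c - a), b + t * (d - b))).
  { intros. apply injective_projections; simpl; ring. }
  assert (Hh : Cmod (1 / 2, 0) < 1).
  { eapply Rle_lt_trans; [apply Cmod_le_Rabs|]. rewrite Rabs_R0, Rabs_pos_eq; lra. }
  assert (Hi : Cmod (0, 1 / 2) < 1).
  { eapply Rle_lt_trans; [apply Cmod_le_Rabs|]. rewrite Rabs_R0, Rabs_pos_eq; lra. }
  apply (connected_of_joined S (G (1 / 2, 0%R))).
  intros w Hw. destruct (not_omitted w Hw) as [x [Hx [Hx0 [Hw0 E]]]].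
  assert (Ew : w = G x) by (unfold G; now rewrite <- E, Cinv_inv).
  rewrite Ew. destruct x as [a b].
  destruct (Req_dec b 0) as [->|Hb].
  - exists (G (0, 1 / 2)). split; apply J; auto; intros t Ht; rewrite Him; intros Z;
      apply (f_equal fst) in Z as Z1; apply (f_equal snd) in Z as Z2; simpl in Z1, Z2.
    + assert (t = 0) by lra. subst t. apply Hx0. apply injective_projections; simpl; lra.
    + assert (t = 1) by lra. subst t. lra.
  - exists (G (1 / 2, 0%R)). split.
    + apply J; auto; intros t Ht; rewrite Him; intros Z;
      apply (f_equal fst) in Z as Z1; apply (f_equal snd) in Z as Z2; simpl in Z1, Z2.
      assert (E1 : (1 - t) * b = 0) by lra.
      apply Rmult_integral in E1. destruct E1 as [E1|]; [|contradiction].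
      assert (t = 1) by lra. subst t. lra.
    + apply J; auto; intros t Ht; rewrite Him; intros Z;
      apply (f_equal fst) in Z as Z1; simpl in Z1. lra.
Qed.

(** The image of [F] being stable under translation to the right, its complement is stable under
    translation to the left. An omitted [w <> 0] is thus joined to [0] by [1 / (1/w - t)], with [t]
    running from [0] to infinity. *)
Lemma omitted_set_connected :
  (forall x (t : R), Cmod x < 1 -> 0 <= t -> exists z, Cmod z < 1 /\ F z = (F x + t)%C) ->
  connected_set omitted_set.
Proof.
  intros Hshift. apply (connected_of_joined _ 0). intros w Hw. exists w. split.
  - apply (joined_segment _ (fun _ => w) 0 0).
    + intros. exact Hw.
    + intros. exact (has_deriv_cont _ _ _ (has_deriv_const w _)).
  - assert (Ho0 : omitted_set 0).
    { intros [x [_ E]]. rewrite Cmult_0_l in E. apply RtoC_inj in E. lra. }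
    destruct (Ceq_dec w 0) as [->|Hw0].
    { apply (joined_segment _ (fun _ => 0%C) 0 0).
      + intros. exact Ho0.
      + intros. exact (has_deriv_cont _ _ _ (has_deriv_const _ _)). }
    (* [g s = 1 / (1/w - t)] with [t = s / (1 - s)] *)
    set (g := fun s : C => ((1 - s) * / ((1 - s) * / w - s))%C).
    (* A zero of the denominator would make [1 / w] a nonnegative real, hence a translate of
       [F 0 = 0], and [w] would not be omitted. *)
    assert (Hden : forall s : R, 0 <= s <= 1 -> ((1 - s) * / w - s)%C <> 0).
    { intros s Hs Z. destruct (Req_dec s 1) as [->|Hs1].
      - replace ((1 - 1%R) * / w - 1%R)%C with (- (1))%C in Z by ring.
        apply (f_equal fst) in Z. simpl in Z. lra.
      - assert (Hs1' : (1 - s)%C <> 0).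
        { intros Z1. rewrite <- RtoC_minus in Z1. apply RtoC_inj in Z1. lra. }
        destruct (Hshift 0 (s / (1 - s))) as [x [Hx E]].
        { rewrite Cmod_0. lra. }
        { apply Rdiv_le_0_compat; lra. }
        apply Hw. exists x. split; [exact Hx|].
        rewrite E, F_0, RtoC_div, RtoC_minus by lra.
        assert (Ez : (s : C) = ((1 - s) * / w)%C).
        { transitivity ((1 - s) * / w - ((1 - s) * / w - s))%C; [ring|].
          rewrite Z. ring. }
        rewrite Ez at 1. field. split; auto. }
    assert (E0 : g 0 = w).
    { unfold g. replace (1 - 0)%C with (RtoC 1) by ring.
      replace (1 * / w - 0)%C with (/ w)%C by ring. rewrite Cinv_inv. ring. }
    assert (E1 : g 1 = 0) by (unfold g; ring).
    assert (J : joined omitted_set (g 0) (g 1)); [|now rewrite E0, E1 in J].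
    apply joined_segment.
    + intros s Hs. replace (0 + s * (1 - 0))%C with (RtoC s) by ring.
      unfold g. destruct (Req_dec s 1) as [->|Hs1].
      { replace ((1 - 1%R) * / ((1 - 1%R) * / w - 1%R))%C with (RtoC 0) by ring. exact Ho0. }
      intros [x [Hx E]].
      assert (Hs1' : (1 - s)%C <> 0).
      { intros Z1. rewrite <- RtoC_minus in Z1. apply RtoC_inj in Z1. lra. }
      destruct (Hshift x (s / (1 - s))) as [y [Hy Ey]]; auto.
      { apply Rdiv_le_0_compat; lra. }
      apply Hw. exists y. split; [exact Hy|].
      rewrite Ey, RtoC_div, RtoC_minus by lra.
      assert (Hd := Hden s Hs).
      assert (EF : F x = (((1 - s) * / w - s) / (1 - s))%C).
      { set (D := ((1 - s) * / w - s)%C) in *. clearbody D.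
        transitivity (D / (1 - s) * ((1 - s) * / D * F x))%C.
        - field. split; auto.
        - rewrite E. ring. }
      rewrite EF. field. split; auto.
    + intros s Hs. replace (0 + s * (1 - 0))%C with (RtoC s) by ring.
      unfold g. eapply has_deriv_cont. apply has_deriv_mult.
      * apply has_deriv_minus; [apply has_deriv_const|apply has_deriv_id].
      * apply has_deriv_inv; [now apply Hden|].
        apply has_deriv_minus; [|apply has_deriv_id].
        apply has_deriv_mult; [|apply has_deriv_const].
        apply has_deriv_minus; [apply has_deriv_const|apply has_deriv_id].
Qed.

Lemma omitted_set_planar (w0 : C) :
  (forall x (t : R), Cmod x < 1 -> 0 <= t -> exists z, Cmod z < 1 /\ F z = (F x + t)%C) ->
  w0 <> 0 -> omitted_set w0 ->
  planar_shape omitted_set.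
Proof.
  intros Hshift H0 Hw0.
  split; [exact omitted_set_compact|]. split; [now apply omitted_set_connected|].
  split; [|exact complement_omitted_connected].
  exists w0, 0. split; [exact Hw0|]. split; [|exact H0].
  intros [x [_ E]]. rewrite Cmult_0_l in E. apply RtoC_inj in E. lra.
Qed.

End Disk_map.

(** * The logarithm on the slit plane *)

Definition slit_plane (z : C) : Prop := 0 < Cmod z + fst z.

(** The principal branch. The argument is twice the arctangent of [tan (arg / 2) = y / (|z| + x)], a
    single formula on the whole slit plane, where the denominator is positive. *)
Definition Clog (z : C) : C :=
  (/ 2 * ln (fst z ^ 2 + snd z ^ 2), 2 * atan (snd z / (sqrt (fst z ^ 2 + snd z ^ 2) + fst z))).

Lemma slit_plane_near (z : C) : slit_plane z -> near z slit_plane.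
Proof.
  intros Hz. unfold slit_plane in *. exists ((Cmod z + fst z) / 2). split; [lra|].
  intros y Hy. generalize (Cmod_triangle_inv z y), (Cmod_Re_Lipschitz y z).
  rewrite (Cmod_minus_sym z y). intros H1 H2. apply Rabs_le_between in H2. lra.
Qed.

Lemma slit_plane_Im (z : C) : snd z <> 0 -> slit_plane z.
Proof.
  intros Hz. unfold slit_plane, Cmod.
  assert (H : Rabs (fst z) < sqrt (fst z ^ 2 + snd z ^ 2)).
  { rewrite <- sqrt_Rsqr_abs. apply sqrt_lt_1_alt. unfold Rsqr.
    assert (0 < snd z ^ 2) by (apply pow2_gt_0; exact Hz). nra. }
  generalize (Rle_abs (- fst z)). rewrite Rabs_Ropp. lra.
Qed.

Lemma slit_plane_pos (x : R) : 0 < x -> slit_plane x.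
Proof. intros Hx. unfold slit_plane. rewrite Cmod_R, Rabs_pos_eq; simpl; lra. Qed.

Lemma slit_plane_neq_0 (z : C) : slit_plane z -> z <> 0.
Proof. intros H ->. unfold slit_plane in H. rewrite Cmod_0 in H. simpl in H. lra. Qed.

Lemma continuous_Re_Im (f : C -> C) (z : C) :
  cont_at f z ->
  continuous (fun p : R * R => fst (f p)) z /\ continuous (fun p : R * R => snd (f p)) z.
Proof.
  intros Hf. split; intros Q [e He]; apply locally_near.
  - generalize (Hf e (cond_pos e)). apply near_imp. intros y Hy. apply He.
    eapply Rle_lt_trans; [|exact Hy]. apply Cmod_Re_Lipschitz.
  - generalize (Hf e (cond_pos e)). apply near_imp. intros y Hy. apply He.
    eapply Rle_lt_trans; [|exact Hy]. apply Cmod_Im_Lipschitz.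
Qed.

Lemma slit_plane_coords (x y : R) :
  slit_plane (x, y) ->
  0 < x ^ 2 + y ^ 2 /\ 0 < sqrt (x ^ 2 + y ^ 2) + x /\ 0 < sqrt (x ^ 2 + y ^ 2) /\
  sqrt (x ^ 2 + y ^ 2) * sqrt (x ^ 2 + y ^ 2) = x ^ 2 + y ^ 2.
Proof.
  intros H. assert (H0 := slit_plane_neq_0 _ H). apply Cmod_gt_0 in H0.
  unfold slit_plane in H. unfold Cmod in H, H0. simpl fst in H, H0; simpl snd in H, H0.
  assert (P : 0 < x ^ 2 + y ^ 2).
  { apply Rnot_le_lt. intros Hle. rewrite sqrt_neg_0 in H0 by exact Hle. lra. }
  repeat split; auto. apply sqrt_sqrt. lra.
Qed.

(** This is [1 + tan^2] of half the argument, with the left side in the shape produced by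
    [auto_derive]. *)
Lemma half_angle_sqr (a b r : R) :
  r + a <> 0 -> r * r = a ^ 2 + b ^ 2 ->
  1 + b / (r + a) * (b / (r + a) * 1) = 2 * r / (r + a).
Proof.
  intros H E. replace (b / (r + a) * (b / (r + a) * 1)) with (b ^ 2 / (r + a) ^ 2) by (field; lra).
  replace (b ^ 2) with (r * r - a ^ 2) by lra. field. exact H.
Qed.

Lemma Clog_deriv (z : C) : slit_plane z -> has_deriv Clog z (/ z)%C.
Proof.
  destruct z as [x y]. intros Hz.
  assert (Hn := slit_plane_near _ Hz).
  assert (Hc := cont_at_Cinv _ (slit_plane_neq_0 _ Hz)).
  destruct (continuous_Re_Im _ _ Hc) as [C1 C2].
  apply (has_deriv_of_partials (fun a b => / 2 * ln (a ^ 2 + b ^ 2))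
    (fun a b => 2 * atan (b / (sqrt (a ^ 2 + b ^ 2) + a)))
    (fun a b => a / (a ^ 2 + b ^ 2)) (fun a b => - b / (a ^ 2 + b ^ 2)) x y).
  - revert Hn. apply near_imp. intros [a b] H. simpl fst; simpl snd.
    destruct (slit_plane_coords a b H) as [P1 [P2 [P3 P4]]].
    auto_derive; [|field]; simpl in *; lra.
  - revert Hn. apply near_imp. intros [a b] H. simpl fst; simpl snd.
    destruct (slit_plane_coords a b H) as [P1 [P2 [P3 P4]]].
    auto_derive.
    + simpl in *; repeat split; lra.
    + replace (a * (a * 1) + b * (b * 1)) with (a ^ 2 + b ^ 2) by (simpl; ring).
      set (r := sqrt (a ^ 2 + b ^ 2)) in *. clearbody r.
      change (b * / (r + a)) with (b / (r + a)).
      rewrite (half_angle_sqr a b r), <- P4 by lra. field. lra.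
  - destruct (slit_plane_coords x y Hz) as [P1 [P2 [P3 P4]]].
    auto_derive; [|field]; simpl in *; lra.
  - destruct (slit_plane_coords x y Hz) as [P1 [P2 [P3 P4]]].
    auto_derive.
    + simpl in *; repeat split; lra.
    + replace (x * (x * 1) + y * (y * 1)) with (x ^ 2 + y ^ 2) by (simpl; ring).
      set (r := sqrt (x ^ 2 + y ^ 2)) in *. clearbody r.
      change (y * / (r + x)) with (y / (r + x)).
      rewrite (half_angle_sqr x y r), <- P4 by lra.
      replace (x / (r * r)) with ((r * (r + x) - (r * r - x ^ 2)) / (r * r * (r + x)))
        by (field; lra).
      replace (r * r - x ^ 2) with (y ^ 2) by lra. field. lra.
  - exact C1.
  - exact C2.
Qed.

Lemma Clog_conj (z : C) : Clog (Cconj z) = Cconj (Clog z).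
Proof.
  destruct z as [x y]. unfold Clog, Cconj; cbn [fst snd].
  replace ((- y) ^ 2) with (y ^ 2) by ring. f_equal.
  replace (- y / (sqrt (x ^ 2 + y ^ 2) + x)) with (- (y / (sqrt (x ^ 2 + y ^ 2) + x)))
    by (unfold Rdiv; ring).
  rewrite atan_opp. ring.
Qed.

Lemma Clog_pos (x : R) : 0 < x -> Clog x = RtoC (ln x).
Proof.
  intros Hx. unfold Clog, RtoC; simpl fst; simpl snd. f_equal.
  - replace (x ^ 2 + 0 ^ 2) with (x * x) by ring. rewrite ln_mult by exact Hx. field.
  - unfold Rdiv. rewrite Rmult_0_l, atan_0. ring.
Qed.

Lemma Clog_Im_pos (z : C) : 0 < snd z -> 0 < snd (Clog z).
Proof.
  intros Hz. assert (Hs : slit_plane z) by (apply slit_plane_Im; lra).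
  destruct z as [x y]. destruct (slit_plane_coords x y Hs) as [P1 [P2 [P3 P4]]].
  unfold Clog; cbn [fst snd] in *.
  assert (0 < y / (sqrt (x ^ 2 + y ^ 2) + x)) by (apply Rdiv_lt_0_compat; assumption).
  apply atan_increasing in H. rewrite atan_0 in H. lra.
Qed.

(** [Clog] tilts chords clockwise. *)
Lemma Clog_chord (z w : C) :
  0 < snd z -> 0 < snd w -> z <> w ->
  snd ((Clog w - Clog z) * Cconj (w - z))%C < 0.
Proof.
  intros Hz Hw Hne. set (d := (w - z)%C).
  assert (Hd : 0 < Cmod d).
  { apply Cmod_gt_0. intros E. apply Hne. symmetry. apply Cmod_eq. fold d. rewrite E. apply Cmod_0. }
  assert (HI : forall t : R, 0 <= t <= 1 -> 0 < snd (z + t * d)%C).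
  { intros t Ht. unfold d. simpl. nra. }
  (* The derivative along the chord is [Cmod d ^ 2 / (z + t d)], whose imaginary part is negative in
     the upper half-plane. *)
  assert (HD : forall t : R, 0 <= t <= 1 ->
    is_derive (fun u : R => Im (Clog (z + u * d) * Cconj d)%C) t
      (Im (/ (z + t * d) * Cconj d * d)%C)).
  { intros t Ht. apply (is_derive_Im (fun u : R => Clog (z + u * d) * Cconj d)%C).
    apply (has_deriv_along (fun y => Clog y * Cconj d)%C).
    apply has_deriv_val with (/ (z + t * d) * Cconj d + Clog (z + t * d) * 0)%C; [|ring].
    apply (has_deriv_mult Clog (fun _ => Cconj d)); [|apply has_deriv_const].
    apply Clog_deriv. apply slit_plane_Im. specialize (HI t Ht). lra. }
  destruct (MVT_unit _ _ HD) as [t [Ht E]].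
  specialize (HI t Ht).
  assert (E1 : Im (Clog (z + 1 * d) * Cconj d)%C - Im (Clog (z + 0 * d) * Cconj d)%C
                = snd ((Clog w - Clog z) * Cconj d)%C).
  { replace (z + 1 * d)%C with w by (unfold d; ring).
    replace (z + 0 * d)%C with z by ring. unfold Im. simpl. ring. }
  rewrite E1 in E. rewrite E.
  assert (Hslit : (z + t * d)%C <> 0).
  { apply slit_plane_neq_0, slit_plane_Im. lra. }
  apply Cmod_gt_0 in Hslit.
  replace (/ (z + t * d) * Cconj d * d)%C with (/ (z + t * d) * (d * Cconj d))%C by ring.
  rewrite <- Cmod2_conj.
  set (p := (z + t * d)%C) in *. clearbody p. destruct p as [a b]. simpl snd in HI.
  unfold Cmod in Hslit. simpl fst in Hslit; simpl snd in Hslit.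
  assert (P : 0 < a ^ 2 + b ^ 2) by nra.
  assert (Ep : Im (/ (a, b) * RtoC (Cmod d ^ 2))%C = - (b * Cmod d ^ 2 / (a ^ 2 + b ^ 2))).
  { unfold Im. simpl. field. simpl in P. lra. }
  rewrite Ep.
  assert (0 < b * Cmod d ^ 2 / (a ^ 2 + b ^ 2)); [|lra].
  apply Rdiv_lt_0_compat; [|exact P]. apply Rmult_lt_0_compat; [exact HI|].
  apply pow_lt. exact Hd.
Qed.

Lemma slit_plane_sqrt (z : C) : slit_plane z -> exists s : C, 0 < fst s /\ (s * s)%C = z.
Proof.
  intros Hz. destruct z as [a b]. destruct (slit_plane_coords a b Hz) as [P1 [P2 [P3 P4]]].
  set (r := sqrt (a ^ 2 + b ^ 2)) in *. clearbody r.
  set (p := sqrt ((r + a) / 2)).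
  assert (Hp : 0 < p) by (apply sqrt_lt_R0; lra).
  assert (Ep : p * p = (r + a) / 2) by (apply sqrt_sqrt; lra).
  exists (p, b / (2 * p)). split; [exact Hp|].
  apply injective_projections; simpl; [|field; lra].
  replace (b / (2 * p) * (b / (2 * p))) with (b ^ 2 / (4 * (p * p))) by (field; lra).
  rewrite Ep. replace (b ^ 2) with (r * r - a ^ 2) by lra. field. lra.
Qed.

(** * A non-planar cap: the arrow *)

(** In the coordinate [1 / w] the corridors between the shaft and the barbs are
    strips of width [kap * PI]. *)

Definition kap : R := / 1000.

(** [slit_coord] maps the disk onto the complement of [(-oo, 9/10]]. *)
Definition slit_coord (x : C) : C := (1 + (2 / 5) * (x / ((1 - x) * (1 - x))))%C.

(** In the coordinate [1 / w], [0 < T <= 9/10] gives the shaft and [T = 0] is sent to infinity, that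
    is, to the head. The two sides of [T < 0] are lifted to the heights [kap * PI] and [- kap * PI]
    and give the barbs. For [kap = 0] the factor [10] would make the shaft the segment [[-1, 0]]. *)
Definition slit_map (T : C) : C := (10 * (T - 1) + kap * Clog T)%C.

(** The complement of the image of [1 / arrow_map] is an arrow: its shaft is a
    real segment starting at the head [0], its barbs are two arcs starting
    there tangentially to the shaft. *)
Definition arrow_map (x : C) : C := slit_map (slit_coord x).

(** * Univalence of the arrow map *)

Lemma disk_neq_1 (x : C) : Cmod x < 1 -> (1 - x)%C <> 0.
Proof.
  intros Hx E. assert (x = 1).
  { replace x with (1 - (1 - x))%C by ring. rewrite E. ring. }
  subst x. rewrite Cmod_1 in Hx. lra.
Qed.

Lemma Cmod_sqr (x : C) : Cmod x * Cmod x = fst x * fst x + snd x * snd x.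
Proof.
  unfold Cmod. rewrite sqrt_sqrt; [ring|]. nra.
Qed.

Lemma Cmod_lt_1_sqr (x : C) : Cmod x < 1 <-> fst x * fst x + snd x * snd x < 1.
Proof.
  rewrite <- Cmod_sqr. assert (H := Cmod_ge_0 x). split; intros K; [nra|].
  apply Rnot_le_lt. intros L. nra.
Qed.

Lemma slit_coord_Im (x : C) :
  Cmod x < 1 -> exists c : R, 0 < c /\ snd (slit_coord x) = c * snd x.
Proof.
  intros Hx. assert (H1 := disk_neq_1 x Hx). apply Cmod_lt_1_sqr in Hx.
  destruct x as [a b]. simpl fst in Hx; simpl snd in Hx.
  set (q := (1 - a) * (1 - a) + b * b).
  assert (Hq : 0 < q).
  { unfold q. apply Rnot_le_lt. intros L. apply H1.
    apply injective_projections; simpl; nra. }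
  exists (2 / 5 * (1 - (a * a + b * b)) / (q * q)). split.
  - apply Rdiv_lt_0_compat; [lra|nra].
  - unfold slit_coord, Cdiv. simpl. unfold q in *. field. split; [nra|].
    replace (((1 + - a) * (1 + - a) - (0 + - b) * (0 + - b)) *
             ((1 + - a) * (1 + - a) - (0 + - b) * (0 + - b)) +
             ((1 + - a) * (0 + - b) + (0 + - b) * (1 + - a)) *
             ((1 + - a) * (0 + - b) + (0 + - b) * (1 + - a)))
      with (((1 - a) * (1 - a) + b * b) * ((1 - a) * (1 - a) + b * b)) by ring.
    nra.
Qed.

Lemma slit_coord_real (a : R) :
  -1 < a < 1 -> exists T : R, slit_coord a = T /\ 9 / 10 < T.
Proof.
  intros Ha. exists (1 + 2 / 5 * (a / ((1 - a) * (1 - a)))). split.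
  - unfold slit_coord. rewrite !RtoC_plus, !RtoC_mult, !RtoC_div, !RtoC_mult, !RtoC_minus; auto; nra.
  - replace (1 + 2 / 5 * (a / ((1 - a) * (1 - a)))) with
      (9 / 10 + (1 + a) * (1 + a) / (10 * ((1 - a) * (1 - a)))) by (field; lra).
    assert (0 < (1 + a) * (1 + a) / (10 * ((1 - a) * (1 - a)))); [|lra].
    apply Rdiv_lt_0_compat; nra.
Qed.

Lemma real_of_Im_0 (x : C) : snd x = 0 -> x = RtoC (fst x).
Proof. destruct x as [a b]. simpl. now intros ->. Qed.

Lemma disk_real (x : C) : Cmod x < 1 -> snd x = 0 -> exists a : R, x = a /\ -1 < a < 1.
Proof.
  intros Hx H0. exists (fst x). split; [now apply real_of_Im_0|].
  apply Cmod_lt_1_sqr in Hx. rewrite H0 in Hx. nra.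
Qed.

Lemma slit_coord_slit (x : C) : Cmod x < 1 -> slit_plane (slit_coord x).
Proof.
  intros Hx. destruct (Req_dec (snd x) 0) as [H0|H0].
  - destruct (disk_real x Hx H0) as [a [-> Ha]].
    destruct (slit_coord_real a Ha) as [T [-> HT]]. apply slit_plane_pos. lra.
  - destruct (slit_coord_Im x Hx) as [c [Hc E]]. apply slit_plane_Im. rewrite E.
    apply Rmult_integral_contrapositive. lra.
Qed.

(** Univalence of the Koebe function: equal values give [(x - y) (1 - x y) = 0], and [x y] lies in
    the disk. *)
Lemma slit_coord_inj : injective_on unit_disk slit_coord.
Proof.
  intros x y Hx Hy E. unfold unit_disk in *.
  assert (Nx := disk_neq_1 x Hx). assert (Ny := disk_neq_1 y Hy).
  assert (E1 : (x / ((1 - x) * (1 - x)))%C = (y / ((1 - y) * (1 - y)))%C).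
  { unfold slit_coord in E.
    assert (K : forall u : C, u = ((1 + 2 / 5 * u - 1) * (5 / 2))%C).
    { intros u. field. }
    rewrite (K (x / ((1 - x) * (1 - x)))%C), E, <- K. reflexivity. }
  assert (E2 : ((x - y) * (1 - x * y))%C = 0).
  { replace ((x - y) * (1 - x * y))%C with
      ((x / ((1 - x) * (1 - x)) - y / ((1 - y) * (1 - y))) *
        ((1 - x) * (1 - x) * ((1 - y) * (1 - y))))%C by (field; auto).
    rewrite E1. ring. }
  apply NNPP. intros Hne.
  assert (Hp : (1 - x * y)%C <> 0).
  { apply disk_neq_1. rewrite Cmod_mult. generalize (Cmod_ge_0 x), (Cmod_ge_0 y). nra. }
  apply (Cmult_neq_0 (x - y)%C (1 - x * y)%C); auto.
  intros Z. apply Hne. replace x with (x - y + y)%C by ring. rewrite Z. ring.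
Qed.

(** The Koebe function is a squared Cayley transform: [10 T - 9 = s^2] with [s = (1 + x) / (1 - x)],
    and the disk corresponds to the roots with positive real part. *)
Lemma slit_coord_onto (T : C) :
  slit_plane (10 * T - 9)%C -> exists x, Cmod x < 1 /\ slit_coord x = T.
Proof.
  intros HT. destruct (slit_plane_sqrt _ HT) as [s [Hs E]].
  assert (H1 : (s + 1)%C <> 0).
  { intros Z. apply (f_equal fst) in Z. simpl in Z. lra. }
  exists ((s - 1) / (s + 1))%C. split.
  - rewrite Cmod_div by exact H1. apply Cmod_gt_0 in H1 as H2.
    apply (Rmult_lt_reg_r (Cmod (s + 1))); [exact H2|].
    unfold Rdiv. rewrite Rmult_assoc, Rinv_l, Rmult_1_r, Rmult_1_l by lra.
    unfold Cmod. apply sqrt_lt_1_alt. clear E HT H1 H2. destruct s as [a b]. simpl in *. split; [|nra]. generalize (pow2_ge_0 (a - 1)), (pow2_ge_0 b). simpl. intros K1 K2. nra.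
  - unfold slit_coord.
    assert (H2 : (1 - (s - 1) / (s + 1))%C = (2 / (s + 1))%C) by (field; exact H1).
    rewrite H2.
    transitivity ((s * s + 9) / 10)%C; [|rewrite E; field].
    field. exact H1.
Qed.

Lemma slit_coord_conj (x : C) : slit_coord (Cconj x) = Cconj (slit_coord x).
Proof.
  assert (Kr : forall r : R, Cconj r = r).
  { intros r. apply injective_projections; simpl; ring. }
  assert (Kd : forall u v : C, Cconj (u / v)%C = (Cconj u / Cconj v)%C).
  { intros u v. apply injective_projections; simpl; unfold Rdiv.
    - replace (- snd v * (- snd v * 1)) with (snd v * (snd v * 1)) by ring. ring.
    - replace (- snd v * (- snd v * 1)) with (snd v * (snd v * 1)) by ring. ring. }
  unfold slit_coord.
  rewrite Cplus_conj, Cmult_conj, !Kd, Cmult_conj, !Cminus_conj, !Kr. reflexivity.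
Qed.

Lemma slit_map_conj (T : C) : slit_map (Cconj T) = Cconj (slit_map T).
Proof.
  unfold slit_map. rewrite Clog_conj.
  apply injective_projections; simpl; ring.
Qed.

Lemma arrow_map_conj (x : C) : arrow_map (Cconj x) = Cconj (arrow_map x).
Proof. unfold arrow_map. now rewrite slit_coord_conj, slit_map_conj. Qed.

Definition slit_map_real (T : R) : R := 10 * (T - 1) + kap * ln T.

Lemma slit_map_pos (T : R) : 0 < T -> slit_map T = slit_map_real T.
Proof.
  intros HT. unfold slit_map, slit_map_real. rewrite Clog_pos by exact HT.
  rewrite RtoC_plus, !RtoC_mult, RtoC_minus. reflexivity.
Qed.

Lemma slit_map_Im (T : C) : snd (slit_map T) = 10 * snd T + kap * snd (Clog T).
Proof. unfold slit_map. simpl. ring. Qed.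

Lemma slit_map_Im_pos (T : C) : 0 < snd T -> 0 < snd (slit_map T).
Proof.
  intros HT. rewrite slit_map_Im. generalize (Clog_Im_pos T HT). unfold kap. lra.
Qed.

Lemma arrow_map_Im_pos (x : C) : Cmod x < 1 -> 0 < snd x -> 0 < snd (arrow_map x).
Proof.
  intros Hx H. apply slit_map_Im_pos. destruct (slit_coord_Im x Hx) as [c [Hc ->]].
  now apply Rmult_lt_0_compat.
Qed.

Lemma arrow_map_Im_neg (x : C) : Cmod x < 1 -> snd x < 0 -> snd (arrow_map x) < 0.
Proof.
  intros Hx H. assert (K : 0 < snd (arrow_map (Cconj x))).
  { apply arrow_map_Im_pos; [now rewrite Cmod_conj|]. simpl. lra. }
  rewrite arrow_map_conj in K. unfold Cconj in K; cbn [snd] in K. lra.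
Qed.

Lemma arrow_map_real (a : R) :
  -1 < a < 1 -> exists T : R, slit_coord a = T /\ 9 / 10 < T /\ arrow_map a = slit_map_real T.
Proof.
  intros Ha. destruct (slit_coord_real a Ha) as [T [E HT]]. exists T.
  split; [exact E|]. split; [exact HT|]. unfold arrow_map. rewrite E. apply slit_map_pos. lra.
Qed.

Lemma arrow_map_Im_0 (x : C) : Cmod x < 1 -> snd x = 0 -> snd (arrow_map x) = 0.
Proof.
  intros Hx H. destruct (disk_real x Hx H) as [a [-> Ha]].
  destruct (arrow_map_real a Ha) as [T [_ [_ ->]]]. reflexivity.
Qed.

(** Equal values would make the increment of [Clog] a real multiple of the chord, whereas
    [Clog_chord] turns it strictly. *)
Lemma slit_map_inj_upper (T U : C) :
  0 < snd T -> 0 < snd U -> slit_map T = slit_map U -> T = U.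
Proof.
  intros HT HU E. apply NNPP. intros Hne.
  assert (K := Clog_chord T U HT HU Hne).
  assert (E1 : (kap * (Clog U - Clog T))%C = (- (10 * (U - T)))%C).
  { unfold slit_map in E.
    replace (kap * (Clog U - Clog T))%C with
      ((10 * (U - 1) + kap * Clog U) - (10 * (T - 1) + kap * Clog T) - 10 * (U - T))%C by ring.
    rewrite <- E. ring. }
  assert (E2 : kap * snd ((Clog U - Clog T) * Cconj (U - T))%C = 0).
  { transitivity (snd (kap * (Clog U - Clog T) * Cconj (U - T))%C); [simpl; ring|].
    rewrite E1. simpl. ring. }
  unfold kap in E2. lra.
Qed.

Lemma slit_map_real_increasing (T U : R) : 0 < T -> T < U -> slit_map_real T < slit_map_real U.
Proof.
  intros HT H. unfold slit_map_real. generalize (ln_increasing T U HT H). unfold kap. lra.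
Qed.

(** The sign of the imaginary part is preserved, so the two half-disks and the real diameter can be
    treated separately: the lower half by conjugation, the diameter by monotonicity. *)
Lemma arrow_map_inj : injective_on unit_disk arrow_map.
Proof.
  assert (Hup : forall x y, Cmod x < 1 -> Cmod y < 1 -> 0 < snd x -> arrow_map x = arrow_map y -> x = y).
  { intros x y Hx Hy H E.
    assert (Hy' : 0 < snd y).
    { assert (K := arrow_map_Im_pos x Hx H). rewrite E in K.
      destruct (Rtotal_order (snd y) 0) as [L|[L|L]]; [| |lra].
      - generalize (arrow_map_Im_neg y Hy L). lra.
      - generalize (arrow_map_Im_0 y Hy L). lra. }
    apply slit_coord_inj; auto. apply slit_map_inj_upper; auto.
    - destruct (slit_coord_Im x Hx) as [c [Hc ->]]. now apply Rmult_lt_0_compat.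
    - destruct (slit_coord_Im y Hy) as [c [Hc ->]]. now apply Rmult_lt_0_compat. }
  intros x y Hx Hy E. unfold unit_disk in *.
  destruct (Rtotal_order (snd x) 0) as [L|[L|L]]; [| |now apply Hup].
  - rewrite <- (Cconj_conj x), <- (Cconj_conj y). f_equal. apply Hup.
    + now rewrite Cmod_conj.
    + now rewrite Cmod_conj.
    + simpl. lra.
    + rewrite !arrow_map_conj. now rewrite E.
  - assert (Ly : snd y = 0).
    { assert (K := arrow_map_Im_0 x Hx L). rewrite E in K.
      destruct (Rtotal_order (snd y) 0) as [M|[M|M]]; [|exact M|].
      - generalize (arrow_map_Im_neg y Hy M). lra.
      - generalize (arrow_map_Im_pos y Hy M). lra. }
    destruct (disk_real x Hx L) as [a [-> Ha]]. destruct (disk_real y Hy Ly) as [b [-> Hb]].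
    apply slit_coord_inj; auto.
    destruct (arrow_map_real a Ha) as [T [ET [HT E1]]].
    destruct (arrow_map_real b Hb) as [U [EU [HU E2]]].
    rewrite ET, EU. f_equal.
    assert (E3 : slit_map_real T = slit_map_real U) by (apply RtoC_inj; congruence).
    destruct (Rtotal_order T U) as [M|[M|M]]; [|exact M|].
    + generalize (slit_map_real_increasing T U ltac:(lra) M). lra.
    + generalize (slit_map_real_increasing U T ltac:(lra) M). lra.
Qed.

Definition arrow_deriv (x : C) : C :=
  ((10 + kap / slit_coord x) * (2 / 5 * ((1 + x) / ((1 - x) * (1 - x) * (1 - x)))))%C.

(** The hypotheses also hold on the boundary arc that is mapped to the shaft, where
    [arrow_m_cont_circle] uses the lemma. *)
Lemma arrow_map_deriv_slit (x : C) :
  (1 - x)%C <> 0 -> slit_plane (slit_coord x) -> has_deriv arrow_map x (arrow_deriv x).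
Proof.
  intros H1 HT. unfold arrow_map, arrow_deriv.
  apply (has_deriv_comp slit_map slit_coord).
  - unfold slit_map.
    apply has_deriv_val with (10 * (1 - 0) + kap * / slit_coord x)%C; [|unfold Cdiv; ring].
    apply has_deriv_plus.
    + apply has_deriv_scal. apply has_deriv_minus; [apply has_deriv_id|apply has_deriv_const].
    + apply has_deriv_scal. now apply Clog_deriv.
  - unfold slit_coord, Cdiv.
    apply has_deriv_val with (0 + (2 * / 5) * (1 * / ((1 - x) * (1 - x)) +
      x * (- ((0 - 1) * (1 - x) + (1 - x) * (0 - 1)) / (((1 - x) * (1 - x)) * ((1 - x) * (1 - x))))))%C.
    2:{ field. exact H1. }
    assert (D : has_deriv (fun x => (1 - x)%C) x (0 - 1)%C).
    { apply has_deriv_minus; [apply has_deriv_const|apply has_deriv_id]. }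
    apply has_deriv_plus; [apply has_deriv_const|]. apply has_deriv_scal.
    apply (has_deriv_mult (fun x => x) (fun x => / ((1 - x) * (1 - x)))%C); [apply has_deriv_id|].
    apply (has_deriv_inv (fun x => (1 - x) * (1 - x))%C); [now apply Cmult_neq_0|].
    now apply (has_deriv_mult (fun x => 1 - x)%C (fun x => 1 - x)%C).
Qed.

Lemma arrow_map_deriv (x : C) : Cmod x < 1 -> has_deriv arrow_map x (arrow_deriv x).
Proof.
  intros Hx. apply arrow_map_deriv_slit; [now apply disk_neq_1|now apply slit_coord_slit].
Qed.

(** The critical points lie on the boundary: [T = - kap / 10], which lies on the slit, and [x = -1],
    the tip of the shaft. *)
Lemma arrow_deriv_neq_0 (x : C) : Cmod x < 1 -> arrow_deriv x <> 0.
Proof.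
  intros Hx. assert (H1 := disk_neq_1 x Hx). assert (HT := slit_coord_slit x Hx).
  assert (HT0 := slit_plane_neq_0 _ HT).
  unfold arrow_deriv. apply Cmult_neq_0.
  - intros Z.
    assert (E : slit_coord x = RtoC (- kap / 10)).
    { transitivity ((10 + kap / slit_coord x) * slit_coord x / 10 - kap / 10)%C.
      - field. exact HT0.
      - rewrite Z, RtoC_div, RtoC_opp by lra. field. }
    rewrite E in HT. unfold slit_plane in HT. rewrite Cmod_R in HT. simpl in HT.
    rewrite Rabs_left in HT; unfold kap in *; lra.
  - apply Cmult_neq_0.
    + intros Z. apply (f_equal fst) in Z. simpl in Z. lra.
    + unfold Cdiv. apply Cmult_neq_0; [|apply Cinv_neq_0; repeat apply Cmult_neq_0; exact H1].
      intros Z. assert (x = - (1))%C.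
      { replace x with ((1 + x) - 1)%C by ring. rewrite Z. ring. }
      subst x. rewrite Cmod_m1 in Hx. lra.
Qed.

Lemma slit_coord_0 : slit_coord 0 = 1.
Proof. unfold slit_coord. field. Qed.

Lemma arrow_map_0 : arrow_map 0 = 0.
Proof.
  unfold arrow_map. rewrite slit_coord_0, slit_map_pos by lra.
  unfold slit_map_real. rewrite ln_1. f_equal. ring.
Qed.

(** The horizontal half-line to the right of [slit_map T] is the image of a
    part of the curve [v |-> T], [v] being the tangent of half the argument,
    on which the imaginary part of [slit_map] is constant. *)
Lemma slit_map_shift_upper (T : C) (t : R) :
  0 < snd T -> 0 <= t -> exists U, 0 < snd U /\ slit_map U = (slit_map T + t)%C.
Proof.
  intros HT Ht. assert (Hs : slit_plane T) by (apply slit_plane_Im; lra).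
  destruct T as [x0 y0]. destruct (slit_plane_coords x0 y0 Hs) as [P1 [P2 [P3 P4]]].
  cbn [fst snd] in HT.
  set (r0 := sqrt (x0 ^ 2 + y0 ^ 2)) in *.
  (* The tangent of half the argument of the starting point; [Y] is the imaginary part of its
     image. *)
  set (v0 := y0 / (r0 + x0)).
  assert (Hv0 : 0 < v0) by (apply Rdiv_lt_0_compat; assumption).
  set (Y := 10 * y0 + 2 * kap * atan v0).
  (* The ordinate that keeps the imaginary part of [slit_map] equal to [Y]. With the half-angle
     tangent [v] it determines the abscissa [y (1 - v^2) / (2 v)]. *)
  set (y := fun v => (Y - 2 * kap * atan v) / 10).
  set (pt := fun v => (y v * (1 - v ^ 2) / (2 * v), y v) : C).
  assert (Hy0 : y v0 = y0) by (unfold y, Y; field).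
  assert (Hy : forall v, 0 < v <= v0 -> y0 <= y v).
  { intros v Hv. rewrite <- Hy0. unfold y.
    assert (atan v <= atan v0).
    { destruct Hv as [_ [Hv| ->]]; [left; now apply atan_increasing|lra]. }
    unfold kap. lra. }
  assert (Hpt : forall v, 0 < v <= v0 ->
     slit_map (pt v) = (10 * (y v * (1 - v ^ 2) / (2 * v) - 1) + kap * ln (y v * (1 + v ^ 2) / (2 * v)), Y)).
  { intros v Hv. assert (Hyv := Hy v Hv). assert (Hv2 : 0 <= v ^ 2) by apply pow2_ge_0.
    set (rho := y v * (1 + v ^ 2) / (2 * v)).
    assert (Hrho : 0 < rho).
    { apply Rdiv_lt_0_compat; [apply Rmult_lt_0_compat|]; lra. }
    assert (Em : (y v * (1 - v ^ 2) / (2 * v)) ^ 2 + y v ^ 2 = rho * rho).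
    { unfold rho. field. lra. }
    unfold slit_map, Clog, pt. cbn [fst snd]. rewrite Em.
    rewrite sqrt_square by lra. rewrite ln_mult by assumption.
    replace (y v / (rho + y v * (1 - v ^ 2) / (2 * v))) with v.
    2:{ unfold rho. field. split; [|lra].
        replace (y v * (1 + v ^ 2) + y v * (1 - v ^ 2)) with (2 * y v) by ring. lra. }
    apply injective_projections; simpl; [field; lra|].
    unfold y. field. lra. }
  assert (E0 : pt v0 = (x0, y0)).
  { unfold pt. rewrite Hy0. f_equal. unfold v0.
    assert (Er : y0 ^ 2 = r0 * r0 - x0 ^ 2) by lra.
    replace (y0 * (1 - (y0 / (r0 + x0)) ^ 2) / (2 * (y0 / (r0 + x0))))
      with (((r0 + x0) ^ 2 - y0 ^ 2) / (2 * (r0 + x0))) by (field; lra).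
    rewrite Er. field. lra. }
  set (Rp := fun v => 10 * (y v * (1 - v ^ 2) / (2 * v) - 1) + kap * ln (y v * (1 + v ^ 2) / (2 * v))).
  assert (ER : forall v, 0 < v <= v0 -> slit_map (pt v) = (Rp v, Y)) by exact Hpt.
  set (N := Rabs (Rp v0) + t + 11).
  assert (HN : 11 <= N) by (unfold N; generalize (Rabs_pos (Rp v0)); lra).
  assert (HN0 : Rp v0 + t <= N - 11) by (unfold N; generalize (Rle_abs (Rp v0)); lra).
  (* So small that the abscissa is at least [3/4 * N] and the logarithm nonnegative, which takes the
     real part beyond its target; the intermediate value theorem applies between [v1] and [v0]. *)
  set (v1 := Rmin (Rmin v0 (/ 2)) (y0 / (2 * N))).
  assert (Hv1 : 0 < v1).
  { unfold v1. repeat apply Rmin_pos; try lra. apply Rdiv_lt_0_compat; lra. }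
  assert (Hv1a : v1 <= v0).
  { unfold v1. eapply Rle_trans; [apply Rmin_l|apply Rmin_l]. }
  assert (Hv1b : v1 <= / 2).
  { unfold v1. eapply Rle_trans; [apply Rmin_l|apply Rmin_r]. }
  assert (Hv1c : N <= y0 / (2 * v1)).
  { assert (H : v1 <= y0 / (2 * N)) by apply Rmin_r.
    apply (Rmult_le_reg_r (2 * v1)); [lra|].
    replace (y0 / (2 * v1) * (2 * v1)) with y0 by (field; lra).
    apply (Rmult_le_compat_r (2 * N)) in H; [|lra].
    replace (y0 / (2 * N) * (2 * N)) with y0 in H by (field; lra). lra. }
  assert (HR1 : Rp v0 + t < Rp v1).
  { assert (Hyv := Hy v1 ltac:(lra)).
    assert (A1 : N <= y v1 / (2 * v1)).
    { eapply Rle_trans; [exact Hv1c|]. apply Rmult_le_compat_r; [|exact Hyv].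
      left. apply Rinv_0_lt_compat. lra. }
    assert (A2 : v1 ^ 2 <= / 4).
    { replace (/ 4) with (/ 2 * / 2) by field. simpl. rewrite Rmult_1_r.
      apply Rmult_le_compat; lra. }
    assert (A2' : 0 <= v1 ^ 2) by apply pow2_ge_0.
    assert (E1 : Rp v1 = 10 * (y v1 * (1 - v1 ^ 2) / (2 * v1) - 1)
                   + kap * ln (y v1 * (1 + v1 ^ 2) / (2 * v1))) by reflexivity.
    rewrite E1.
    replace (y v1 * (1 - v1 ^ 2) / (2 * v1)) with (y v1 / (2 * v1) * (1 - v1 ^ 2)) by (field; lra).
    replace (y v1 * (1 + v1 ^ 2) / (2 * v1)) with (y v1 / (2 * v1) * (1 + v1 ^ 2)) by (field; lra).
    set (w := y v1 / (2 * v1)) in *.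
    assert (A3 : 0 <= ln (w * (1 + v1 ^ 2))).
    { rewrite <- ln_1. apply ln_le; [lra|]. nra. }
    assert (A4 : 3 / 4 * w <= w * (1 - v1 ^ 2)) by nra.
    assert (A5 : 0 <= kap * ln (w * (1 + v1 ^ 2))) by (apply Rmult_le_pos; [unfold kap; lra|exact A3]).
    lra. }
  assert (Hlt : v1 < v0).
  { destruct Hv1a as [|E]; [assumption|]. rewrite E in HR1. lra. }
  destruct (Req_dec t 0) as [->|Ht0].
  { exists (x0, y0). split; [exact HT|]. ring. }
  destruct (IVT_interv (fun v => Rp v0 + t - Rp v) v1 v0) as [v [Hv Ev]].
  - intros v Hv. apply continuity_pt_filterlim.
    apply (ex_derive_continuous (fun v => Rp v0 + t - Rp v)).
    assert (Hyv := Hy v ltac:(lra)). assert (Hv2 : 0 <= v ^ 2) by apply pow2_ge_0.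
    assert (Hpos : 0 < y v * (1 + v ^ 2) / (2 * v)).
    { apply Rdiv_lt_0_compat; [apply Rmult_lt_0_compat|]; lra. }
    unfold Rp, y in *. auto_derive. simpl in Hpos. repeat split; try lra.
  - exact Hlt.
  - lra.
  - cbv beta; lra.
  - exists (pt v). split.
    + unfold pt. cbn [snd]. generalize (Hy v ltac:(lra)). lra.
    + rewrite ER by lra. rewrite <- E0 at 1. rewrite ER by lra.
      apply injective_projections; simpl; lra.
Qed.

Lemma arrow_map_shift (x : C) (t : R) :
  Cmod x < 1 -> 0 <= t -> exists z, Cmod z < 1 /\ arrow_map z = (arrow_map x + t)%C.
Proof.
  assert (Hup : forall x, Cmod x < 1 -> 0 < snd x -> 0 <= t ->
    exists z, Cmod z < 1 /\ arrow_map z = (arrow_map x + t)%C).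
  { intros y Hy Hpos Ht.
    destruct (slit_map_shift_upper (slit_coord y) t) as [U [HU E]]; auto.
    { destruct (slit_coord_Im y Hy) as [c [Hc ->]]. now apply Rmult_lt_0_compat. }
    destruct (slit_coord_onto U) as [z [Hz Ez]].
    { apply slit_plane_Im. simpl. lra. }
    exists z. split; [exact Hz|]. unfold arrow_map. now rewrite Ez. }
  intros Hx Ht. destruct (Rtotal_order (snd x) 0) as [L|[L|L]]; [| |now apply Hup].
  - destruct (Hup (Cconj x)) as [z [Hz E]]; auto.
    { now rewrite Cmod_conj. }
    { simpl. lra. }
    exists (Cconj z). split; [now rewrite Cmod_conj|].
    rewrite arrow_map_conj, E, arrow_map_conj, Cplus_conj, Cconj_conj. f_equal.
    apply injective_projections; simpl; ring.
  - destruct (Req_dec t 0) as [->|Ht0].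
    { exists x. split; [exact Hx|]. ring. }
    destruct (disk_real x Hx L) as [a [-> Ha]].
    destruct (arrow_map_real a Ha) as [T [_ [HT ->]]].
    destruct (IVT_interv (fun U => slit_map_real U - (slit_map_real T + t)) T (T + t)) as [U [HU E]].
    + intros U HU. apply continuity_pt_filterlim.
      apply (ex_derive_continuous (fun U => slit_map_real U - (slit_map_real T + t))).
      unfold slit_map_real. auto_derive. lra.
    + lra.
    + lra.
    + unfold slit_map_real. assert (ln T < ln (T + t)) by (apply ln_increasing; lra).
      unfold kap. lra.
    + destruct (slit_coord_onto U) as [z [Hz Ez]].
      { replace (10 * U - 9)%C with (RtoC (10 * U - 9)) by (rewrite RtoC_minus, RtoC_mult; reflexivity).
        apply slit_plane_pos. lra. }
      exists z. split; [exact Hz|]. unfold arrow_map. rewrite Ez, slit_map_pos by lra.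
      rewrite <- RtoC_plus. f_equal. lra.
Qed.

Lemma ln_lower (x : R) : 0 < x -> 1 - / x <= ln x.
Proof.
  intros Hx. assert (H := exp_ineq1_le (- ln x)).
  rewrite exp_Ropp, exp_ln in H by exact Hx. lra.
Qed.

(** * The arrow as a planar shape *)

Definition arrow_set : C -> Prop := omitted_set arrow_map.

(** A second point of the arrow besides [0]: [-10] lies to the left of the real values of
    [arrow_map], which exceed [-1 + kap * ln (9/10)]. *)
Lemma arrow_set_omits : arrow_set (- / 10)%R.
Proof.
  intros [x [Hx E]].
  assert (E1 : arrow_map x = (-10)%R).
  { transitivity (-10 * ((- / 10)%R * arrow_map x))%C; [|rewrite E].
    - rewrite RtoC_opp, RtoC_inv. field. lra.
    - apply injective_projections; simpl; ring. }
  assert (Hr : snd x = 0).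
  { destruct (Rtotal_order (snd x) 0) as [L|[L|L]]; [|exact L|].
    - generalize (arrow_map_Im_neg x Hx L). rewrite E1. simpl. lra.
    - generalize (arrow_map_Im_pos x Hx L). rewrite E1. simpl. lra. }
  destruct (disk_real x Hx Hr) as [a [-> Ha]].
  destruct (arrow_map_real a Ha) as [T [_ [HT E2]]]. rewrite E2 in E1. apply RtoC_inj in E1.
  unfold slit_map_real in E1. assert (L := ln_lower T ltac:(lra)).
  assert (/ T <= / (9 / 10)) by (apply Rinv_le_contravar; lra).
  unfold kap in E1. lra.
Qed.

Lemma arrow_planar : planar_shape arrow_set.
Proof.
  apply (omitted_set_planar arrow_map arrow_deriv arrow_map_deriv arrow_deriv_neq_0
           arrow_map_0 arrow_map_inj (- / 10)%R).
  - exact arrow_map_shift.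
  - intros Z. apply RtoC_inj in Z. lra.
  - exact arrow_set_omits.
Qed.

Definition arrow_Phi : sphere -> sphere := exterior_map arrow_map.
Definition arrow_Psi : sphere -> sphere := exterior_inverse arrow_map.

Lemma arrow_riemann : riemann_map arrow_set arrow_Phi arrow_Psi.
Proof.
  exact (exterior_map_riemann arrow_map arrow_deriv arrow_map_deriv arrow_deriv_neq_0
           arrow_map_0 arrow_map_inj).
Qed.

Lemma arrow_compact : compact_set arrow_set.
Proof. exact (proj1 arrow_planar). Qed.

(** * The decomposition [g = 2 N - m] for the arrow, and its symmetry *)

Definition arrow_k : C -> C := cap_k _ _ _ arrow_riemann.
Definition arrow_N (z : C) : C := (z * radial_mean arrow_k z)%C.
Definition arrow_m (x : C) : C := (x * x * / arrow_map x)%C.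

Lemma arrow_m_eq (x : C) : cap_m arrow_Phi x = arrow_m x.
Proof.
  unfold cap_m, Phi_fin, arrow_Phi, arrow_m. simpl. now rewrite Cinv_inv.
Qed.

Lemma arrow_cap_g (z : C) : Cmod z < 1 -> cap_g arrow_Phi z = (2 * arrow_N z - arrow_m z)%C.
Proof.
  intros Hz. rewrite <- arrow_m_eq.
  exact (cap_g_eq _ _ _ arrow_riemann z Hz).
Qed.

Lemma arrow_N_deriv (z : C) : Cmod z < 1 -> has_deriv arrow_N z (arrow_k z).
Proof. exact (cap_k_primitive _ _ _ arrow_riemann z). Qed.

Lemma arrow_k_mult (z : C) : (z * arrow_k z)%C = arrow_m z.
Proof.
  rewrite <- arrow_m_eq.
  exact (cap_k_mult _ _ _ arrow_riemann z).
Qed.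

Lemma Cinv_conj (z : C) : Cconj (/ z)%C = (/ Cconj z)%C.
Proof.
  apply injective_projections; simpl; unfold Rdiv.
  - replace (- snd z * (- snd z * 1)) with (snd z * (snd z * 1)) by ring. ring.
  - replace (- snd z * (- snd z * 1)) with (snd z * (snd z * 1)) by ring. ring.
Qed.

Lemma arrow_m_conj (z : C) : arrow_m (Cconj z) = Cconj (arrow_m z).
Proof. unfold arrow_m. now rewrite arrow_map_conj, !Cmult_conj, Cinv_conj. Qed.

Lemma is_RInt_conj (f : R -> C) (a b : R) (l : C) :
  is_RInt (V := C_R_NormedModule) f a b l ->
  is_RInt (V := C_R_NormedModule) (fun t => Cconj (f t)) a b (Cconj l).
Proof.
  intros H.
  apply (is_RInt_fct_extend_pair (U := R_NormedModule) (V := R_NormedModule)).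
  - exact (is_RInt_fct_extend_fst (U := R_NormedModule) (V := R_NormedModule) f a b l H).
  - exact (is_RInt_opp _ _ _ _
      (is_RInt_fct_extend_snd (U := R_NormedModule) (V := R_NormedModule) f a b l H)).
Qed.

Lemma arrow_N_conj (z : C) : Cmod z < 1 -> arrow_N (Cconj z) = Cconj (arrow_N z).
Proof.
  intros Hz. unfold arrow_N. rewrite Cmult_conj.
  destruct (Ceq_dec z 0) as [->|Hz0].
  { replace (Cconj 0) with (RtoC 0) by (apply injective_projections; simpl; ring). ring. }
  f_equal. unfold radial_mean at 1. apply RInt_C_unique.
  assert (I := radial_mean_correct arrow_k z
    (cap_k_cont _ _ _ arrow_riemann) Hz).
  apply is_RInt_conj in I.
  refine (is_RInt_ext (V := C_R_NormedModule) _ _ 0 1 _ _ I).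
  (* Only [0 < t < 1] matters, so that [arrow_k] can be computed as the quotient [arrow_m y / y]. *)
  rewrite Rmin_left, Rmax_right by lra. intros t Ht.
  assert (Hconj : (t * Cconj z)%C = Cconj (t * z)%C).
  { rewrite Cmult_conj. f_equal. apply injective_projections; simpl; ring. }
  rewrite Hconj.
  assert (Hy : (t * z)%C <> 0).
  { apply Cmult_neq_0; [|exact Hz0]. intros Z. apply RtoC_inj in Z. lra. }
  set (y := (t * z)%C) in *. clearbody y.
  assert (Hyc : Cconj y <> 0).
  { intros Z. apply Hy. rewrite <- (Cconj_conj y), Z.
    apply injective_projections; simpl; ring. }
  change (Cconj (arrow_k y) = arrow_k (Cconj y) :> C).
  transitivity (arrow_m (Cconj y) / Cconj y)%C.
  - rewrite arrow_m_conj, <- arrow_k_mult, Cmult_conj. field. exact Hyc.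
  - rewrite <- arrow_k_mult. field. exact Hyc.
Qed.

Lemma arrow_cap_g_conj (z : C) :
  Cmod z < 1 -> cap_g arrow_Phi (Cconj z) = Cconj (cap_g arrow_Phi z).
Proof.
  intros Hz. rewrite !arrow_cap_g; [|exact Hz|now rewrite Cmod_conj].
  rewrite arrow_N_conj, arrow_m_conj by exact Hz.
  apply injective_projections; simpl; ring.
Qed.

(** * The boundary values of [arrow_m] *)

(** On the unit circle [x / (1 - x)^2 = 1 / (x + 1/x - 2)] is real and depends only on the real part
    [c] of [x]. The value is positive, so that the point goes to the shaft, exactly for
    [c < 4/5]. *)
Definition circle_T (c : R) : R := 1 - / (5 * (1 - c)).

Lemma cexp_circle (tau : R) : cexp (0, tau) = (cos tau, sin tau).
Proof. unfold cexp. cbn [fst snd]. rewrite exp_0. f_equal; ring. Qed.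

Lemma slit_coord_circle (c s : R) :
  c < 1 -> c * c + s * s = 1 -> slit_coord (c, s) = circle_T c.
Proof.
  intros Hc Hcs. unfold slit_coord, circle_T.
  assert (E : ((1 - (c, s)) * (1 - (c, s)))%C = (RtoC (-2 * (1 - c)) * (c, s))%C).
  { apply injective_projections; simpl.
    - assert (s * s = 1 - c * c) by lra. nra.
    - ring. }
  rewrite E.
  assert (H1 : RtoC (-2 * (1 - c)) <> 0) by (intros Z; apply RtoC_inj in Z; lra).
  assert (H2 : ((c, s) : C) <> 0).
  { intros Z. apply (f_equal fst) in Z as Z1. apply (f_equal snd) in Z as Z2. simpl in Z1, Z2.
    subst. lra. }
  replace ((c, s) / (RtoC (-2 * (1 - c)) * (c, s)))%C with (/ RtoC (-2 * (1 - c)))%C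
    by (field; auto).
  rewrite <- RtoC_inv, <- RtoC_div, <- RtoC_mult, <- RtoC_plus. f_equal.
  all: try lra. field. lra.
Qed.

(** On the shaft [Phi] is real and equals [- 1 / G], so that [m x = - x^2 / G]. *)
Lemma arrow_m_circle (c s : R) :
  c < 1 -> c * c + s * s = 1 -> 0 < circle_T c ->
  let G := 2 / (1 - c) + kap * - ln (circle_T c) in
  arrow_m (c, s) = (- ((c * c - s * s) / G), - (2 * c * s / G)).
Proof.
  intros Hc Hcs HT G.
  assert (E : arrow_map (c, s) = RtoC (- G)).
  { unfold arrow_map. rewrite slit_coord_circle by assumption. rewrite slit_map_pos by exact HT.
    f_equal. unfold slit_map_real, G, circle_T. field. lra. }
  unfold arrow_m. rewrite E.
  destruct (Req_dec G 0) as [Z|Z].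
  - rewrite Z. replace (-0) with 0 by ring. rewrite Cinv_0. unfold Rdiv. rewrite Rinv_0.
    apply injective_projections; simpl; ring.
  - rewrite <- RtoC_inv by lra. apply injective_projections; simpl; field; exact Z.
Qed.

Lemma circle_T_lt_1 (c : R) : c < 1 -> circle_T c < 1.
Proof.
  intros Hc. unfold circle_T. assert (0 < / (5 * (1 - c))); [|lra].
  apply Rinv_0_lt_compat. lra.
Qed.

Lemma circle_G_pos (c : R) :
  c < 1 -> 0 < circle_T c ->
  0 <= - ln (circle_T c) /\ 0 < 2 / (1 - c) + kap * - ln (circle_T c).
Proof.
  intros Hc HT. assert (H := circle_T_lt_1 c Hc).
  assert (L : ln (circle_T c) <= 0) by (rewrite <- ln_1; apply ln_le; lra).
  assert (0 < 2 / (1 - c)) by (apply Rdiv_lt_0_compat; lra).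
  unfold kap. lra.
Qed.

(** A comparison of [/ G] with [(1 - c) / 2], its value for [kap = 0]. Since [/ G] is the smaller
    one, the error is favourable where [cos (2 t) >= 0], even near the corridor, where the logarithm
    blows up. Where [cos (2 t) < 0], [c] keeps away from [4/5] and the error is at most
    [5 / 2 * kap]. *)
Lemma arrow_m_circle_lower (c s : R) :
  -1 <= c -> c < 1 -> c * c + s * s = 1 -> 0 < circle_T c ->
  0 <= fst (arrow_m (c, s)) + (1 - c) / 2 * (2 * (c * c) - 1) + 5 / 2 * kap.
Proof.
  intros Hc0 Hc Hcs HT.
  destruct (circle_G_pos c Hc HT) as [HL HG].
  rewrite arrow_m_circle by assumption. cbn [fst].
  replace (c * c - s * s) with (2 * (c * c) - 1) by lra.
  set (L := - ln (circle_T c)) in *. set (G := 2 / (1 - c) + kap * L) in *.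
  assert (Hd : 0 < 2 / (1 - c)) by (apply Rdiv_lt_0_compat; lra).
  assert (HkL : 0 <= kap * L) by (apply Rmult_le_pos; [unfold kap; lra|exact HL]).
  assert (Hinv : / G <= (1 - c) / 2).
  { replace ((1 - c) / 2) with (/ (2 / (1 - c))) by (field; lra).
    apply Rinv_le_contravar; unfold G; lra. }
  assert (Hi0 : 0 < / G) by now apply Rinv_0_lt_compat.
  assert (Hk : 0 < kap) by (unfold kap; lra).
  unfold Rdiv at 1.
  set (q := 2 * (c * c) - 1).
  destruct (Rle_lt_dec 0 q) as [Hq|Hq]; [nra|].
  (* [0.7072] slightly exceeds [1 / sqrt 2], and [1.464 = 5 (1 - 0.7072)] below. *)
  assert (Hcb : -0.7072 < c < 0.7072) by (unfold q in Hq; split; nra).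
  assert (HT2 : 0.3165 <= circle_T c).
  { unfold circle_T. assert (/ (5 * (1 - c)) <= / 1.464) by (apply Rinv_le_contravar; lra). lra. }
  assert (HL2 : L <= 2.2).
  { unfold L. assert (K := ln_lower (circle_T c) HT).
    assert (/ circle_T c <= / 0.3165) by (apply Rinv_le_contravar; lra). lra. }
  assert (Hdiff : (1 - c) / 2 - / G <= 5 / 2 * kap).
  { assert (E : (1 - c) / 2 - / G = (1 - c) / 2 * (kap * L) * / G).
    { assert (0 <= kap * L * (1 - c)) by (apply Rmult_le_pos; lra).
      assert (HG' : G * (1 - c) = 2 + kap * L * (1 - c)) by (unfold G; field; lra).
      apply (Rmult_eq_reg_r G); [|lra].
      replace (((1 - c) / 2 - / G) * G) with (G * (1 - c) / 2 - 1) by (field; lra).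
      rewrite HG'. field. lra. }
    rewrite E.
    apply Rle_trans with ((1 - c) / 2 * (kap * L) * ((1 - c) / 2)).
    - apply Rmult_le_compat_l; [|exact Hinv]. apply Rmult_le_pos; lra.
    - replace ((1 - c) / 2 * (kap * L) * ((1 - c) / 2)) with
        (kap * (L * ((1 - c) / 2 * ((1 - c) / 2)))) by ring.
      rewrite (Rmult_comm (5 / 2)). apply Rmult_le_compat_l; [lra|].
      assert ((1 - c) / 2 * ((1 - c) / 2) <= 1) by nra.
      assert (0 <= (1 - c) / 2 * ((1 - c) / 2)) by nra. nra. }
  assert (Hq1 : -1 <= q) by (unfold q; nra). nra.
Qed.

Lemma arrow_m_cont_circle (c s : R) :
  c < 1 -> c * c + s * s = 1 -> 0 < circle_T c -> cont_at arrow_m (c, s).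
Proof.
  intros Hc Hcs HT. destruct (circle_G_pos c Hc HT) as [_ HG].
  eapply has_deriv_cont. unfold arrow_m. apply has_deriv_mult.
  - apply has_deriv_mult; apply has_deriv_id.
  - apply has_deriv_inv.
    + unfold arrow_map. rewrite slit_coord_circle, slit_map_pos by assumption.
      intros Z. apply RtoC_inj in Z.
      assert (E : slit_map_real (circle_T c) = - (2 / (1 - c) + kap * - ln (circle_T c))).
      { unfold slit_map_real, circle_T. field. lra. }
      lra.
    + apply arrow_map_deriv_slit.
      * intros Z. apply (f_equal fst) in Z. simpl in Z. lra.
      * rewrite slit_coord_circle by assumption. now apply slit_plane_pos.
Qed.

(** Along a circle [dz = i z dt], so that the angular derivative of [N] is [i z k z = i m z]. *)
Lemma arrow_N_circle_deriv (sigma tau : R) :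
  sigma < 0 ->
  is_derive (fun t => Im (arrow_N (cexp (sigma, t)))) tau (Re (arrow_m (cexp (sigma, tau)))).
Proof.
  intros Hs.
  apply (is_derive_ext (fun t : R => Im (arrow_N (cexp ((sigma, 0%R) + t * Ci)%C)))).
  { intros t. now rewrite vertical_point. }
  set (w := cexp (sigma, tau)).
  replace (Re (arrow_m w)) with (Im (arrow_k w * w * Ci)%C).
  2:{ rewrite <- arrow_k_mult, (Cmult_comm w). unfold Im, Re. simpl. ring. }
  apply (is_derive_Im (fun t : R => arrow_N (cexp ((sigma, 0%R) + t * Ci)%C))).
  apply (has_deriv_along (fun z => arrow_N (cexp z))).
  rewrite vertical_point. apply (has_deriv_comp arrow_N cexp); [|apply cexp_deriv].
  apply arrow_N_deriv. unfold w. rewrite Cmod_cexp. simpl. rewrite <- exp_0. now apply exp_increasing.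
Qed.

(** A primitive of [(1 - cos t) / 2 * cos (2 t)], the limit for [kap = 0]. *)
Definition edge_primitive (t : R) : R := sin t * (sin t ^ 2 / 3 - (1 - cos t) / 2).

Lemma edge_primitive_deriv (t : R) : is_derive edge_primitive t ((1 - cos t) / 2 * (2 * (cos t * cos t) - 1)).
Proof.
  unfold edge_primitive. auto_derive; [exact I|].
  assert (E := sin2_cos2 t). unfold Rsqr in E.
  set (s := sin t) in *. set (c := cos t) in *. clearbody s c.
  assert (E2 : s * s = 1 - c * c) by lra.
  transitivity (c * (s * s) - c * (1 - c) / 2 - s * s / 2); [simpl; field|].
  rewrite E2. field.
Qed.

Lemma nondecreasing_of_deriv (f df : R -> R) (a b : R) :
  a < b -> (forall t, a <= t <= b -> is_derive f t (df t)) ->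
  (forall t, a <= t <= b -> 0 <= df t) -> f a <= f b.
Proof.
  intros Hab Hd Hp. destruct (MVT_gen f a b df) as [t [Ht E]].
  - rewrite Rmin_left, Rmax_right by lra. intros x Hx. apply Hd. lra.
  - rewrite Rmin_left, Rmax_right by lra. intros x Hx.
    apply continuity_pt_filterlim. apply (ex_derive_continuous f).
    exists (df x). apply Hd. lra.
  - rewrite Rmin_left, Rmax_right in Ht by lra.
    assert (0 <= df t * (b - a)) by (apply Rmult_le_pos; [now apply Hp|lra]). lra.
Qed.

(** The point of argument [tau1] on the circle, at which [slit_coord] is [eps1],
    lies deep inside the corridor between a barb and the shaft. *)
Definition eps1 : R := exp (- 10 ^ 7).
Definition c1 : R := 1 - / (5 * (1 - eps1)).
Definition tau1 : R := acos c1.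

Lemma eps1_bounds : 0 < eps1 < / 10 ^ 7.
Proof.
  unfold eps1. split; [apply exp_pos|]. rewrite exp_Ropp.
  apply Rinv_lt_contravar.
  - apply Rmult_lt_0_compat; [apply pow_lt; lra|apply exp_pos].
  - apply Rlt_le_trans with (1 + 10 ^ 7); [lra|]. apply exp_ineq1_le.
Qed.

Lemma c1_bounds : 0.7999 < c1 < 0.8.
Proof.
  assert (H := eps1_bounds). unfold c1.
  assert (H1 : / 10 ^ 7 < 0.0001) by (simpl; lra).
  split.
  - assert (/ (5 * (1 - eps1)) < / (5 * 0.9998)); [|lra].
    apply Rinv_lt_contravar; nra.
  - assert (/ 5 < / (5 * (1 - eps1))); [|lra].
    apply Rinv_lt_contravar; lra.
Qed.

Lemma circle_T_c1 : circle_T c1 = eps1.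
Proof.
  assert (H := eps1_bounds). assert (/ 10 ^ 7 < 1) by (simpl; lra).
  unfold circle_T, c1. field. lra.
Qed.

Lemma circle_T_antitone (c : R) : c <= c1 -> eps1 <= circle_T c.
Proof.
  intros Hc. assert (H := c1_bounds). rewrite <- circle_T_c1. unfold circle_T.
  assert (/ (5 * (1 - c)) <= / (5 * (1 - c1))); [|lra].
  apply Rinv_le_contravar; lra.
Qed.

Lemma cos_tau1 : cos tau1 = c1.
Proof. apply cos_acos. generalize c1_bounds. lra. Qed.

Lemma tau1_bounds : 0 < tau1 < PI.
Proof.
  assert (H := acos_bound c1). fold tau1 in H. assert (E := cos_tau1). assert (K := c1_bounds).
  split.
  - destruct H as [[H|H] _]; [exact H|]. rewrite <- H, cos_0 in E. lra.
  - destruct H as [_ [H|H]]; [exact H|]. rewrite H, cos_PI in E. lra.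
Qed.

Lemma sin_tau1 : 0.6 <= sin tau1 <= 1.
Proof.
  assert (H := sin2_cos2 tau1). rewrite cos_tau1 in H. unfold Rsqr in H.
  assert (K := c1_bounds). assert (B := tau1_bounds).
  assert (0 < sin tau1) by (apply sin_gt_0; lra). split; nra.
Qed.

Lemma tail_circle (tau : R) :
  tau1 <= tau <= PI ->
  -1 <= cos tau /\ cos tau < 1 /\ cos tau * cos tau + sin tau * sin tau = 1 /\
  0 < circle_T (cos tau).
Proof.
  intros Ht. assert (B := tau1_bounds). assert (K := c1_bounds).
  assert (Hc : cos tau <= c1).
  { rewrite <- cos_tau1. apply cos_decr_1; lra. }
  generalize (sin2_cos2 tau), (COS_bound tau), (circle_T_antitone _ Hc), eps1_bounds.
  unfold Rsqr. lra.
Qed.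

(** At [cos t = 4/5], [sin t = 3/5] the value is [0.6 (0.12 - 0.1) = 0.012], and [tau1] is very
    close to this angle. *)
Lemma edge_primitive_tau1 : 0.0119 <= edge_primitive tau1.
Proof.
  unfold edge_primitive. rewrite cos_tau1. assert (H := sin_tau1). assert (K := c1_bounds).
  assert (0.0199 <= sin tau1 ^ 2 / 3 - (1 - c1) / 2) by nra. nra.
Qed.

Definition arc_error : R := / 10000.

(** [N] is controlled only inside the disk. Since [m] is continuous at the points of the closed
    boundary arc, it is uniformly close to its boundary values on a slightly smaller circle. *)
Lemma near_circle :
  exists sigma, sigma < 0 /\ forall tau, tau1 <= tau <= PI ->
    Cmod (arrow_m (cexp (sigma, tau)) - arrow_m (cexp (0, tau))) <= arc_error.
Proof.
  destruct (uniform_cont_seg (fun w => arrow_m (cexp w)) (0, 0) Ci tau1 PI arc_error) as [r [Hr K]].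
  - intros t Ht. rewrite vertical_point. intros eps Heps.
    apply (near_cont cexp (0, t)
      (fun y => Cmod (arrow_m y - arrow_m (cexp (0, t))) < eps)).
    + exact (has_deriv_cont _ _ _ (cexp_deriv _)).
    + rewrite cexp_circle. destruct (tail_circle t Ht) as [_ [H1 [H2 H3]]].
      now apply arrow_m_cont_circle.
  - unfold arc_error. lra.
  - exists (- r / 2). split; [lra|]. intros tau Ht.
    specialize (K tau (- r / 2, tau) Ht). rewrite vertical_point in K. apply K.
    replace (((- r / 2)%R, tau) - (0%R, tau))%C with (RtoC (- r / 2))
      by (apply injective_projections; simpl; ring).
    rewrite Cmod_R, Rabs_left; lra.
Qed.

(** * The sign of [Im g] in the upper half of the disk *)

Lemma cap_g_wrong_side :
  exists x, Cmod x < 1 /\ 0 < snd x /\ snd (cap_g arrow_Phi x) < 0.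
Proof.
  destruct near_circle as [sigma [Hs Hnear]].
  assert (B := tau1_bounds).
  assert (Hmod : forall t, Cmod (cexp (sigma, t)) < 1).
  { intros t. rewrite Cmod_cexp. simpl. rewrite <- exp_0. now apply exp_increasing. }
  exists (cexp (sigma, tau1)). split; [apply Hmod|]. split.
  { unfold cexp. cbn [fst snd]. apply Rmult_lt_0_compat; [apply exp_pos|].
    generalize sin_tau1. lra. }
  (* The two errors per unit of angle: from [kap] on the boundary and from the passage to the
     smaller circle. Adding [C0 * t] absorbs them into a monotone function. *)
  set (C0 := 5 / 2 * kap + arc_error).
  assert (Hmono : Im (arrow_N (cexp (sigma, tau1))) + edge_primitive tau1 + C0 * tau1
                  <= Im (arrow_N (cexp (sigma, PI))) + edge_primitive PI + C0 * PI).
  { apply (nondecreasing_of_deriv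
      (fun t => Im (arrow_N (cexp (sigma, t))) + edge_primitive t + C0 * t)
      (fun t => Re (arrow_m (cexp (sigma, t))) + (1 - cos t) / 2 * (2 * (cos t * cos t) - 1) + C0)).
    - lra.
    - intros t Ht.
      apply (is_derive_plus (fun t => Im (arrow_N (cexp (sigma, t))) + edge_primitive t) (fun t => C0 * t)).
      + apply (is_derive_plus (fun t => Im (arrow_N (cexp (sigma, t)))) edge_primitive).
        * now apply arrow_N_circle_deriv.
        * apply edge_primitive_deriv.
      + auto_derive; [exact I|ring].
    - intros t Ht. destruct (tail_circle t Ht) as [H0 [H1 [H2 H3]]].
      assert (L := arrow_m_circle_lower _ _ H0 H1 H2 H3).
      assert (D := Hnear t Ht). rewrite cexp_circle in D.
      assert (R1 := Cmod_Re_Lipschitz (arrow_m (cexp (sigma, t))) (arrow_m (cos t, sin t))).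
      apply Rabs_le_between in R1. unfold Re, C0. lra. }
  (* At the angle [PI] the point is real, so [N] is real there by symmetry; this starts the
     integration at the tip of the shaft. *)
  assert (HPI : Im (arrow_N (cexp (sigma, PI))) = 0).
  { assert (E : Cconj (cexp (sigma, PI)) = cexp (sigma, PI)).
    { unfold cexp, Cconj. cbn [fst snd]. rewrite sin_PI. f_equal. ring. }
    assert (K := arrow_N_conj _ (Hmod PI)). rewrite E in K.
    apply (f_equal snd) in K. unfold Cconj in K. cbn [snd] in K. unfold Im. lra. }
  assert (HQ : edge_primitive PI = 0) by (unfold edge_primitive; rewrite sin_PI; ring).
  rewrite HPI, HQ in Hmono.
  (* With [PI <= 4] the accumulated error is at most [4 * 0.0026 = 0.0104], which leaves [0.0015] of
     the margin [0.0119]. *)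
  assert (HQ1 := edge_primitive_tau1). assert (P4 := PI_4).
  assert (HC0 : C0 = 0.0026) by (unfold C0, kap, arc_error; lra).
  assert (HN : Im (arrow_N (cexp (sigma, tau1))) <= - 0.0015).
  { rewrite HC0 in Hmono. lra. }
  rewrite arrow_cap_g by apply Hmod.
  assert (Em : snd (2 * arrow_N (cexp (sigma, tau1)) - arrow_m (cexp (sigma, tau1)))%C
    = 2 * Im (arrow_N (cexp (sigma, tau1))) - snd (arrow_m (cexp (sigma, tau1)))).
  { unfold Im. simpl. ring. }
  rewrite Em.
  assert (Ht1 : tau1 <= tau1 <= PI) by lra.
  destruct (tail_circle tau1 Ht1) as [H0 [H1 [H2 H3]]].
  assert (D := Hnear tau1 Ht1). rewrite cexp_circle in D.
  assert (R1 := Cmod_Im_Lipschitz (arrow_m (cexp (sigma, tau1))) (arrow_m (cos tau1, sin tau1))).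
  apply Rabs_le_between in R1.
  assert (Hsmall : - snd (arrow_m (cos tau1, sin tau1)) <= 0.001).
  { rewrite arrow_m_circle by assumption. cbn [snd].
    rewrite cos_tau1, circle_T_c1. unfold eps1. rewrite ln_exp.
    assert (K := c1_bounds). assert (S := sin_tau1).
    (* The exponent in [eps1] outweighs [kap]: the logarithmic term alone is [10 ^ 4], so [m] is
       negligible at this point and the sign of [2 N - m] is that of [N]. *)
    set (G := 2 / (1 - c1) + kap * - - 10 ^ 7).
    assert (HG : 10000 <= G).
    { unfold G, kap. assert (0 < 2 / (1 - c1)) by (apply Rdiv_lt_0_compat; lra). simpl. lra. }
    rewrite Ropp_involutive. apply (Rmult_le_reg_r G); [lra|].
    unfold Rdiv. rewrite Rmult_assoc, Rinv_l, Rmult_1_r by lra. nra. }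
  unfold arc_error in *. lra.
Qed.

(** [g 0 = 0] and [g' 0] is a positive real, so that [g] moves upwards along the imaginary axis. *)
Lemma cap_g_right_side :
  exists x, Cmod x < 1 /\ 0 < snd x /\ 0 < snd (cap_g arrow_Phi x).
Proof.
  assert (H01 : Cmod 0 < 1) by (rewrite Cmod_0; lra).
  assert (Hd := cap_g_deriv _ _ _ arrow_riemann 0 H01).
  rewrite (cap_integrand_0 _ _ _ arrow_riemann) in Hd.
  destruct (cap_k0_spec _ _ _ arrow_riemann) as [K0 [K1 _]].
  set (k0 := cap_k0 _ _ _ arrow_riemann) in *.
  (* In the charts at infinity [Phi] is [arrow_map] itself. *)
  assert (E : (/ k0)%C = arrow_deriv 0).
  { apply (has_deriv_unique arrow_map 0); [|now apply arrow_map_deriv].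
    apply has_deriv_ext with (2 := K1). intros x. unfold arrow_Phi. simpl.
    destruct (Ceq_dec x 0) as [->|Hx]; simpl; [symmetry; exact arrow_map_0|].
    now rewrite !Cinv_inv. }
  assert (Ek : k0 = RtoC (/ ((10 + kap) * (2 / 5)))).
  { rewrite <- (Cinv_inv k0), E. unfold arrow_deriv. rewrite slit_coord_0.
    rewrite RtoC_inv, RtoC_mult, RtoC_plus, RtoC_div. f_equal. field.
    all: unfold kap; lra. }
  clearbody k0. set (a := / ((10 + kap) * (2 / 5))) in *.
  assert (Ha : 0 < a) by (apply Rinv_0_lt_compat; unfold kap; lra).
  assert (g0 : cap_g arrow_Phi 0 = 0) by (unfold cap_g; apply Cmult_0_l).
  destruct (Hd (a / 2)) as [d [Hd0 Hd1]]; [lra|].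
  set (e := Rmin (d / 2) (/ 2)). assert (He : 0 < e) by (apply Rmin_pos; lra).
  assert (He1 : e <= d / 2) by apply Rmin_l. assert (He2 : e <= / 2) by apply Rmin_r.
  assert (Hm : Cmod (e * Ci) = e) by (rewrite Cmod_mult, Cmod_Ci, Cmod_R, Rabs_pos_eq; lra).
  exists (e * Ci)%C. split; [lra|]. split; [simpl; lra|].
  specialize (Hd1 (e * Ci)%C). replace (e * Ci - 0)%C with (e * Ci)%C in Hd1 by ring.
  rewrite Hm, g0, Ek in Hd1. specialize (Hd1 ltac:(lra)).
  assert (R1 := Cmod_Im_Lipschitz (cap_g arrow_Phi (e * Ci)%C) (a * (e * Ci))%C).
  replace (cap_g arrow_Phi (e * Ci) - 0 - a * (e * Ci))%C
    with (cap_g arrow_Phi (e * Ci) - a * (e * Ci))%C in Hd1 by ring.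
  apply Rabs_le_between in R1.
  assert (E3 : snd (a * (e * Ci))%C = a * e) by (simpl; ring).
  rewrite E3 in R1. nra.
Qed.

(** The upper half of the disk is convex, so the intermediate value theorem applies on the segment
    between the points with opposite signs of [Im g]. *)
Lemma cap_g_real_value :
  exists x, Cmod x < 1 /\ 0 < snd x /\ snd (cap_g arrow_Phi x) = 0.
Proof.
  destruct cap_g_wrong_side as [p [Hp1 [Hp2 Hp3]]].
  destruct cap_g_right_side as [q [Hq1 [Hq2 Hq3]]].
  assert (Hin : forall t : R, 0 <= t <= 1 ->
            Cmod (p + t * (q - p)) < 1 /\ 0 < snd (p + t * (q - p))%C).
  { intros t Ht. split.
    - now apply disk_convex.
    - simpl. destruct (Rle_lt_dec t (1 / 2)); nra. }
  destruct (IVT_interv (fun t : R => Im (cap_g arrow_Phi (p + t * (q - p))%C)) 0 1) as [t [Ht E]].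
  - intros t Ht. apply continuity_pt_filterlim.
    apply (ex_derive_continuous (fun t : R => Im (cap_g arrow_Phi (p + t * (q - p))%C))).
    eexists. apply (is_derive_Im (fun t : R => cap_g arrow_Phi (p + t * (q - p))%C)).
    apply has_deriv_along.
    apply (cap_g_deriv _ _ _ arrow_riemann).
    now apply Hin.
  - lra.
  - replace (p + 0%R * (q - p))%C with p by ring. exact Hp3.
  - replace (p + 1%R * (q - p))%C with q by ring. exact Hq3.
  - exists (p + t * (q - p))%C. destruct (Hin t Ht). repeat split; auto.
Qed.

Lemma arrow_development_not_injective :
  ~ injective_on (complement arrow_set) (cap_development arrow_Phi arrow_Psi).
Proof.
  destruct cap_g_real_value as [x [Hx [Him Hg]]]. intros Hinj.
  assert (Hne : forall y : C, Cmod y < 1 -> snd y <> 0 -> y <> 0 /\ 1 < Cmod (/ y)).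
  { intros y Hy Hi. assert (H0 : y <> 0) by (intros ->; now apply Hi).
    split; [exact H0|]. now apply Cmod_inv_gt_1. }
  destruct arrow_riemann as [[HU [_ [HPsi _]]] _].
  assert (Hdev : forall y, Cmod y < 1 -> snd y <> 0 ->
     complement arrow_set (arrow_Phi (Fin (/ y))) /\
     cap_development arrow_Phi arrow_Psi (arrow_Phi (Fin (/ y))) = cap_g arrow_Phi y).
  { intros y Hy Hi. destruct (Hne y Hy Hi) as [H0 H1]. split; [now apply (HU (Fin (/ y)))|].
    unfold cap_development. rewrite (HPsi (Fin (/ y)) H1). simpl. now rewrite Cinv_inv. }
  assert (Hxc : Cmod (Cconj x) < 1) by now rewrite Cmod_conj.
  assert (Hic : snd (Cconj x) <> 0) by (simpl; lra).
  destruct (Hdev x Hx ltac:(lra)) as [A1 A2]. destruct (Hdev (Cconj x) Hxc Hic) as [B1 B2].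
  assert (E := Hinj _ _ A1 B1).
  rewrite A2, B2, arrow_cap_g_conj in E by exact Hx.
  assert (E1 : cap_g arrow_Phi x = Cconj (cap_g arrow_Phi x)).
  { apply injective_projections; [reflexivity|].
    unfold Cconj. cbn [snd]. rewrite Hg. ring. }
  specialize (E E1). apply (f_equal arrow_Psi) in E.
  destruct (Hne x Hx ltac:(lra)) as [X0 X1]. destruct (Hne (Cconj x) Hxc Hic) as [Y0 Y1].
  rewrite (HPsi (Fin (/ x)) X1), (HPsi (Fin (/ Cconj x)) Y1) in E.
  apply (f_equal (coord chart_inf)) in E. simpl in E. rewrite !Cinv_inv in E.
  apply (f_equal snd) in E. simpl in E. lra.
Qed.

Theorem theorem1p1 :
  (forall (P : C -> Prop) (Phi Psi : sphere -> sphere),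
     planar_shape P -> riemann_map P Phi Psi ->
     locally_univalent unit_disk (cap_g Phi) /\
     euclidean_development P Psi (cap_development Phi Psi)) /\
  (exists (P : C -> Prop) (Phi Psi : sphere -> sphere),
     planar_shape P /\ riemann_map P Phi Psi /\
     ~ planar_cap P Psi /\
     ~ injective_on (complement P) (cap_development Phi Psi)).
Proof.
  split.
  - intros P Phi Psi HP HPhi. split.
    + exact (cap_g_locally_univalent P Phi Psi (proj1 HP) HPhi).
    + exact (cap_development_correct P Phi Psi (proj1 HP) HPhi).
  - exists arrow_set, arrow_Phi, arrow_Psi.
    split; [exact arrow_planar|]. split; [exact arrow_riemann|].
    split; [|exact arrow_development_not_injective].
    (* [planar_cap] makes every development injective, in particular this one. *)
    intros H. apply arrow_development_not_injective. apply H.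
    exact (cap_development_correct _ _ _ arrow_compact arrow_riemann).
Qed.
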